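(* Let $L>0$. Consider either the infinite periodic channel $\mathbb{T}_L\times\mathbb{R}$ or the finite periodic channel $\mathbb{T}_L\times[0,1]$. Suppose that there exists $c>0$ such that $c<g<c^{-1}$, that $\frac1g,f\in W^{3,\infty}$, and that $L\|f\|_{W^{3,\infty}}$ is sufficiently small. Let $\omega_0\in L^2$ and let $W$ be the solution of the linearized Euler equations in scattering formulation with initial datum $\omega_0$. Then there exists $W_\infty\in L^2$ such that $$W(t)\xrightarrow{L^2}W_\infty\quad\text{as }t\to\infty.$$
   Context: $\mathbb{T}_L=[0,L]/\sim$. The linearized Euler equations in scattering formulation are $$\partial_tW=f\,\partial_x\Phi,\qquad\big(\partial_x^2+(g(\partial_y-t\partial_x))^2\big)\Phi=W,\qquad W|_{t=0}=\omega_0,$$ on $\mathbb{T}_L\times\mathbb{R}$ or $\mathbb{T}_L\times[0,1]$, in the latter case with $\Phi=0$ for $y\in\{0,1\}$. The operator $g(\partial_y-t\partial_x)$ is $u\mapsto g\,(\partial_yu-t\partial_xu)$, its square is composition. The equations are understood mode by mode in the Fourier variable $k\in\frac{2\pi}{L}\mathbb{Z}$ dual to $x$; only modes $k\ne0$ of $\Phi$ enter and the $x$-average of $W$ is conserved in time. Here $U$ is a strictly increasing shear profile (a bijection of $\mathbb{R}$ for the infinite channel, a bijection $[a,b]\to[0,1]$ for the finite channel) and $g(z)=U'(U^{-1}(z))$, $f(z)=U''(U^{-1}(z))$ are functions of the variable $z=U(y)$, relabelled $y$. ''Sufficiently small'' means smaller than a positive constant depending only on $c$, an upper bound for $\|1/g\|_{W^{3,\infty}}$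 and an upper bound for $L$. *)

(* Defs.v *)
From HB Require Import structures.
From mathcomp Require Import all_boot all_order all_algebra.
From mathcomp Require Import complex.
From mathcomp Require Import all_classical all_reals all_analysis.

Set Implicit Arguments.
Unset Strict Implicit.
Unset Printing Implicit Defensive.

Import Order.TTheory GRing.Theory Num.Theory.
Import numFieldNormedType.Exports.

Local Open Scope classical_set_scope.
Local Open Scope ring_scope.
Local Open Scope complex_scope.

(** Complex-valued functions are handled through real and imaginary parts;
    real vorticities are the special case of zero imaginary part. Elements of
    [L^2] are represented by Borel functions on the plane or the line, and only
    their values almost everywhere on the relevant domain matter. *)

Section FunctionSpaces.
Variable R : realType.

Let leb := @lebesgue_measure R.

Definition complex_measurable d (T : measurableType d) (D : set T)
    (u : T -> R[i]) : Prop :=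
  measurable_fun D (fun x => complex.Re (u x)) /\
  measurable_fun D (fun x => complex.Im (u x)).

Definition L2norm d (T : measurableType d) (m : {measure set T -> \bar R})
    (D : set T) (u : T -> R[i]) : \bar R :=
  ('N[m]_(2%:E)[(fun x => (ComplexField.Normc.normc (u x))%:E) \_ D])%E.

Definition in_L2 d (T : measurableType d) (m : {measure set T -> \bar R})
    (D : set T) (u : T -> R[i]) : Prop :=
  complex_measurable D u /\ (L2norm m D u < +oo)%E.

Definition test_function (D : set R) (phi : R -> R) : Prop :=
  (forall n x, derivable (derive1n n phi) x 1) /\
  exists K : set R, [/\ compact K, K `<=` D & forall x, ~ K x -> phi x = 0].

(** [D] is meant to be open ([locally_integrable] enforces it). *)
Definition weak_derivative (D : set R) (u u' : R -> R) : Prop :=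
  [/\ locally_integrable D u, locally_integrable D u' &
      forall phi : R -> R, test_function D phi ->
        \int[leb]_(x in D) (u x * derive1 phi x) =
        - \int[leb]_(x in D) (u' x * phi x)].

(** [D] may carry its endpoints: derivatives are taken in the interior. The
    weak derivatives being unique almost everywhere, the infimum ranges over at
    most one value; it is [+oo] when [u] is not in [W^{m,oo}]. *)
Definition sobolev_oo_norm (m : nat) (D : set R) (u : R -> R) : \bar R :=
  ereal_inf [set s | exists h : nat -> R -> R,
    [/\ h 0%N = u,
        forall j, (j < m)%N -> weak_derivative D° (h j) (h j.+1) &
        s = (\sum_(j < m.+1) 'N[leb]_(+oo)[(fun x => (h j x)%:E) \_ D])%E]].

Definition complex_weak_derivative (D : set R) (u u' : R -> R[i]) : Prop :=
  weak_derivative D (fun x => complex.Re (u x)) (fun x => complex.Re (u' x)) /\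
  weak_derivative D (fun x => complex.Im (u x)) (fun x => complex.Im (u' x)).

End FunctionSpaces.

Section Fourier.
Variable R : realType.

Let leb := @lebesgue_measure R.

Definition expi (theta : R) : R[i] := cos theta +i* sin theta.

Definition wavenumber (L : R) (n : int) : R := 2 * pi / L * n%:~R.

(** [L^-1 * \int_0^L w (x, y) e^{-ikx} dx], with [k = wavenumber L n]. *)
Definition fourier_mode (L : R) (n : int) (w : R * R -> R[i]) (y : R) : R[i] :=
  let e x := w (x, y) * expi (- (wavenumber L n * x)) in
  (L^-1 * \int[leb]_(x in `[0, L]) complex.Re (e x)) +i*
  (L^-1 * \int[leb]_(x in `[0, L]) complex.Im (e x)).

End Fourier.

Inductive channel := InfiniteChannel | FiniteChannel.

Section LinearizedEuler.
Variable R : realType.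

Let leb := @lebesgue_measure R.

Definition cross_section (ch : channel) : set R :=
  match ch with
  | InfiniteChannel => setT
  | FiniteChannel => `[0, 1]
  end.

(** Fundamental domain of [T_L] times the cross section. *)
Definition channel_domain (ch : channel) (L : R) : set (R * R) :=
  `[0, L] `*` cross_section ch.

Definition plane_measure := (leb \x leb)%E.

Definition profile_domain (ch : channel) (I : set R) : Prop :=
  match ch with
  | InfiniteChannel => I = setT
  | FiniteChannel => exists a b : R, a < b /\ I = `[a, b]%classic
  end.

Definition shear_profile (ch : channel) (I : set R) (U : R -> R) : Prop :=
  [/\ profile_domain ch I,
      set_bij I (cross_section ch) U,
      (forall y z, I y -> I z -> y < z -> U y < U z) &
      forall y, I° y -> derivable U y 1 /\ derivable (derive1 U) y 1].

(** [g = U' \o U^-1] and [f = U'' \o U^-1]. *)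
Definition profile_coefficients (I : set R) (U g f : R -> R) : Prop :=
  forall y, I° y -> g (U y) = derive1 U y /\ f (U y) = derive1n 2 U y.

(** [v = g (d_y - t d_x) u] on the mode [e^{ikx}], i.e. [g (d_y u - ikt u)]. *)
Definition sheared_derivative (ch : channel) (g : R -> R) (k t : R)
    (u v : R -> R[i]) : Prop :=
  let D := cross_section ch in
  exists du : R -> R[i],
    [/\ in_L2 leb D u, in_L2 leb D du, in_L2 leb D v,
        complex_weak_derivative D° u du &
        {ae leb, forall y, D y ->
          v y = (g y)%:C * (du y - 'i%C * (k * t)%:C * u y)}].

(** The boundary values are those of the continuous representative. *)
Definition boundary_condition (ch : channel) (Phi : R -> R[i]) : Prop :=
  match ch with
  | InfiniteChannel => True
  | FiniteChannel =>
      [/\ {within `[0, 1], continuous (fun y => complex.Re (Phi y))},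
          {within `[0, 1], continuous (fun y => complex.Im (Phi y))},
          Phi 0 = 0 & Phi 1 = 0]
  end.

(** [(d_x^2 + (g (d_y - t d_x))^2) Phi = w] on the mode [e^{ikx}]. *)
Definition stream_function (ch : channel) (g : R -> R) (k t : R)
    (w Phi : R -> R[i]) : Prop :=
  boundary_condition ch Phi /\
  exists v z : R -> R[i],
    [/\ sheared_derivative ch g k t Phi v,
        sheared_derivative ch g k t v z &
        {ae leb, forall y, cross_section ch y ->
          - (k ^+ 2)%:C * Phi y + z y = w y}].

(** [w] is differentiable at [t], with derivative [dw], as a map from [0, oo)
    to [L^2]; the derivative is one-sided at [t = 0]. *)
Definition L2_derivative (ch : channel) (w : R -> R -> R[i]) (t : R)
    (dw : R -> R[i]) : Prop :=
  L2norm leb (cross_section ch)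
    (fun y => ((s - t)^-1)%:C * (w s y - w t y) - dw y)
    @[s --> within [set s | 0 <= s] t^'] --> (0 : \bar R).

Definition euler_scattering_solution (ch : channel) (L : R) (g f : R -> R)
    (w0 : R * R -> R[i]) (W : R -> R * R -> R[i]) : Prop :=
  let D := cross_section ch in
  [/\ (forall t, 0 <= t -> in_L2 plane_measure (channel_domain ch L) (W t)),
      {ae plane_measure, forall z, channel_domain ch L z -> W 0 z = w0 z},
      (forall t, 0 <= t -> {ae leb, forall y, D y ->
         fourier_mode L 0 (W t) y = fourier_mode L 0 w0 y}) &
      forall n : int, n != 0 ->
        let k := wavenumber L n in
        exists Phi : R -> R -> R[i], forall t, 0 <= t ->
          stream_function ch g k t (fourier_mode L n (W t)) (Phi t) /\
          L2_derivative ch (fun s => fourier_mode L n (W s)) t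
            (fun y => 'i%C * (k * f y)%:C * Phi t y)].

End LinearizedEuler.

(* Main.v *)
Require Import Defs.
From HB Require Import structures.
From mathcomp Require Import all_boot all_order all_algebra.
From mathcomp Require Import complex.
From mathcomp Require Import all_classical all_reals all_analysis.
From mathcomp Require Import measurable_realfun ring lra.

Set Implicit Arguments.
Unset Strict Implicit.
Unset Printing Implicit Defensive.

Import Order.TTheory GRing.Theory Num.Theory.
Import numFieldNormedType.Exports.

Local Open Scope classical_set_scope.
Local Open Scope ring_scope.

Opaque integral.

(** The equation is solved frequency by frequency in [x].  For a frequency [k <> 0] with modulus
    [kap], the modes of [W] and [Phi], extended by zero outside the channel, are functions on the
    line.  Let [G_t] be the multiplication by [e^(-ikty)], which carries the mode of [W t] back to
    the mode of the vorticity in the original variables, and let [S = kap (kap + d/dy)^-1], the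
    average over exponentially distributed shifts ([smear]).

    Three facts combine.

    - Elliptic estimate.  The function [p = G_t Phi_t] solves [(g d/dy)^2 p - k^2 p = G_t W_t].
      Testing this equation with [p / g] bounds the energy of [p] ([elliptic_energy]), and the
      product of a Lipschitz function with [p] is [S^* eta] for some [eta] that this energy bounds
      ([smear_representation]).  Using the second fact twice, for [p / g] and for [f p], one finds
      that the forcing [F = i k f Phi] satisfies [G_t F_t = S^* eta] where the norm of [eta] is at
      most [C] times that of [S G_t W_t] ([elliptic_smoothing], [stage_smoothing]).  The constant
      [C] is at most a multiple of [L] times the norm of [f], so the smallness assumption makes it
      as small as needed ([small_coupling]).

    - Inviscid damping.  Let [q_s u] be the square norm of [S G_s u].  For a fixed [u] the integral
      of [q_s u] over all times is at most [8 pi] times the square norm of [u]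
      ([time_smoothing_le]): as [s] grows, [G_s u] oscillates ever faster and the average over
      shifts destroys it.  Quantitatively, averaging over time turns the oscillating phase into a
      Fejer kernel in the difference of two shifts.

    - Lyapunov functional.  For small [C] the quantity
      [\int_t^T q_s (W t) ds + 1/2 * \int_0^t q_s (W s) ds] is nonincreasing in [t].  The moving
      end point of the first integral contributes [- q_t (W t)].  The forcing contributes twice the
      integral over [s] of the pairings of [S G_s F_t] with [S G_s W_t]; since [G_t F_t = S^* eta],
      these are the pairings of [S G_(s-t) eta] with [S G_(s-t) (S G_t W_t)], and damping bounds
      their integral by [8 pi C q_t (W t)] ([energy_bound]).  Hence [q_t (W t)] is integrable in
      time.  The increment of [W] between two times is bounded by the integral of [q_t (W t)]
      between them ([increment_le]), because the pairing of [F_t] with a fixed function [v] is that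
      of [eta] with [S G_t v], which is square integrable in time.  So each mode converges, and its
      increments are bounded by its initial value ([mode_stability]).

    It remains to sum over [k].  The constants above do not depend on [k], so the square norms of
    the increments of the modes are dominated by those of the initial vorticity, which are summable
    by Bessel's inequality ([plane_bessel]); with Parseval's identity ([plane_parseval]) and the
    conservation of the average in [x], the trajectory is Cauchy in mean square
    ([cauchy_of_modes]), and it converges by completeness ([L2_complete]).  Both facts on Fourier
    series come from one identity that expands the Fejer means of a double integral
    ([circle_energy]). *)

(** * Square-integrable functions *)

Section InnerProduct.
Context d (T : measurableType d) (R : realType) (mu : {measure set T -> \bar R}).
Implicit Types (u v w : T -> R).

Definition ip u v : R := \int[mu]_x (u x * v x).

Record L2 u : Prop := MkL2 {
  L2_measurable : measurable_fun setT u;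
  L2_sqr_integrable : mu.-integrable setT (EFin \o (fun x => u x ^+ 2)) }.

Lemma L2_Lfun u : L2 u <-> u \in Lfun mu 2%:E.
Proof.
split=> [[mu_ /integrableP[_ iu]]|l2]; last first.
  split; last exact: Lfun2_integrable_sqr.
  by move: l2; rewrite inE => /andP[]; rewrite inE.
rewrite inE; apply/andP; split; rewrite inE//=.
rewrite /finite_norm unlock; apply: poweR_lty.
rewrite (le_lt_trans _ iu)//.
under eq_integral do rewrite /= powR_mulrn//.
by under [leRHS]eq_integral do rewrite /= normrX.
Qed.

Lemma L2_ip_integrable u v : L2 u -> L2 v ->
  mu.-integrable setT (EFin \o (fun x => u x * v x)).
Proof. by move=> /L2_Lfun Lu /L2_Lfun Lv; apply/Lfun1_integrable/Lfun2_mul_Lfun1. Qed.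

Lemma L2D u v : L2 u -> L2 v ->
  L2 (fun x => u x + v x).
Proof. move=> /L2_Lfun Lu /L2_Lfun Lv; apply/L2_Lfun.
exact: ((Lfun_addr_closed mu (lee1n 2)).2 u v Lu Lv). Qed.

Lemma L2Z a u : L2 u -> L2 (fun x => a * u x).
Proof.
move=> /L2_Lfun Lu; apply/L2_Lfun; have [L0 LZ] := Lfun_submod_closed mu (lee1n 2).
have := LZ a u 0 Lu L0; rewrite addr0; exact.
Qed.

Lemma L2N u : L2 u -> L2 (fun x => - u x).
Proof. by move=> /L2_Lfun Lu; apply/L2_Lfun; exact: (rpredNr Lu). Qed.

Lemma L2B u v : L2 u -> L2 v ->
  L2 (fun x => u x - v x).
Proof. by move=> Lu Lv; exact: L2D Lu (L2N Lv). Qed.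

Lemma ipC u v : ip u v = ip v u.
Proof. by apply: eq_Rintegral => x _; rewrite mulrC. Qed.

Lemma ipDl u v w : L2 u -> L2 v ->
  L2 w -> ip (fun x => u x + v x) w = ip u w + ip v w.
Proof.
move=> Lu Lv Lw; rewrite -RintegralD//; try exact: L2_ip_integrable.
by apply: eq_Rintegral => x _; rewrite mulrDl.
Qed.

Lemma ipZl a u w : L2 u -> L2 w ->
  ip (fun x => a * u x) w = a * ip u w.
Proof.
move=> Lu Lw; rewrite -RintegralZl//; try exact: L2_ip_integrable.
by apply: eq_Rintegral => x _; rewrite mulrA.
Qed.

Lemma ipDr u v w : L2 u -> L2 v ->
  L2 w -> ip w (fun x => u x + v x) = ip w u + ip w v.
Proof. by move=> Lu Lv Lw; rewrite ipC ipDl// !(ipC w). Qed.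

Lemma ipZr a u w : L2 u -> L2 w ->
  ip w (fun x => a * u x) = a * ip w u.
Proof. by move=> Lu Lw; rewrite ipC ipZl// (ipC w). Qed.

Lemma ip_ge0 u : 0 <= ip u u.
Proof. by apply: Rintegral_ge0 => x _; rewrite -expr2 sqr_ge0. Qed.

Lemma ip_norm_le u v : L2 u -> L2 v ->
  \int[mu]_x `|u x * v x| <= (ip u u + ip v v) / 2.
Proof.
move=> Lu Lv.
have iu := L2_ip_integrable Lu Lu; have iv := L2_ip_integrable Lv Lv.
have iuv := L2_ip_integrable Lu Lv.
rewrite mulrC -RintegralD// -RintegralZl//; last first.
  exact: (integrableD _ iu iv).
apply: le_Rintegral => //.
- exact: (integrable_norm iuv).
- exact: (integrableZl measurableT _ (integrableD measurableT iu iv)).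
- move=> x _; rewrite normrM.
  have uu : u x * u x = `|u x| * `|u x| by rewrite -normrM ger0_norm// -expr2 sqr_ge0.
  have vv : v x * v x = `|v x| * `|v x| by rewrite -normrM ger0_norm// -expr2 sqr_ge0.
  rewrite uu vv; have := sqr_ge0 (`|u x| - `|v x|); nra.
Qed.

Lemma le_norm_ip u v : L2 u -> L2 v ->
  `|ip u v| <= (ip u u + ip v v) / 2.
Proof.
move=> Lu Lv; apply: le_trans (ip_norm_le Lu Lv).
by apply: le_normr_Rintegral => //; exact: L2_ip_integrable.
Qed.

Lemma cauchy_schwarz u v : L2 u -> L2 v ->
  ip u v ^+ 2 <= ip u u * ip v v.
Proof.
move=> Lu Lv.
have quad t : 0 <= ip u u + 2 * t * ip u v + t ^+ 2 * ip v v.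
  have Lw := L2D Lu (L2Z t Lv).
  have := ip_ge0 (fun x => u x + t * v x).
  rewrite ipDl ?ipDr ?ipZl ?ipZr//; try exact: L2Z.
  by rewrite (ipC v u); lra.
have [v0|v0] := eqVneq (ip v v) 0.
  rewrite v0 mulr0; move: quad; rewrite v0 => quad.
  have [->|uv0] := eqVneq (ip u v) 0; first by rewrite expr0n.
  have := quad (- (ip u u + 1) / (2 * ip u v)).
  rewrite (_ : 2 * _ * ip u v = - (ip u u + 1)); first by lra.
  by field.
have vgt0 : 0 < ip v v by rewrite lt_neqAle eq_sym v0 ip_ge0.
have := quad (- ip u v / ip v v).
rewrite -(@pmulr_rge0 _ (ip v v))//.
have -> : ip v v * (ip u u + 2 * (- ip u v / ip v v) * ip u v +
   (- ip u v / ip v v) ^+ 2 * ip v v) = ip u u * ip v v - ip u v ^+ 2 by field.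
by rewrite subr_ge0.
Qed.

Lemma ip_young l u v : 0 < l -> L2 u -> L2 v ->
  2 * ip u v <= l * ip u u + l^-1 * ip v v.
Proof.
move=> l0 Lu Lv.
have := ip_ge0 (fun x => l * u x + (-1) * v x).
have lu := L2Z l Lu; have lv := L2Z (-1) Lv.
rewrite ipDl ?ipDr ?ipZl ?ipZr//; try exact: L2D.
rewrite (ipC v u) => H.
rewrite -(@ler_pM2l _ l)// mulrDr !mulrA mulfV ?gt_eqF// mul1r.
nra.
Qed.

Lemma L2_bounded_mul (b : T -> R) u (M : R) : measurable_fun setT b ->
  (forall x, `|b x| <= M) -> L2 u ->
  L2 (fun x => b x * u x).
Proof.
move=> mb bM Lu; split.
  by apply: measurable_funM => //; exact: L2_measurable.
have Lu2 := L2_sqr_integrable Lu.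
have := integrableZl measurableT (M ^+ 2) Lu2; apply: le_integrable => //.
  apply/measurable_EFinP/measurable_funX/measurable_funM => //.
  exact: L2_measurable.
move=> x _ /=; rewrite lee_fin exprMn [leLHS]normrM [leRHS]normrM ler_wpM2r ?normr_ge0//.
rewrite !normrX.
have M0 : 0 <= M by apply: le_trans (bM x).
by rewrite ler_pXn2r ?nnegrE// (ger0_norm M0).
Qed.

Lemma eq_ae_Rintegral u v : measurable_fun setT u -> measurable_fun setT v ->
  {ae mu, forall x, u x = v x} -> \int[mu]_x u x = \int[mu]_x v x.
Proof.
move=> mu_ mv uv; congr fine; apply: ae_eq_integral => //.
- exact/measurable_EFinP.
- exact/measurable_EFinP.
- by apply: filterS uv => x /= ->.
Qed.

Lemma L2_ae u v : measurable_fun setT v -> {ae mu, forall x, u x = v x} ->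
  L2 u -> L2 v.
Proof.
move=> mv uv [mu_ iu]; split => //.
apply/integrableP; split; first exact/measurable_EFinP/measurable_funX.
case/integrableP: iu => _; apply: le_lt_trans.
apply: ae_ge0_le_integral => //.
- exact/measurableT_comp/measurable_EFinP/measurable_funX.
- exact/measurableT_comp/measurable_EFinP/measurable_funX.
- by apply: filterS uv => x /= -> _.
Qed.

Lemma eq_ae_ip u u' v v' : measurable_fun setT u -> measurable_fun setT u' ->
  measurable_fun setT v -> measurable_fun setT v' ->
  {ae mu, forall x, u x = u' x} -> {ae mu, forall x, v x = v' x} ->
  ip u v = ip u' v'.
Proof.
move=> m1 m2 m3 m4 uu vv; apply: eq_ae_Rintegral.
- exact: measurable_funM.
- exact: measurable_funM.
- by apply: filterS2 uu vv => x -> ->.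
Qed.

End InnerProduct.

(** * Completeness and dominated convergence in mean square *)

Section Completeness.
Context d (T : measurableType d) (R : realType) (mu : {measure set T -> \bar R}).
Implicit Types (u v : T -> R).

Lemma cvgn_EFin (a : nat -> R) (l : R) : a @ \oo --> l -> (fun n => (a n)%:E) @ \oo --> l%:E.
Proof. by move=> al; apply: cvg_EFin => //; exact: nearW. Qed.

Lemma cvgn_sqr_dist (a : nat -> R) (c l : R) : a @ \oo --> l ->
  (fun n => (c - a n) ^+ 2) @ \oo --> (c - l) ^+ 2.
Proof.
move=> al; have cc : (fun n => c - a n) @ \oo --> c - l by apply: cvgB => //; exact: cvg_cst.
by rewrite expr2; under eq_fun do rewrite expr2; exact: cvgM.
Qed.

Lemma L2_le u v : measurable_fun setT u -> L2 mu v -> (forall x, u x ^+ 2 <= v x ^+ 2) -> L2 mu u.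
Proof.
move=> mu_ [mv iv] uv; split=> //; apply: le_integrable iv => //.
  by apply/measurable_EFinP; exact: measurable_funX.
by move=> x _ /=; rewrite lee_fin !ger0_norm ?sqr_ge0.
Qed.

Lemma sqr_integral u : L2 mu u -> (\int[mu]_x (u x ^+ 2)%:E = (ip mu u u)%:E)%E.
Proof.
move=> Lu; rewrite /ip /Rintegral fineK; first by apply: eq_integral => x _; rewrite expr2.
exact: (integrable_fin_num _ (L2_ip_integrable Lu Lu)).
Qed.

Lemma L2_integral_le u (e : R) : measurable_fun setT u ->
  (\int[mu]_x (u x ^+ 2)%:E <= e%:E)%E -> L2 mu u /\ ip mu u u <= e.
Proof.
move=> mu_ ue; have Lu : L2 mu u.
  split=> //; apply/integrableP; split.
    by apply/measurable_EFinP; exact: measurable_funX.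
  apply: le_lt_trans (ltry e); apply: le_trans ue; rewrite le_eqVlt; apply/orP; left.
  by apply/eqP/eq_integral => x _ /=; rewrite ger0_norm ?sqr_ge0.
by split=> //; rewrite -lee_fin -sqr_integral.
Qed.

Lemma sqr_le_of_norm (a b : R) : `|a| <= b -> a ^+ 2 <= b ^+ 2.
Proof.
by move=> ab; rewrite -(real_normK (num_real a)) ler_sqr ?nnegrE// (le_trans _ ab).
Qed.

Lemma L2_dominated (w : nat -> T -> R) G v : (forall n, measurable_fun setT (w n)) ->
  measurable_fun setT v -> L2 mu G -> (forall n x, `|w n x| <= G x) -> (forall x, `|v x| <= G x) ->
  {ae mu, forall x, (fun n => w n x) @ \oo --> v x} ->
  forall e : R, 0 < e -> exists n, ip mu (fun x => v x - w n x) (fun x => v x - w n x) <= e.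
Proof.
move=> mw mv LG wG vG wv e e0.
have Lw n : L2 mu (w n) by apply: (L2_le _ LG) => // x; exact: sqr_le_of_norm.
have Lv : L2 mu v by apply: (L2_le _ LG) => // x; exact: sqr_le_of_norm.
pose f n x : \bar R := ((v x - w n x) ^+ 2)%:E.
have mf n : measurable_fun setT (f n).
  by apply/measurable_EFinP; apply: measurable_funX; exact: measurable_funB.
have f0 : {ae mu, forall x, setT x -> (f ^~ x) @ \oo --> (0%:E : \bar R)}.
  apply: filterS wv => x c _; rewrite /f.
  have := cvgn_EFin (cvgn_sqr_dist (c := v x) c).
  by rewrite subrr expr0n.
have iG : mu.-integrable setT (fun x => ((2 * G x) ^+ 2)%:E) by have [] := L2Z 2 LG.
have fG : {ae mu, forall x n, setT x -> (`|f n x| <= ((2 * G x) ^+ 2)%:E)%E}.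
  apply: aeW => x n _; rewrite /f /= lee_fin ger0_norm ?sqr_ge0//.
  apply: sqr_le_of_norm; apply: le_trans (ler_normB _ _) _.
  by rewrite mulr_natl mulr2n lerD.
have [_ _ c] := dominated_convergence measurableT mf (measurable_cst (0%:E : \bar R)) f0 iG fG.
rewrite integral0 in c.
have [n _ /(_ n (leqnn n)) /= h] : \forall n \near \oo, (\int[mu]_x f n x < e%:E)%E.
  apply: (c [set x | (x < e%:E)%E]).
  by apply: (@nbhs_open_ereal_lt _ _ (fun=> e)).
exists n; rewrite -lee_fin -(sqr_integral (L2B Lv (Lw n))).
exact: ltW.
Qed.

Section FastCauchy.
Variable p : nat -> T -> R.
Hypothesis Lp : forall k, L2 mu (p k).
Hypothesis p_fast : forall k,
  ip mu (fun x => p k.+1 x - p k x) (fun x => p k.+1 x - p k x) <= 8^-1 ^+ k.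

Let inc k x : \bar R := (4 ^+ k * (p k.+1 x - p k x) ^+ 2)%:E.

Let inc_ge0 k x : (0 <= inc k x)%E.
Proof. by rewrite lee_fin mulr_ge0 ?sqr_ge0 ?exprn_ge0. Qed.

Let Linc k : L2 mu (fun x => p k.+1 x - p k x).
Proof. exact: L2B. Qed.

Let measurable_inc k : measurable_fun setT (inc k).
Proof.
apply/measurable_EFinP; apply: measurable_funM => //; apply: measurable_funX.
by have [] := Linc k.
Qed.

Let sum_inc_finite : {ae mu, forall x, setT x -> (\sum_(k <oo) inc k x)%E \is a fin_num}.
Proof.
apply: integrable_ae => //; apply/integrableP; split.
  by apply: ge0_emeasurable_sum => // k x _ _; exact: inc_ge0.
have -> : (\int[mu]_x `|\sum_(k <oo) inc k x| = \int[mu]_x \sum_(k <oo) inc k x)%E.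
  by apply: eq_integral => x _; rewrite gee0_abs//; apply: nneseries_ge0 => k _ _; exact: inc_ge0.
rewrite integral_nneseries//; try by move=> k x _; exact: inc_ge0.
apply: (@le_lt_trans _ _ (\sum_(k <oo) (2^-1 ^+ k)%:E)%E).
  apply: lee_nneseries => k _; first by move=> _; apply: integral_ge0 => x _; exact: inc_ge0.
  rewrite /inc; under eq_integral do rewrite EFinM.
  rewrite ge0_integralZl_EFin ?exprn_ge0//.
  - rewrite (sqr_integral (Linc k)) -EFinM lee_fin.
    have -> : 2^-1 ^+ k = 4 ^+ k * 8^-1 ^+ k :> R by rewrite -exprMn; congr (_ ^+ _); lra.
    by rewrite ler_wpM2l ?exprn_ge0.
  - by move=> x _; rewrite lee_fin sqr_ge0.
  - by apply/measurable_EFinP; apply: measurable_funX; have [] := Linc k.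
have h : `|2^-1 : R| < 1 by rewrite ger0_norm; lra.
have c := @cvg_geometric_series R 1 2^-1 h.
have -> : (\sum_(k <oo) (2^-1 ^+ k)%:E)%E = (1 * (1 - 2^-1)^-1)%:E :> \bar R.
  apply/cvg_lim => //.
  apply: cvg_EFin; first by apply: nearW => n; rewrite sumEFin.
  rewrite (_ : _ \o _ = series (geometric 1 2^-1)) //.
  apply/funext => n /=; rewrite sumEFin seriesEnat /=.
  by apply: eq_bigr => i _; rewrite mul1r.
exact: ltry.
Qed.

(** The increments are summable in mean square with the weights [4 ^ k], hence geometrically
    small at almost every point. *)
Lemma fast_cauchy_cvg : {ae mu, forall x, cvgn (fun k => p k x)}.
Proof.
apply: filterS sum_inc_finite => x /(_ I) fx.
set S := (\sum_(k <oo) inc k x)%E in fx.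
have S0 : (0 <= S)%E by apply: nneseries_ge0 => k _ _; exact: inc_ge0.
have incS k : `|p k.+1 x - p k x| <= geometric (Num.sqrt (fine S)) 2^-1 k.
  have : (inc k x <= S)%E.
    apply: le_trans (nneseries_lim_ge k.+1 _); last by move=> n _ _; exact: inc_ge0.
    by rewrite big_nat_recr//= leeDr// sume_ge0// => n _; exact: inc_ge0.
  rewrite -[in X in X -> _](fineK fx) lee_fin => h.
  have fS : 0 <= fine S by exact: fine_ge0.
  rewrite /= -(@ler_pXn2r _ 2)// ?nnegrE ?mulr_ge0 ?sqrtr_ge0 ?exprn_ge0//.
  rewrite real_normK ?num_real// exprMn sqr_sqrtr// -exprM mulnC exprM.
  have -> : 2^-1 ^+ 2 = 4^-1 :> R by rewrite exprVn; congr (_^-1); ring.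
  by rewrite exprVn ler_pdivlMr ?exprn_gt0// mulrC.
have cs : cvgn (series (telescope (fun k => p k x : R^o))).
  apply: normed_cvg; apply: (series_le_cvg _ _ incS) => [n|n|].
  - exact: normr_ge0.
  - by rewrite mulr_ge0 ?sqrtr_ge0 ?exprn_ge0.
  - by apply: is_cvg_geometric_series; rewrite ger0_norm; lra.
rewrite (_ : (fun k => p k x) = (fun k => p 0%N x + series (telescope (fun k => p k x)) k)).
  by apply: is_cvgD; [exact: is_cvg_cst|exact: cs].
by apply/funext => k; exact: (eq_sum_telescope (fun k => p k x)).
Qed.

End FastCauchy.

(** The limit is taken along a sequence of times with increments so small that they are summable
    at almost every point; Fatou's lemma controls the distance to it. *)
Lemma L2_complete (u : R -> T -> R) : (forall t, 0 <= t -> L2 mu (u t)) ->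
  (forall e : R, 0 < e -> exists2 T0 : R, 0 <= T0 & forall t t', T0 <= t -> T0 <= t' ->
     ip mu (fun x => u t' x - u t x) (fun x => u t' x - u t x) <= e) ->
  exists2 v, L2 mu v & forall e : R, 0 < e -> exists2 T0 : R, 0 <= T0 & forall t, T0 <= t ->
     ip mu (fun x => u t x - v x) (fun x => u t x - v x) <= e.
Proof.
move=> Lu cu.
have e0 k : 0 < 8^-1 ^+ k :> R by rewrite exprn_gt0.
pose tt k := s2val (cid2 (cu _ (e0 k))).
have tt0 k : 0 <= tt k by rewrite /tt; case: cid2.
have ttP k t t' : tt k <= t -> tt k <= t' ->
    ip mu (fun x => u t' x - u t x) (fun x => u t' x - u t x) <= 8^-1 ^+ k.
  by rewrite /tt; case: cid2 => /= T0 _; apply.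
pose s k := \sum_(i < k.+1) (tt i + 1).
have ts k : tt k <= s k.
  have h : 0 <= \sum_(i < k) (tt i + 1) by apply: sumr_ge0 => i _; rewrite addr_ge0.
  by rewrite /s big_ord_recr/= addrCA lerDl addr_ge0.
have s_mono k : s k <= s k.+1.
  by rewrite /s [leRHS]big_ord_recr/= lerDl addr_ge0.
have sk k : k%:R <= s k.
  elim: k => [|k IH]; first exact: le_trans (ts _).
  by rewrite /s big_ord_recr/= -natr1 lerD// lerDr.
have s0 k : 0 <= s k := le_trans (tt0 k) (ts k).
pose p k := u (s k).
have Lp k : L2 mu (p k) by exact: Lu.
have pf k : ip mu (fun x => p k.+1 x - p k x) (fun x => p k.+1 x - p k x) <= 8^-1 ^+ k.
  by apply: ttP; [exact: ts|exact: le_trans (ts k) (s_mono k)].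
pose v x : R := fine (limn_esup (fun k => (p k x)%:E)).
have mp k : measurable_fun setT (p k) by have [] := Lp k.
have mv : measurable_fun setT v.
  by apply: measurableT_comp => //; apply: measurable_fun_limn_esup => k; exact/measurable_EFinP.
have pv : {ae mu, forall x, (fun k => p k x) @ \oo --> v x}.
  apply: filterS (fast_cauchy_cvg Lp pf) => x /cvg_ex[l pl].
  by rewrite /v (cvg_limn_einf_sup (cvgn_EFin pl)).2.
have key (e : R) : 0 < e -> exists2 T0 : R, 0 <= T0 & forall t, T0 <= t ->
    L2 mu (fun x => u t x - v x) /\ ip mu (fun x => u t x - v x) (fun x => u t x - v x) <= e.
  move=> e_gt0; have [T0 T00 TP] := cu e e_gt0; exists T0 => // t Tt.
  have t0 := le_trans T00 Tt.
  have [mut _] := Lu t t0.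
  have mtv : measurable_fun setT (fun x => u t x - v x) by exact: measurable_funB.
  apply: L2_integral_le => //.
  pose N := Num.bound T0.
  have TN n : T0 <= s (n + N)%N.
    apply: le_trans (sk _); rewrite natrD ler_wpDl//.
    by rewrite ltW// archi_boundP.
  pose f n x : \bar R := ((u t x - p (n + N)%N x) ^+ 2)%:E.
  have mf n : measurable_fun setT (f n).
    by apply/measurable_EFinP; apply: measurable_funX; exact: measurable_funB.
  have f0 n x : setT x -> (0 <= f n x)%E by rewrite lee_fin sqr_ge0.
  have -> : (\int[mu]_x ((u t x - v x) ^+ 2)%:E = \int[mu]_x limn_einf (f ^~ x))%E.
    apply: ae_eq_integral => //.
    - by apply/measurable_EFinP; exact: measurable_funX.
    - apply: measurableT_comp => //; apply: measurable_fun_limn_esup => n.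
      exact: measurableT_comp.
    - apply: filterS pv => x pvx _; apply/esym.
      have c : (fun n => (u t x - p (n + N)%N x) ^+ 2) @ \oo --> (u t x - v x) ^+ 2.
        apply: cvgn_sqr_dist.
        exact: (cvg_comp (fun n => (n + N)%N) (fun k => p k x) (cvg_addnr N) pvx).
      exact: (cvg_limn_einf_sup (cvgn_EFin c)).1.
  apply: le_trans (fatou mu measurableT mf f0) _.
  rewrite limn_einf_lim; apply: lime_le; first exact: is_cvg_einfs.
  apply: nearW => n; apply: le_trans (_ : _ <= \int[mu]_x f n x)%E _.
    by apply: ereal_inf_lbound; exists n => //=.
  rewrite (sqr_integral (L2B (Lu t t0) (Lp (n + N)%N))) lee_fin.
  exact: TP.
have [T0 T00 TP] := key 1 ltr01.
have Lv : L2 mu v.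
  have := L2B (Lu T0 T00) (TP T0 (lexx _)).1.
  by rewrite (_ : (fun x => _) = v)//; apply/funext => x; rewrite opprB addrC subrK.
exists v => // e /key[T1 T10 T1P]; exists T1 => // t /T1P[_ h]; exact: h.
Qed.

End Completeness.

(** * Fubini, translations and averages over random shifts *)

Section RealFubini.
Context d1 d2 (T1 : measurableType d1) (T2 : measurableType d2) (R : realType).
Context (m1 : {sigma_finite_measure set T1 -> \bar R}).
Context (m2 : {sigma_finite_measure set T2 -> \bar R}).

Lemma measurable_Rintegral_snd (f : T1 * T2 -> R) : measurable_fun setT f ->
  measurable_fun setT (fun x => \int[m2]_y f (x, y)).
Proof.
move=> mf; apply: measurableT_comp => //.
have mF : measurable_fun setT (EFin \o f) by exact/measurable_EFinP.
have -> : (fun x => \int[m2]_y (f (x, y))%:E)%E =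
  ((fun x => \int[m2]_y (EFin \o f)^\+ (x, y)) \-
   (fun x => \int[m2]_y (EFin \o f)^\- (x, y)))%E.
  apply/funext => x; rewrite [LHS]integralE; congr (_ - _)%E.
    by apply: eq_integral => y _; rewrite !funeposE.
  by apply: eq_integral => y _; rewrite !funenegE.
apply: emeasurable_funB.
  by apply: measurable_fun_fubini_tonelli_F => //; exact: measurable_funepos.
by apply: measurable_fun_fubini_tonelli_F => //; exact: measurable_funeneg.
Qed.

Lemma measurable_Rintegral_fst (f : T1 * T2 -> R) : measurable_fun setT f ->
  measurable_fun setT (fun y => \int[m1]_x f (x, y)).
Proof.
move=> mf; apply: measurableT_comp => //.
have mF : measurable_fun setT (EFin \o f) by exact/measurable_EFinP.
have -> : (fun y => \int[m1]_x (f (x, y))%:E)%E =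
  ((fun y => \int[m1]_x (EFin \o f)^\+ (x, y)) \-
   (fun y => \int[m1]_x (EFin \o f)^\- (x, y)))%E.
  apply/funext => y; rewrite [LHS]integralE; congr (_ - _)%E.
    by apply: eq_integral => x _; rewrite !funeposE.
  by apply: eq_integral => x _; rewrite !funenegE.
apply: emeasurable_funB.
  by apply: measurable_fun_fubini_tonelli_G => //; exact: measurable_funepos.
by apply: measurable_fun_fubini_tonelli_G => //; exact: measurable_funeneg.
Qed.

Context (f : T1 * T2 -> R).
Hypothesis intf : (m1 \x m2)%E.-integrable setT (EFin \o f).

Lemma Rintegral_prod12 :
  \int[m1]_x \int[m2]_y f (x, y) = \int[(m1 \x m2)%E]_z f z.
Proof.
congr fine; rewrite -(integral12_prod_meas1 intf).
have /measurable_EFinP mf := measurable_int _ intf.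
apply: ae_eq_integral => //.
- exact/measurable_EFinP/measurable_Rintegral_snd.
- exact: (measurable_fubini_F intf).
- apply: filterS (ae_integrable1 intf) => x Hx _.
  by rewrite fineK//; exact: integrable_fin_num.
Qed.

Lemma Rintegral_prod21 :
  \int[m2]_y \int[m1]_x f (x, y) = \int[(m1 \x m2)%E]_z f z.
Proof.
congr fine; rewrite -(integral21_prod_meas1 intf).
have /measurable_EFinP mf := measurable_int _ intf.
apply: ae_eq_integral => //.
- exact/measurable_EFinP/measurable_Rintegral_fst.
- exact: (measurable_fubini_G intf).
- apply: filterS (ae_integrable2 intf) => x Hx _.
  by rewrite fineK//; exact: integrable_fin_num.
Qed.

Lemma Rintegral_fubini :
  \int[m1]_x \int[m2]_y f (x, y) = \int[m2]_y \int[m1]_x f (x, y).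
Proof. by rewrite Rintegral_prod12 Rintegral_prod21. Qed.

End RealFubini.

Section Translation.
Context {R : realType}.
Notation leb := (@lebesgue_measure R).

Lemma continuous_measurableR (f : R -> R) : continuous f ->
  measurable_fun [set: measurableTypeR R] f.
Proof. exact: continuous_measurable_fun. Qed.

Lemma measurable_shift (a : R) :
  measurable_fun [set: measurableTypeR R] (fun x : measurableTypeR R => (x - a : measurableTypeR R)).
Proof. exact: measurable_funB. Qed.

Lemma lebesgue_shift (a : R) (A : set R) : measurable A ->
  pushforward leb (fun x : measurableTypeR R => (x - a : measurableTypeR R)) A
  = leb A.
Proof.
move=> mA; have mh := measurable_shift a.
pose h : {mfun measurableTypeR R >-> measurableTypeR R} :=
  HB.pack (fun x : measurableTypeR R => (x - a : measurableTypeR R))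
    (isMeasurableFun.Build _ _ _ _ _ mh).
apply/esym/(@lebesgue_measure_unique _ (pushforward leb h)) => // _ [[x y] _ <-].
rewrite /pushforward [X in _ = leb X](_ : _ = `]x + a, y + a]%classic); last first.
  by apply/seteqP; split => z /=; rewrite !in_itv/=; lra.
rewrite !lebesgue_measure_itv/= !lte_fin ltrD2r.
by case: ifPn => // _; rewrite -!EFinB; congr EFin; lra.
Qed.

Lemma ge0_integral_shift (a : R) (f : R -> \bar R) :
  measurable_fun [set: measurableTypeR R] f -> (forall x, 0 <= f x)%E ->
  (\int[leb]_x f (x - a)%R = \int[leb]_x f x)%E.
Proof.
move=> mf f0.
have := @ge0_integral_pushforward _ _ _ _ _ _ (measurable_shift a) leb setT f
  measurableT mf (fun x _ => f0 x).
rewrite preimage_setT => <-.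
apply: (eq_measure_integral leb) => [|mh A mA _]; first exact: measurable_shift.
exact: lebesgue_shift.
Qed.

Lemma integral_shift (a : R) (f : R -> \bar R) : measurable_fun [set: measurableTypeR R] f ->
  (\int[leb]_x f (x - a)%R = \int[leb]_x f x)%E.
Proof.
move=> mf; rewrite [LHS]integralE [RHS]integralE; congr (_ - _)%E.
  rewrite -(ge0_integral_shift a (measurable_funepos mf) (fun x => funepos_ge0 f x)).
  by apply: eq_integral => x _; rewrite !funeposE.
rewrite -(ge0_integral_shift a (measurable_funeneg mf) (fun x => funeneg_ge0 f x)).
by apply: eq_integral => x _; rewrite !funenegE.
Qed.

Lemma Rintegral_shift (a : R) (f : R -> R) : measurable_fun [set: measurableTypeR R] f ->
  \int[leb]_x f (x - a) = \int[leb]_x f x.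
Proof.
by move=> mf; congr fine; rewrite (@integral_shift a (EFin \o f))//; exact/measurable_EFinP.
Qed.

Definition tau (a : R) (u : R -> R) : R -> R := fun y => u (y - a).

Lemma measurable_tau a u : measurable_fun [set: measurableTypeR R] u -> measurable_fun [set: measurableTypeR R] (tau a u).
Proof. by move=> mu; apply: (measurableT_comp mu); exact: measurable_shift. Qed.

Lemma tau_tau a b u : tau a (tau b u) = tau (a + b) u.
Proof. by apply/funext => y; rewrite /tau; congr u; lra. Qed.

Lemma tau0 u : tau 0 u = u.
Proof. by apply/funext => y; rewrite /tau subr0. Qed.


Lemma L2_tau a (u : R -> R) : L2 leb u -> L2 leb (tau a u).
Proof.
move=> [mu /integrableP[_ iu]]; split; first exact: measurable_tau.
apply/integrableP; split.
  by apply/measurable_EFinP/measurable_funX; exact: (measurable_tau a mu).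
rewrite (ge0_integral_shift a (f := fun x => `|(u x ^+ 2)%:E|%E))//.
by apply: measurableT_comp => //; exact/measurable_EFinP/measurable_funX.
Qed.

Lemma ip_tau a (u v : R -> R) : L2 leb u -> L2 leb v ->
  ip leb (tau a u) (tau a v) = ip leb u v.
Proof.
move=> Lu Lv; rewrite /ip (Rintegral_shift a (f := fun x => u x * v x))//.
exact: (measurable_funM (L2_measurable Lu) (L2_measurable Lv)).
Qed.

Lemma ip_tau_swap a (u v : R -> R) : L2 leb u -> L2 leb v ->
  ip leb (tau a u) v = ip leb u (tau (- a) v).
Proof.
move=> Lu Lv; rewrite -(@ip_tau a u (tau (- a) v))//; last exact: L2_tau.
by rewrite tau_tau subrr tau0.
Qed.

End Translation.

Section Smear.
Context {R : realType} (P : probability (measurableTypeR R) R).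
Notation leb := (@lebesgue_measure R).
Implicit Types (u v : R -> R) (e r : R).

(** With [r] exponentially distributed of rate [kap], [e = 1] gives [kap (kap + d/dy)^-1] and [e
    = -1] its adjoint. As an average over random shifts, the operator is handled by Fubini and
    Jensen instead of Fourier transforms. *)
Definition smear e u y : R := \int[P]_r u (y - e * r).

Lemma measurable_smear_arg e u : measurable_fun [set: measurableTypeR R] u ->
  measurable_fun [set: measurableTypeR R * measurableTypeR R]
    (fun z : measurableTypeR R * measurableTypeR R => u (z.1 - e * z.2)).
Proof.
move=> mu; apply: (measurableT_comp mu).
by apply: measurable_funB => //; apply: measurable_funM.
Qed.

Lemma measurable_smear e u : measurable_fun [set: measurableTypeR R] u ->
  measurable_fun [set: measurableTypeR R] (smear e u).
Proof.
move=> mu.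
exact: (@measurable_Rintegral_snd _ _ _ _ _ P _ (measurable_smear_arg e mu)).
Qed.

Lemma integral_smear_sqr e u : L2 leb u ->
  (\int[leb]_y \int[P]_r ((u (y - e * r)) ^+ 2)%:E = \int[leb]_y ((u y) ^+ 2)%:E)%E.
Proof.
move=> Lu; have mu := L2_measurable Lu.
have m2 : measurable_fun [set: measurableTypeR R] (fun y => (u y ^+ 2)%:E).
  exact/measurable_EFinP/measurable_funX.
rewrite (fubini_tonelli (m1 := leb) (m2 := P)
  (fun z => ((u (z.1 - e * z.2)) ^+ 2)%:E)); last 2 first.
- by apply/measurable_EFinP/measurable_funX; exact: (measurable_smear_arg e mu).
- by move=> z; rewrite lee_fin sqr_ge0.
rewrite /=.
under eq_integral => r _.
  rewrite (@ge0_integral_shift _ (e * r) (fun y => (u y ^+ 2)%:E))//; last first.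
    by move=> y; rewrite lee_fin sqr_ge0.
  over.
by rewrite integral_cst//= probability_setT mule1.
Qed.

Lemma smear_sqr_integrable e u : L2 leb u ->
  (leb \x P)%E.-integrable setT
    (EFin \o (fun z => (u (z.1 - e * z.2)) ^+ 2)).
Proof.
move=> Lu; have mu := L2_measurable Lu.
apply/integrable12ltyP.
  by apply/measurable_EFinP/measurable_funX; exact: (measurable_smear_arg e mu).
under eq_integral => y _.
  under eq_integral => r _ do rewrite /= ger0_norm ?sqr_ge0//.
  over.
rewrite /= integral_smear_sqr//.
have /integrableP[_] := L2_sqr_integrable Lu.
by under eq_integral do rewrite /= ger0_norm ?sqr_ge0//.
Qed.

Lemma smear_prod_integrable e u v : L2 leb u -> L2 leb v ->
  (leb \x P)%E.-integrable setT
    (EFin \o (fun z => u (z.1 - e * z.2) * v z.1)).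
Proof.
move=> Lu Lv; have mu := L2_measurable Lu; have mv := L2_measurable Lv.
have i1 := smear_sqr_integrable e Lu.
have i2 := smear_sqr_integrable 0 Lv.
have i3 : (leb \x P)%E.-integrable setT (EFin \o (fun z =>
    u (z.1 - e * z.2) ^+ 2 + v (z.1 - 0 * z.2) ^+ 2)).
  exact: (integrableD measurableT i1 i2).
apply: le_integrable i3 => //.
  apply/measurable_EFinP/measurable_funM; first exact: (measurable_smear_arg e mu).
  exact: (measurableT_comp mv).
move=> z _ /=; rewrite mul0r subr0 lee_fin normrM.
rewrite [leRHS]ger0_norm ?addr_ge0 ?sqr_ge0//.
rewrite -(real_normK (num_real (u _))) -(real_normK (num_real (v _))).
have := sqr_ge0 (`|u (z.1 - e * z.2)| - `|v z.1|).
have := sqr_ge0 (`|u (z.1 - e * z.2)|); have := sqr_ge0 (`|v z.1|); nra.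
Qed.

(** Jensen's inequality, as Cauchy-Schwarz against the constant [1]. *)
Lemma sqr_smear_le e u y :
  P.-integrable setT (EFin \o (fun r => (u (y - e * r)) ^+ 2)) ->
  measurable_fun [set: measurableTypeR R] u ->
  (smear e u y) ^+ 2 <= \int[P]_r (u (y - e * r)) ^+ 2.
Proof.
move=> iu mu.
have Lu : L2 P (fun r => u (y - e * r)).
  split => //; apply: (measurableT_comp mu).
  by apply: measurable_funB => //; apply: measurable_funM.
have L1 : L2 P (fun _ : measurableTypeR R => 1 : R).
  split => //; rewrite /= expr1n.
  by apply: finite_measure_integrable_cst.
have := cauchy_schwarz Lu L1.
rewrite /ip; under eq_Rintegral do rewrite mulr1.
move/le_trans; apply; rewrite [X in _ * X](_ : _ = 1) ?mulr1; last first.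
  by rewrite /Rintegral integral_cst//= probability_setT mule1.
by rewrite le_eqVlt; apply/orP; left; apply/eqP/eq_Rintegral => r _; rewrite expr2.
Qed.

Lemma smear_L2_le e u : L2 leb u ->
  (\int[leb]_y ((smear e u y) ^+ 2)%:E <= \int[leb]_y ((u y) ^+ 2)%:E)%E.
Proof.
move=> Lu; have mu := L2_measurable Lu.
rewrite -(integral_smear_sqr e Lu).
apply: ae_ge0_le_integral => //.
- by move=> y _; rewrite lee_fin sqr_ge0.
- by apply/measurable_EFinP/measurable_funX; exact: (measurable_smear e mu).
- by move=> y _; apply: integral_ge0 => r _; rewrite lee_fin sqr_ge0.
- have m2 := measurable_funX 2 (measurable_smear_arg e mu).
  move/measurable_EFinP : m2 => m2.
  have f0 z : (0 <= ((u (z.1 - e * z.2)) ^+ 2)%:E)%E by rewrite lee_fin sqr_ge0.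
  exact: (@measurable_fun_fubini_tonelli_F _ _ _ _ _ P _ m2 f0).
- apply: filterS (ae_integrable1 (smear_sqr_integrable e Lu)) => y iy _.
  have := sqr_smear_le iy mu; rewrite -lee_fin => /le_trans; apply.
  by rewrite /Rintegral fineK//; exact: integrable_fin_num iy.
Qed.

Lemma L2_smear e u : L2 leb u -> L2 leb (smear e u).
Proof.
move=> Lu; have mu := L2_measurable Lu; have ms := measurable_smear e mu.
split; first exact: ms.
apply/integrableP; split; first by apply/measurable_EFinP/measurable_funX.
under eq_integral do rewrite /= ger0_norm ?sqr_ge0//.
apply: le_lt_trans (smear_L2_le e Lu) _.
have /integrableP[_] := L2_sqr_integrable Lu.
by under eq_integral do rewrite /= ger0_norm ?sqr_ge0//.
Qed.

Lemma ipE u : L2 leb u -> (ip leb u u)%:E = (\int[leb]_y ((u y) ^+ 2)%:E)%E.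
Proof.
move=> Lu; rewrite /ip /Rintegral.
have Li := L2_ip_integrable Lu Lu.
by rewrite fineK; [apply: eq_integral => y _; rewrite expr2|exact: integrable_fin_num Li].
Qed.

Lemma ip_smear_le e u : L2 leb u -> ip leb (smear e u) (smear e u) <= ip leb u u.
Proof.
move=> Lu; rewrite -lee_fin !ipE//; first exact: smear_L2_le.
exact: L2_smear.
Qed.

Lemma ip_smear e u v : L2 leb u -> L2 leb v ->
  ip leb (smear e u) v = \int[P]_r ip leb (tau (e * r) u) v.
Proof.
move=> Lu Lv.
rewrite -(Rintegral_fubini (smear_prod_integrable e Lu Lv)).
apply: eq_ae_Rintegral.
- apply: measurable_funM; last exact: L2_measurable Lv.
  exact: measurable_smear (L2_measurable Lu).
- have mf : measurable_fun setT (fun z : measurableTypeR R * measurableTypeR R =>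
    u (z.1 - e * z.2) * v z.1).
    apply: measurable_funM; first exact: measurable_smear_arg (L2_measurable Lu).
    exact: (measurableT_comp (L2_measurable Lv)).
  exact: (@measurable_Rintegral_snd _ _ _ _ _ P _ mf).
apply: filterS (ae_integrable1 (smear_sqr_integrable e Lu)) => y iy.
rewrite /smear -RintegralZr//=.
have mu := L2_measurable Lu.
have Lu' : L2 P (fun r => u (y - e * r)).
  split => //; apply: (measurableT_comp mu).
  by apply: measurable_funB => //; apply: measurable_funM.
have L1 : L2 P (fun _ : measurableTypeR R => 1 : R).
  split => //; rewrite /= expr1n.
  by apply: finite_measure_integrable_cst.
apply: eq_integrable (L2_ip_integrable Lu' L1) => // r _ /=.
by rewrite mulr1.
Qed.

Lemma ip_smear_adj e u v : L2 leb u -> L2 leb v ->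
  ip leb (smear e u) v = ip leb u (smear (- e) v).
Proof.
move=> Lu Lv; rewrite ip_smear// ipC ip_smear//.
by apply: eq_Rintegral => r _; rewrite ip_tau_swap// ipC mulNr.
Qed.

Lemma smear_tau e a u : smear e (tau a u) = tau a (smear e u).
Proof.
by apply/funext => y; apply: eq_Rintegral => r _; rewrite /tau; congr u; lra.
Qed.

End Smear.

(** * The smoothing forms of a mode *)

Section Correlation.
Context {R : realType} (P : probability (measurableTypeR R) R).
Notation leb := (@lebesgue_measure R).
Implicit Types (u v : R -> R).

Lemma measurable_ip_tau u v : L2 leb u -> L2 leb v ->
  measurable_fun [set: measurableTypeR R] (fun x => ip leb u (tau x v)).
Proof.
move=> Lu Lv.
have mf : measurable_fun setT (fun z : measurableTypeR R * measurableTypeR R =>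
    u z.1 * v (z.1 - z.2)).
  apply: measurable_funM; first exact: (measurableT_comp (L2_measurable Lu)).
  by apply: (measurableT_comp (L2_measurable Lv)); exact: measurable_funB.
exact: (@measurable_Rintegral_fst _ _ _ _ _ leb _ mf).
Qed.

Lemma norm_ip_tau_le u v x : L2 leb u -> L2 leb v ->
  `|ip leb u (tau x v)| <= (ip leb u u + ip leb v v) / 2.
Proof.
move=> Lu Lv; apply: le_trans (le_norm_ip Lu (L2_tau x Lv)) _.
by rewrite ip_tau.
Qed.

Lemma prod_bounded_integrable (M : R) (f : R * R -> R) :
  measurable_fun [set: measurableTypeR R * measurableTypeR R] f ->
  (forall z, `|f z| <= M) -> (P \x P)%E.-integrable setT (EFin \o f).
Proof.
move=> mf fM; apply/integrable12ltyP; first exact/measurable_EFinP.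
apply: (@le_lt_trans _ _ (\int[P]_x \int[P]_y M%:E)%E).
  have mabs : measurable_fun setT (fun z => `|(f z)%:E|%E).
    by apply: measurableT_comp => //; exact/measurable_EFinP.
  have M0 : 0 <= M by exact: le_trans (fM (0, 0)).
  apply: ge0_le_integral => //.
  - by move=> x _; exact: integral_ge0.
  - exact: (@measurable_fun_fubini_tonelli_F _ _ _ _ _ P _ mabs (fun z => abse_ge0 _)).
  - move=> x _; apply: ge0_le_integral => //.
    + by apply: (measurableT_comp mabs); exact: measurable_pair1.
    + by move=> y _; rewrite lee_fin.
rewrite /=; under eq_integral do rewrite integral_cst//= probability_setT mule1.
by rewrite integral_cst//= probability_setT mule1 ltry.
Qed.

Lemma measurable_diff (f : R -> R) : measurable_fun [set: measurableTypeR R] f ->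
  measurable_fun [set: measurableTypeR R * measurableTypeR R]
    (fun z => f (z.2 - z.1)).
Proof.
by move=> mf; apply: (measurableT_comp mf); exact: measurable_funB.
Qed.

Lemma ip_smear_smear u v : L2 leb u -> L2 leb v ->
  ip leb (smear P 1 u) (smear P 1 v) =
  \int[(P \x P)%E]_z ip leb u (tau (z.2 - z.1) v).
Proof.
move=> Lu Lv; rewrite ip_smear//; last exact: L2_smear.
have mi := measurable_diff (measurable_ip_tau Lu Lv).
have ii := prod_bounded_integrable mi (fun z => norm_ip_tau_le (z.2 - z.1) Lu Lv).
rewrite -(Rintegral_prod12 ii); apply: eq_Rintegral => r _.
rewrite ipC ip_smear//; last exact: L2_tau.
apply: eq_Rintegral => r' _ /=.
by rewrite !mul1r [LHS]ipC (ip_tau_swap r Lu (L2_tau r' Lv)) tau_tau addrC.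
Qed.

Lemma ip_smear_tau u v x : L2 leb u -> L2 leb v ->
  ip leb (smear P (-1) u) (tau x v) = ip leb u (tau x (smear P 1 v)).
Proof.
by move=> Lu Lv; rewrite (ip_smear_adj P (-1) Lu (L2_tau x Lv)) opprK smear_tau.
Qed.

End Correlation.


Section Rotation.
Context {R : realType} (P : probability (measurableTypeR R) R) (k : R).
Notation leb := (@lebesgue_measure R).
Notation cfun := ((R -> R) * (R -> R))%type.
Implicit Types (a b : cfun) (s x : R).

Definition L2c a := L2 leb a.1 /\ L2 leb a.2.
Definition ip2 a b : R := ip leb a.1 b.1 + ip leb a.2 b.2.
(** A pair stands for the complex function [a.1 + i a.2], and [rot s] for multiplication by
    [e^(-iksy)]. *)
Definition rot s a : cfun :=
  (fun y => cos (k * s * y) * a.1 y + sin (k * s * y) * a.2 y,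
   fun y => cos (k * s * y) * a.2 y - sin (k * s * y) * a.1 y).
Definition smear2 e a : cfun := (smear P e a.1, smear P e a.2).
(** What remains visible of [a] and [b] at time [s] once shearing has made them oscillate like
    [e^(-iksy)] and smearing has averaged the oscillation out. *)
Definition smoothing s a b : R := ip2 (smear2 1 (rot s a)) (smear2 1 (rot s b)).

(** [cor + i cori] is the complex correlation of [a] with the translates of [b], and [rcor s]
    the real part of its product with the phase that [rot s] attaches to a translation. *)
Definition cor a b x : R := ip leb a.1 (tau x b.1) + ip leb a.2 (tau x b.2).
Definition cori a b x : R := ip leb a.2 (tau x b.1) - ip leb a.1 (tau x b.2).
Definition rcor s a b x : R :=
  cos (k * s * x) * cor a b x + sin (k * s * x) * cori a b x.

Lemma continuous_cosM (c : R) : continuous (fun y : R => cos (c * y)).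
Proof.
move=> x; apply: continuous_comp; last exact: continuous_cos.
by apply: continuousM; [exact: cst_continuous|].
Qed.

Lemma continuous_sinM (c : R) : continuous (fun y : R => sin (c * y)).
Proof.
move=> x; apply: continuous_comp; last exact: continuous_sin.
by apply: continuousM; [exact: cst_continuous|].
Qed.

Lemma measurable_cosM (c : R) :
  measurable_fun [set: measurableTypeR R] (fun y => cos (c * y)).
Proof. by apply: continuous_measurableR; exact: continuous_cosM. Qed.

Lemma measurable_sinM (c : R) :
  measurable_fun [set: measurableTypeR R] (fun y => sin (c * y)).
Proof. by apply: continuous_measurableR; exact: continuous_sinM. Qed.

Lemma norm_cos_le (c : R) : `|cos c| <= 1.
Proof. by rewrite ler_norml cos_geN1 cos_le1. Qed.

Lemma norm_sin_le (c : R) : `|sin c| <= 1.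
Proof. by rewrite ler_norml sin_geN1 sin_le1. Qed.

Lemma L2_cosM (c : R) (u : R -> R) : L2 leb u -> L2 leb (fun y => cos (c * y) * u y).
Proof.
by move=> Lu; exact: (L2_bounded_mul (measurable_cosM c) (fun y => norm_cos_le _) Lu).
Qed.

Lemma L2_sinM (c : R) (u : R -> R) : L2 leb u -> L2 leb (fun y => sin (c * y) * u y).
Proof.
by move=> Lu; exact: (L2_bounded_mul (measurable_sinM c) (fun y => norm_sin_le _) Lu).
Qed.

Lemma L2c_rot s a : L2c a -> L2c (rot s a).
Proof.
by move=> [a1 a2]; split; [apply: L2D|apply: L2B];
  by [exact: L2_cosM|exact: L2_sinM].
Qed.

Lemma L2c_smear e a : L2c a -> L2c (smear2 e a).
Proof. by move=> [a1 a2]; split; exact: L2_smear. Qed.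

Lemma rot_rot s t a : rot s (rot t a) = rot (s + t) a.
Proof.
by congr pair; apply/funext => y /=; rewrite !mulrDr !mulrDl cosD sinD; ring.
Qed.

Lemma ip2_rot s a b : L2c a -> L2c b -> ip2 (rot s a) (rot s b) = ip2 a b.
Proof.
move=> La Lb; have [a1 a2] := La; have [b1 b2] := Lb.
have [c1 c2] := L2c_rot s La; have [d1 d2] := L2c_rot s Lb.
rewrite /ip2 -!RintegralD//; try exact: L2_ip_integrable.
apply: eq_Rintegral => y _ /=; have := cos2Dsin2 (k * s * y).
set c := cos _; set d := sin _ => cd.
transitivity ((c ^+ 2 + d ^+ 2) * (a.1 y * b.1 y + a.2 y * b.2 y)).
  by ring.
by rewrite cd mul1r.
Qed.

Lemma ip2_tau_rot s a b x : L2c a -> L2c b ->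
  ip leb (rot s a).1 (tau x (rot s b).1) + ip leb (rot s a).2 (tau x (rot s b).2)
  = rcor s a b x.
Proof.
move=> La Lb; have [a1 a2] := La; have [b1 b2] := Lb.
have [c1 c2] := L2c_rot s La; have [d1 d2] := L2c_rot s Lb.
have [tb1 tb2] := (L2_tau x b1, L2_tau x b2).
have [td1 td2] := (L2_tau x d1, L2_tau x d2).
rewrite /rcor /cor /cori -[in RHS]RintegralD//; try exact: L2_ip_integrable.
rewrite -[in RHS]RintegralB//; try exact: L2_ip_integrable.
have i1 := L2_ip_integrable a1 tb1; have i2 := L2_ip_integrable a2 tb2.
have i3 := L2_ip_integrable a2 tb1; have i4 := L2_ip_integrable a1 tb2.
have i12 := integrableD measurableT i1 i2.
have i34 := integrableB measurableT i3 i4.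
rewrite -!RintegralZl//.
rewrite -!RintegralD//; try exact: L2_ip_integrable;
  try exact: (integrableZl measurableT _ i12); try exact: (integrableZl measurableT _ i34).
apply: eq_Rintegral => y _ /=.
have -> : k * s * x = k * s * y - k * s * (y - x) by ring.
rewrite /tau /= cosB sinB; ring.
Qed.

Lemma measurable_cor a b : L2c a -> L2c b -> measurable_fun [set: measurableTypeR R] (cor a b).
Proof.
by move=> [a1 a2] [b1 b2]; apply: measurable_funD; exact: measurable_ip_tau.
Qed.

Lemma measurable_cori a b : L2c a -> L2c b -> measurable_fun [set: measurableTypeR R] (cori a b).
Proof.
by move=> [a1 a2] [b1 b2]; apply: measurable_funB; exact: measurable_ip_tau.
Qed.

Lemma measurable_rcor s a b : L2c a -> L2c b ->
  measurable_fun [set: measurableTypeR R] (rcor s a b).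
Proof.
move=> La Lb; apply: measurable_funD; apply: measurable_funM.
- exact: measurable_cosM.
- exact: measurable_cor.
- exact: measurable_sinM.
- exact: measurable_cori.
Qed.

Lemma norm_cor_le a b x : L2c a -> L2c b ->
  `|cor a b x| <= (ip2 a a + ip2 b b) / 2.
Proof.
move=> [a1 a2] [b1 b2]; apply: le_trans (ler_normD _ _) _.
have := norm_ip_tau_le x a1 b1; have := norm_ip_tau_le x a2 b2.
rewrite /ip2; lra.
Qed.

Lemma norm_cori_le a b x : L2c a -> L2c b ->
  `|cori a b x| <= (ip2 a a + ip2 b b) / 2.
Proof.
move=> [a1 a2] [b1 b2]; apply: le_trans (ler_normB _ _) _.
have := norm_ip_tau_le x a2 b1; have := norm_ip_tau_le x a1 b2.
rewrite /ip2; lra.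
Qed.

Lemma norm_rcor_le s a b x : L2c a -> L2c b ->
  `|rcor s a b x| <= ip2 a a + ip2 b b.
Proof.
move=> La Lb; apply: le_trans (ler_normD _ _) _; rewrite !normrM.
have h1 := norm_cor_le x La Lb; have h2 := norm_cori_le x La Lb.
have h3 := norm_cos_le (k * s * x); have h4 := norm_sin_le (k * s * x).
have := ler_pM (normr_ge0 _) (normr_ge0 _) h3 h1.
have := ler_pM (normr_ge0 _) (normr_ge0 _) h4 h2.
lra.
Qed.

(** Averaging over two independent shifts, the form sees only the correlation at their
    difference. *)
Lemma smoothingE s a b : L2c a -> L2c b ->
  smoothing s a b = \int[(P \x P)%E]_z rcor s a b (z.2 - z.1).
Proof.
move=> La Lb.
have [c1 c2] := L2c_rot s La; have [d1 d2] := L2c_rot s Lb.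
rewrite /smoothing /ip2 !ip_smear_smear// -RintegralD//.
- by apply: eq_Rintegral => z _; rewrite ip2_tau_rot.
- exact: (prod_bounded_integrable P (measurable_diff (measurable_ip_tau c1 d1))
    (fun z => norm_ip_tau_le (z.2 - z.1) c1 d1)).
- exact: (prod_bounded_integrable P (measurable_diff (measurable_ip_tau c2 d2))
    (fun z => norm_ip_tau_le (z.2 - z.1) c2 d2)).
Qed.

Lemma rcor_integrable s a b : L2c a -> L2c b ->
  (P \x P)%E.-integrable setT (EFin \o (fun z => rcor s a b (z.2 - z.1))).
Proof.
move=> La Lb.
exact: (prod_bounded_integrable P (measurable_diff (measurable_rcor s La Lb))
  (fun z => norm_rcor_le s (z.2 - z.1) La Lb)).
Qed.

(** Both sides average the same correlation function over the same differences of shifts. *)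
Lemma smoothing_smear s a b : L2c a -> L2c b ->
  smoothing s (smear2 (-1) a) b = smoothing s a (smear2 1 b).
Proof.
move=> La Lb.
rewrite (smoothingE s (L2c_smear (-1) La) Lb) (smoothingE s La (L2c_smear 1 Lb)).
have [a1 a2] := La; have [b1 b2] := Lb.
apply: eq_Rintegral => z _.
by rewrite /rcor /cor /cori /smear2 /= (ip_smear_tau _ _ a1 b1) (ip_smear_tau _ _ a2 b2)
  (ip_smear_tau _ _ a2 b1) (ip_smear_tau _ _ a1 b2).
Qed.

Lemma smoothing_rot s t a b : smoothing (s + t) a b = smoothing s (rot t a) (rot t b).
Proof. by rewrite /smoothing !rot_rot. Qed.

Lemma ip2_smear_le e a : L2c a -> ip2 (smear2 e a) (smear2 e a) <= ip2 a a.
Proof. by move=> [a1 a2]; apply: lerD; exact: ip_smear_le. Qed.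

Lemma smoothing_le s a : L2c a -> smoothing s a a <= ip2 a a.
Proof.
move=> La; apply: le_trans (ip2_smear_le 1 (L2c_rot s La)) _.
by rewrite ip2_rot.
Qed.

Lemma smoothing_ge0 s a : 0 <= smoothing s a a.
Proof. by apply: addr_ge0; exact: ip_ge0. Qed.

Lemma smoothingC s a b : smoothing s a b = smoothing s b a.
Proof. by rewrite /smoothing /ip2 ipC [X in _ + X]ipC. Qed.

Lemma continuous_smoothing a b : L2c a -> L2c b ->
  continuous (fun s => smoothing s a b).
Proof.
move=> La Lb s0.
have -> : (fun s => smoothing s a b) =
  (fun s => \int[(P \x P)%E]_z rcor s a b (z.2 - z.1)).
  by apply/funext => s; rewrite smoothingE.
apply: (@continuity_under_integral _ _ _ (P \x P)%E
  (fun s z => rcor s a b (z.2 - z.1)) setT measurableT (s0 - 1) (s0 + 1) _ _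
  (fun _ => ip2 a a + ip2 b b)).
- by move=> s _; exact: rcor_integrable.
- apply: aeW => z _ s _; rewrite /rcor.
  have E x : k * x * (z.2 - z.1) = (k * (z.2 - z.1)) * x by ring.
  under eq_fun do rewrite E.
  apply: cvgD; apply: cvgM; try exact: cvg_cst.
    exact: continuous_cosM.
  exact: continuous_sinM.
- apply: (@prod_bounded_integrable _ P (ip2 a a + ip2 b b)) => // z.
  rewrite ger0_norm// addr_ge0// /ip2; apply: addr_ge0; exact: ip_ge0.
- by move=> s _; apply: aeW => z _; exact: norm_rcor_le.
- by rewrite inE/= in_itv/=; lra.
Qed.

End Rotation.

Lemma smoothing_def {R : realType} (P : probability (measurableTypeR R) R) (k s : R) a b :
  smoothing P k s a b = ip2 (smear2 P 1 (rot k s a)) (smear2 P 1 (rot k s b)).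
Proof. by []. Qed.

(** * The time integral of the smoothing forms *)

Section FTC.
Context {R : realType}.
Notation leb := (@lebesgue_measure R).

Lemma is_derive_continuous (F f : R -> R) :
  (forall x : R, is_derive x 1 F (f x)) -> continuous F.
Proof.
by move=> dF x; apply: differentiable_continuous; apply/derivable1_diffP; case: (dF x).
Qed.

Lemma Rintegral_FTC (F f : R -> R) (a b : R) : a <= b ->
  (forall x : R, is_derive x 1 F (f x)) -> continuous f ->
  \int[leb]_(x in `[a, b]) f x = F b - F a.
Proof.
move=> ab dF cf; move: ab; rewrite le_eqVlt => /predU1P[->|ab].
  by rewrite set_itv1 Rintegral_set1 subrr.
have cF := is_derive_continuous dF.
rewrite /Rintegral (@continuous_FTC2 _ f F)//.
- exact: continuous_subspaceT.
- split.
  + by move=> x _; case: (dF x).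
  + exact/cvg_at_right_filter/cF.
  + exact/cvg_at_left_filter/cF.
- by move=> x _; rewrite derive1E; exact: derive_val.
Qed.

Lemma continuous_itv_integrable (f : R -> R) (a b : R) : continuous f ->
  leb.-integrable `[a, b] (EFin \o f).
Proof.
move=> cf; apply: continuous_compact_integrable; first exact: segment_compact.
exact: continuous_subspaceT.
Qed.

End FTC.

Section Fejer.
Context {R : realType}.
Notation leb := (@lebesgue_measure R).
Implicit Types t S x : R.

Lemma fejer_integral t S : 0 < S -> t != 0 ->
  \int[leb]_(s in `[0, S]) ((1 - s / S) * cos (t * s)) =
  (1 - cos (t * S)) / (S * t ^+ 2).
Proof.
move=> S0 t0.
pose F s := (1 - s / S) * sin (t * s) / t - cos (t * s) / (S * t ^+ 2).
have dF (s : R) : is_derive s 1 F ((1 - s / S) * cos (t * s)).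
  apply: is_derive_eq.
  rewrite /GRing.scale/=; field; rewrite t0 gt_eqF//.
have cf : continuous (fun s : R => (1 - s / S) * cos (t * s)).
  move=> s; apply: cvgM; last exact: continuous_cosM.
  by apply: cvgB; [exact: cvg_cst|apply: cvgM; [exact: cvg_id|exact: cvg_cst]].
rewrite (Rintegral_FTC (ltW S0) dF cf).
rewrite /F mulfV ?gt_eqF// subrr mul0r mul0r mulr0 sin0 cos0.
by field; rewrite t0 gt_eqF.
Qed.

Lemma sin_le_id t : 0 <= t -> sin t <= t.
Proof.
move=> t0.
have e1 := Rintegral_FTC t0 (@is_derive_sin R) (@continuous_cos R).
have e2 := Rintegral_FTC t0 (fun x => is_derive_id x 1) (@cst_continuous R R 1).
rewrite -[leLHS]subr0 -{1}sin0 -e1 -[leRHS]subr0 -e2; apply: le_Rintegral => //.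
- exact: continuous_itv_integrable (@continuous_cos R).
- by apply: continuous_itv_integrable => x; exact: cvg_cst.
Qed.

Lemma one_sub_cos_le_sqr t : 1 - cos t <= t ^+ 2 / 2.
Proof.
wlog t0 : t / 0 <= t.
  move=> H; have [|/ltW t0] := leP 0 t; first exact: H.
  by rewrite -cosN -sqrrN; apply: H; rewrite oppr_ge0.
have d1 (s : R) : is_derive s 1 (fun s => - cos s) (sin s).
  by apply: is_derive_eq; rewrite opprK.
have d2 (s : R) : is_derive s 1 (fun s => s ^+ 2 / 2) s.
  by apply: is_derive_eq; rewrite /GRing.scale/=; field.
have e1 := Rintegral_FTC t0 d1 (@continuous_sin R).
have e2 := Rintegral_FTC t0 d2 (fun x : R => @cvg_id _ (nbhs x)).
rewrite cos0 opprK addrC in e1.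
rewrite expr0n mul0r subr0 in e2.
rewrite -e1 -e2; apply: le_Rintegral => //.
- exact: continuous_itv_integrable (@continuous_sin R).
- by apply: continuous_itv_integrable => x; exact: cvg_id.
- by move=> x /=; rewrite in_itv/= => /andP[x0 _]; exact: sin_le_id.
Qed.

Lemma one_sub_cos_le t : 1 - cos t <= 4 * t ^+ 2 / (4 + t ^+ 2).
Proof.
have t2 := sqr_ge0 t.
rewrite ler_pdivlMr; last lra.
have c1 := cos_le1 t; have c2 := cos_geN1 t.
have := one_sub_cos_le_sqr t; nra.
Qed.

Definition fejer S t : R := \int[leb]_(s in `[0, S]) ((1 - s / S) * cos (t * s)).

Lemma fejer_ge0 S t : 0 < S -> 0 <= fejer S t.
Proof.
move=> S0; have [->|t0] := eqVneq t 0.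
  apply: Rintegral_ge0 => s /=; rewrite in_itv/= => /andP[s0 sS].
  by rewrite mul0r cos0 mulr1 subr_ge0 ler_pdivrMr// mul1r.
rewrite /fejer fejer_integral// divr_ge0//.
by rewrite mulr_ge0 ?sqr_ge0// ltW.
Qed.

(** The bound is a Cauchy density of width [2 / S] in [t], which [integral_cauchy] integrates. *)
Lemma fejer_le S t : 0 < S -> fejer S t <= S / (1 + (t * S / 2) ^+ 2).
Proof.
move=> S0; have [->|t0] := eqVneq t 0.
  rewrite !mul0r expr0n addr0 divr1.
  have E : \int[leb]_(s in `[0, S]) (1 : R) = S.
    by rewrite Rintegral_cst//= lebesgue_measure_itv/= lte_fin S0 oppr0 adde0 mul1r.
  rewrite -[leRHS]E; apply: le_Rintegral => //.
  - apply: continuous_itv_integrable => s; apply: cvgM; last exact: continuous_cosM.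
    by apply: cvgB; [exact: cvg_cst|apply: cvgM; [exact: cvg_id|exact: cvg_cst]].
  - by apply: continuous_itv_integrable => s; exact: cvg_cst.
  - move=> s /=; rewrite in_itv/= => /andP[s0 sS].
    by rewrite mul0r cos0 mulr1 gerBl mulr_ge0// invr_ge0 ltW.
rewrite /fejer fejer_integral//.
have t2 : 0 < t ^+ 2 by rewrite exprn_even_gt0.
have S2 : 0 < S ^+ 2 by rewrite exprn_gt0.
rewrite (ler_pdivrMr _ _ (mulr_gt0 S0 t2)).
apply: le_trans (one_sub_cos_le _) _.
rewrite le_eqVlt; apply/orP; left; apply/eqP.
field.
by rewrite !gt_eqF//; have := sqr_ge0 (t * S); lra.
Qed.

End Fejer.

Section ExponentialLaw.
Context {R : realType} (kap : R) (kap0 : 0 < kap).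
Notation leb := (@lebesgue_measure R).

Definition expP : probability (measurableTypeR R) R :=
  exponential_distribution_exponential_prob__canonical__probability_measure_Probability kap0.

Lemma exponential_pdf_le (x : R) : exponential_pdf kap x <= kap.
Proof.
have [x0|x0] := ltP x 0; first by rewrite lt0_exponential_pdf// ltW.
rewrite exponential_pdfE// ler_piMr ?(ltW kap0)// -[leRHS]expR0 ler_expR mulNr oppr_le0.
by rewrite mulr_ge0// (ltW kap0).
Qed.

Lemma expP_le (A : set R) : measurable A -> (expP A <= mscale (NngNum (ltW kap0)) leb A)%E.
Proof.
move=> mA; rewrite /mscale/= /exponential_prob -integral_cst//.
apply: ge0_le_integral => //.
- by move=> x _; rewrite lee_fin exponential_pdf_ge0// ltW.
- apply/measurable_funTS/measurable_EFinP; exact: measurable_exponential_pdf.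
- by move=> x _; rewrite lee_fin exponential_pdf_le.
Qed.

Lemma ge0_integral_expP_le (f : R -> \bar R) : measurable_fun [set: measurableTypeR R] f ->
  (forall x, 0 <= f x)%E ->
  (\int[expP]_x f x <= kap%:E * \int[leb]_x f x)%E.
Proof.
move=> mf f0.
have := @ge0_le_measure_integral _ _ _ expP (mscale (NngNum (ltW kap0)) leb) expP_le
  f setT measurableT f0 mf.
by rewrite ge0_integral_mscale.
Qed.

Lemma expP_dom : expP `<< leb.
Proof.
apply/null_content_dominatesP => A mA A0; apply/eqP; rewrite eq_le measure_ge0 andbT.
apply: le_trans (expP_le mA) _.
by rewrite /mscale/= A0 mule0.
Qed.

Lemma integral_expP (f : R -> \bar R) : expP.-integrable setT f ->
  (\int[expP]_x f x = \int[leb]_x (f x * (exponential_pdf kap x)%:E))%E.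
Proof.
move=> fi; have mf : measurable_fun [set: measurableTypeR R] f := measurable_int _ fi.
rewrite -(Radon_Nikodym_change_of_variables expP_dom)//=.
apply: ae_eq_integral => //.
- apply: emeasurable_funM => //; apply: (measurable_int leb).
  by apply: Radon_Nikodym_integrable; exact: expP_dom.
- apply: emeasurable_funM => //=; apply/measurableT_comp => //=.
  exact: measurable_exponential_pdf.
- apply: ae_eqe_mul2l => /=.
  rewrite Radon_NikodymE//=; first exact: expP_dom.
  move=> dom; case: cid => /= h [h1 h2 h3].
  apply: integral_ae_eq => //=.
  + by apply/measurableT_comp => //; exact: measurable_exponential_pdf.
  + by move=> E E01 mE; rewrite -h3.
Qed.

End ExponentialLaw.

Section CauchyDensity.
Context {R : realType}.
Notation leb := (@lebesgue_measure R).

Lemma integral_cauchy (c S : R) : 0 < c -> 0 < S ->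
  (\int[leb]_x (S / (1 + (c * x * S / 2) ^+ 2))%:E = (2 * pi / c)%:E)%E.
Proof.
move=> c0 S0.
pose d := c * S / 2.
have d0 : 0 < d by rewrite /d !mulr_gt0.
pose f (x : R) := S * (oneDsqr (d * x))^-1.
have cf : continuous f.
  move=> x; apply: cvgM; first exact: cvg_cst.
  apply: (@continuous_comp _ _ _ (fun x => d * x) (fun y => (oneDsqr y)^-1)).
    by apply: continuousM; [exact: cst_continuous|].
  exact: continuous_oneDsqrV.
transitivity (\int[leb]_x (f x)%:E)%E.
  apply: eq_integral => x _; congr (_ / _)%:E; rewrite /oneDsqr /d; congr (1 + _ ^+ 2).
  by field.
have f0 x : 0 <= f x by rewrite mulr_ge0 ?ltW// invr_gt0 (lt_le_trans ltr01).
rewrite ge0_symfun_integralT//; last first.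
  by move=> x; rewrite /f /= mulrN /oneDsqr sqrrN.
rewrite -set_itvcy (@ge0_continuous_FTC2y _ _ (fun x => S / d * atan (d * x)) 0 (S / d * (pi / 2)))//.
- rewrite mulr0 atan0 mulr0 sube0 -EFinM; congr EFin; rewrite /d; field.
  by rewrite !gt_eqF.
- exact: continuous_subspaceT.
- apply: cvgM; first exact: cvg_cst.
  apply: (@cvg_comp _ _ _ (fun x => d * x) atan _ (pinfty_nbhs R)); last exact: cvgy_atan.
  exact: gt0_cvgMry.
- apply/cvg_at_right_filter; apply: cvgM; first exact: cvg_cst.
  apply: continuous_comp; last exact: continuous_atan.
  by apply: continuousM; [exact: cst_continuous|].
- move=> x _; rewrite derive1E; apply: derive_val.
  apply: is_derive_eq; rewrite /f /oneDsqr /GRing.scale/=; field.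
  by rewrite !gt_eqF// ltr_pwDl// sqr_ge0.
Qed.

End CauchyDensity.

Arguments expP : simpl never.
Opaque expP.

Section ProbabilityConstants.
Context {R : realType} (P : probability (measurableTypeR R) R).

Lemma integral_cst_prob (c : R) : (\int[P]_x c%:E = c%:E)%E.
Proof. by rewrite integral_cst//= probability_setT mule1. Qed.

Lemma prod_prob_setT : (P \x P)%E setT = 1%E.
Proof.
by rewrite -setXTT product_measure1E//= probability_setT mule1.
Qed.

End ProbabilityConstants.

Section WeightIntegrable.
Context {R : realType} d (T : measurableType d) (m : {sigma_finite_measure set T -> \bar R}).
Notation leb := (@lebesgue_measure R).

Lemma weight_integrable (w : R -> R) (g : R * T -> R) (M : R) :
  measurable_fun [set: measurableTypeR R] w ->
  leb.-integrable setT (EFin \o w) -> (forall s, 0 <= w s) -> m setT = 1%E ->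
  measurable_fun [set: measurableTypeR R * T] g -> (forall p, `|g p| <= M) ->
  (leb \x m)%E.-integrable setT (EFin \o (fun p => w p.1 * g p)).
Proof.
move=> mw iw w0 m1 mg gM; have [M0|M0] := leP 0 M; last first.
  suff : [set: measurableTypeR R * T] = set0 by move->; exact: integrable_set0.
  apply/seteqP; split => // p _.
  by have := le_lt_trans (gM p) M0; rewrite ltNge normr_ge0.
have mf : measurable_fun [set: measurableTypeR R * T] (fun p => w p.1 * g p).
  by apply: measurable_funM => //; exact: measurableT_comp mw measurable_fst.
have mF : measurable_fun [set: measurableTypeR R * T] (fun p => `|(w p.1 * g p)%:E|%E).
  by apply: measurableT_comp => //; exact/measurable_EFinP.
apply/integrable12ltyP; first exact/measurable_EFinP.
apply: (@le_lt_trans _ _ (\int[leb]_s (w s * M)%:E)%E).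
  apply: ge0_le_integral => //.
  - by move=> s _; apply: integral_ge0.
  - exact: (@measurable_fun_fubini_tonelli_F _ _ _ _ _ m _ mF (fun z => abse_ge0 _)).
  - by apply/measurable_EFinP; exact: measurable_funM.
  - move=> s _; apply: (@le_trans _ _ (\int[m]_z (w s * M)%:E)%E).
      apply: ge0_le_integral => //.
      + by apply: (measurableT_comp mF); exact: measurable_pair1.
      + by move=> z _; rewrite /= lee_fin normrM ger0_norm// ler_wpM2l.
    by rewrite integral_cst//= m1 mule1.
under eq_integral do rewrite EFinM.
rewrite integralZr//.
apply: lte_mul_pinfty => //.
- by apply: integral_ge0 => s _; rewrite lee_fin.
- exact: (integrable_fin_num _ iw).
- by rewrite ltry.
Qed.

End WeightIntegrable.

Opaque smoothing.

Section TimeIntegrated.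
Context {R : realType} (k : R) (k0 : 0 < `|k|).
Notation leb := (@lebesgue_measure R).
Notation P := (expP k0).
Notation cfun := ((R -> R) * (R -> R))%type.
Implicit Types (a b : cfun) (s x S T : R).

Let Fej S (x : R) := S / (1 + (k * x * S / 2) ^+ 2).

Lemma measurable_cauchy S : measurable_fun [set: measurableTypeR R] (Fej S).
Proof.
apply: continuous_measurableR => x; apply: cvgM; first exact: cvg_cst.
apply: cvgV; first by rewrite gt_eqF// ltr_pwDl// sqr_ge0.
apply: cvgD; first exact: cvg_cst.
apply: (@continuous_comp _ _ _ (fun x => k * x * S / 2) (fun y => y ^+ 2)).
  apply: cvgM; last exact: cvg_cst; apply: cvgM; last exact: cvg_cst.
  by apply: cvgM; [exact: cvg_cst|exact: cvg_id].
exact: exprn_continuous.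
Qed.

Lemma cauchy_ge0 S x : 0 < S -> 0 <= Fej S x.
Proof. by move=> S0; rewrite divr_ge0 ?(ltW S0)// addr_ge0// sqr_ge0. Qed.

Lemma cauchy_le S x : 0 < S -> Fej S x <= S.
Proof.
move=> S0; rewrite ler_pdivrMr; last by rewrite ltr_pwDl// sqr_ge0.
by rewrite ler_peMr ?(ltW S0)// lerDl sqr_ge0.
Qed.

Lemma cauchy_integrable S : 0 < S ->
  (P \x P)%E.-integrable setT (EFin \o (fun z => Fej S (z.2 - z.1))).
Proof.
move=> S0; apply: (@prod_bounded_integrable _ P S).
  exact: measurable_diff (measurable_cauchy S).
by move=> z; rewrite ger0_norm ?cauchy_ge0// cauchy_le.
Qed.

(** The density of the exponential law is at most its rate, so one of the shifts may be
    integrated against Lebesgue measure instead; the rate then cancels against the factor [k] in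
    the argument of the Cauchy density. *)
Lemma integral_prod_cauchy_le S : 0 < S ->
  \int[(P \x P)%E]_z Fej S (z.2 - z.1) <= 2 * pi.
Proof.
move=> S0; have iF := cauchy_integrable S0.
rewrite -lee_fin /Rintegral fineK; last exact: integrable_fin_num iF.
have mF : measurable_fun [set: measurableTypeR R * measurableTypeR R]
    (fun z => (Fej S (z.2 - z.1))%:E).
  by apply/measurable_EFinP; exact: measurable_diff (measurable_cauchy S).
have F0 z : (0 <= (Fej S (z.2 - z.1))%:E)%E by rewrite lee_fin cauchy_ge0.
rewrite (fubini_tonelli1 (m1 := P) (m2 := P)
  (fun z : measurableTypeR R * measurableTypeR R => (Fej S (z.2 - z.1))%:E))// /fubini_F/=.
apply: (@le_trans _ _ (\int[P]_x (2 * pi)%:E)%E); last first.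
  by rewrite integral_cst_prob.
have mFx (r : R) : measurable_fun [set: measurableTypeR R] (fun x => (Fej S (x - r))%:E).
  by apply/measurable_EFinP; exact: measurable_tau (measurable_cauchy S).
apply: ge0_le_integral => //.
- by move=> x _; apply: integral_ge0 => r _; rewrite lee_fin cauchy_ge0.
- exact: (@measurable_fun_fubini_tonelli_F _ _ _ _ _ P _ mF F0).
- move=> r _.
  apply: le_trans (ge0_integral_expP_le k0 (mFx r) _) _.
    by move=> x; rewrite lee_fin cauchy_ge0.
  rewrite (@ge0_integral_shift _ r (fun x => (Fej S x)%:E)); last 2 first.
  + by apply/measurable_EFinP; exact: (measurable_cauchy S).
  + by move=> x; rewrite lee_fin cauchy_ge0.
  rewrite (_ : (\int[leb]_x (Fej S x)%:E)%E = (2 * pi / `|k|)%:E); last first.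
    rewrite -(integral_cauchy k0 S0); apply: eq_integral => x _.
    congr (_ / (1 + _))%:E; rewrite -!mulrA !exprMn -normrX ger0_norm ?sqr_ge0//.
  by rewrite -EFinM lee_fin mulrC divfK// gt_eqF.
Qed.

(** The part of the twisted correlation that is odd in time cancels. *)
Lemma smoothing_sym a s : L2c a ->
  smoothing P k s a a + smoothing P k (- s) a a =
  \int[(P \x P)%E]_z (2 * cos (k * (z.2 - z.1) * s) * cor a a (z.2 - z.1)).
Proof.
move=> La; rewrite (smoothingE P k s La La) (smoothingE P k (- s) La La) -RintegralD//;
  try exact: rcor_integrable.
apply: eq_Rintegral => z _; rewrite /rcor mulrN mulNr cosN sinN mulNr.
by rewrite (mulrAC k s); ring.
Qed.

(** Under the triangular weight, the phase of [smoothing_sym] integrates in time to a Fejer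
    kernel in the difference of the shifts, and the correlations are at most [ip2 a a]. *)
Lemma weighted_smoothing_le S a : 0 < S -> L2c a ->
  \int[leb]_(s in `[0, S]) ((1 - s / S) *
     (smoothing P k s a a + smoothing P k (- s) a a)) <= 4 * pi * ip2 a a.
Proof.
move=> S0 La.
pose w := (fun s : R => 1 - s / S) \_ `[0, S].
pose X (z : R * R) := k * (z.2 - z.1).
have mcor := measurable_diff (measurable_cor La La).
have w01 s : 0 <= w s <= 1.
  rewrite /w patchE; case: ifPn => [|_]; last by rewrite lexx ler01.
  rewrite inE/= in_itv/= => /andP[s0 sS]; rewrite subr_ge0 ler_pdivrMr// mul1r sS/=.
  by rewrite gerBl divr_ge0// ltW.
have mw : measurable_fun [set: measurableTypeR R] w.
  apply/measurable_restrict => //; apply: measurable_funTS.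
  apply: continuous_measurableR => s.
  by apply: cvgB; [exact: cvg_cst|apply: cvgM; [exact: cvg_id|exact: cvg_cst]].
have wS s : w s <= (\1_(`[0, S]%classic) s : R).
  have /andP[_] := w01 s; rewrite /w patchE indicE; case: ifPn => //= _.
have iw : leb.-integrable setT (EFin \o w).
  have i1 := @integrable_indic_itv R 0 S true false.
  apply: (le_integrable measurableT _ _ i1); first exact/measurable_EFinP.
  move=> s _ /=; have /andP[ws _] := w01 s.
  by rewrite lee_fin ger0_norm// ger0_norm// wS.
have cfej z : \int[leb]_s (w s * cos (X z * s)) = fejer S (X z).
  rewrite /fejer [RHS]Rintegral_mkcond; apply: eq_Rintegral => s _.
  by rewrite /w !patchE; case: ifPn => // _; rewrite mul0r.
pose f (p : R * (R * R)) := w p.1 * (2 * cos (X p.2 * p.1) * cor a a (p.2.2 - p.2.1)).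
have mX : measurable_fun [set: measurableTypeR R * (measurableTypeR R * measurableTypeR R)]
    (fun p : R * (R * R) => X p.2 * p.1).
  apply: measurable_funM => //; apply: measurable_funM => //.
  apply: measurable_funB; apply: measurableT_comp => //.
have n0 : 0 <= ip2 a a by apply: addr_ge0; exact: ip_ge0.
pose g (p : R * (R * R)) := 2 * cos (X p.2 * p.1) * cor a a (p.2.2 - p.2.1).
have mg : measurable_fun [set: measurableTypeR R * (measurableTypeR R * measurableTypeR R)] g.
  apply: measurable_funM; last exact: (measurableT_comp mcor measurable_snd).
  apply: measurable_funM => //; apply: (measurableT_comp _ mX).
  exact: continuous_measurableR (@continuous_cos R).
have gle p : `|g p| <= 2 * ip2 a a.
  rewrite !normrM ger0_norm//; have := norm_cos_le (X p.2 * p.1).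
  have := norm_cor_le (p.2.2 - p.2.1) La La.
  have := normr_ge0 (cor a a (p.2.2 - p.2.1)); have := normr_ge0 (cos (X p.2 * p.1)).
  by move=> h1 h2 h3 h4; nra.
have mf : measurable_fun [set: measurableTypeR R * (measurableTypeR R * measurableTypeR R)] f.
  by apply: measurable_funM => //; exact: measurableT_comp mw measurable_fst.
have PPT : (P \x P)%E setT = 1%E.
  exact: prod_prob_setT.
pose PP : subprobability _ R := product_subprobability (P : subprobability _ R, P : subprobability _ R).
have intf : (leb \x PP)%E.-integrable setT (EFin \o f).
  have w0 s : 0 <= w s by case/andP: (w01 s).
  exact: (@weight_integrable R _ _ PP w g _ mw iw w0 PPT mg gle).
have -> : \int[leb]_(s in `[0, S]) ((1 - s / S) *
     (smoothing P k s a a + smoothing P k (- s) a a)) =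
   \int[leb]_s \int[(P \x P)%E]_z f (s, z).
  rewrite Rintegral_mkcond; apply: eq_Rintegral => s _.
  transitivity (w s * (smoothing P k s a a + smoothing P k (- s) a a)).
    by rewrite /w !patchE; case: ifPn => // _; rewrite mul0r.
  rewrite smoothing_sym// -RintegralZl//.
  apply: (@prod_bounded_integrable _ P (2 * ip2 a a)).
    apply: measurable_funM; last exact: mcor.
    apply: measurable_funM => //.
    have E z : k * (z.2 - z.1) * s = (k * s) * (z.2 - z.1) by ring.
    under eq_fun do rewrite E.
    exact: measurable_diff (measurable_cosM (k * s)).
  move=> z; rewrite !normrM ger0_norm//; have := norm_cos_le (k * (z.2 - z.1) * s).
  have := norm_cor_le (z.2 - z.1) La La.
  have := normr_ge0 (cor a a (z.2 - z.1)); have := normr_ge0 (cos (k * (z.2 - z.1) * s)).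
  by move=> h1 h2 h3 h4; nra.
rewrite [leLHS](Rintegral_fubini intf).
have E z : \int[leb]_s f (s, z) = 2 * cor a a (z.2 - z.1) * fejer S (X z).
  rewrite -cfej -RintegralZl//.
    by apply: eq_Rintegral => s _; rewrite /f/=; ring.
  have mc : measurable_fun [set: measurableTypeR R] (fun s => w s * cos (X z * s)).
    by apply: measurable_funM => //; exact: measurable_cosM.
  apply: (le_integrable measurableT _ _ iw); first exact/measurable_EFinP.
  move=> s _ /=; rewrite lee_fin normrM ler_piMr//; exact: norm_cos_le.
have le1 z : `|\int[leb]_s f (s, z)| <= 2 * ip2 a a * Fej S (z.2 - z.1).
  rewrite E !normrM ger0_norm//.
  have h1 := norm_cor_le (z.2 - z.1) La La.
  have h2 := fejer_ge0 (X z) S0; have h3 := fejer_le (X z) S0.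
  rewrite (ger0_norm h2) -!mulrA ler_wpM2l//.
  by apply: ler_pM => //; lra.
have mE := @measurable_Rintegral_fst _ _ _ _ _ leb f mf.
have iE : (P \x P)%E.-integrable setT (EFin \o (fun z => \int[leb]_s f (s, z))).
  apply: (@prod_bounded_integrable _ P (2 * ip2 a a * S)) => // z.
  apply: le_trans (le1 z) _; rewrite ler_wpM2l//; first exact: mulr_ge0.
  exact: cauchy_le.
have iC := cauchy_integrable S0.
apply: (@le_trans _ _ (\int[(P \x P)%E]_z (2 * ip2 a a * Fej S (z.2 - z.1)))).
  apply: le_Rintegral => //; first exact: (integrableZl measurableT _ iC).
  by move=> z _; apply: le_trans (ler_norm _) (le1 z).
rewrite RintegralZl//.
have := integral_prod_cauchy_le S0; have := pi_ge0 R; nra.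
Qed.

(** Inviscid damping in integrated form: a fixed function is visible only for a bounded total
    time, whatever its profile. The triangular weight on an interval of length [2 T + 1] is at
    least [1/2] up to time [T]. *)
Lemma time_smoothing_le T a : 0 <= T -> L2c a ->
  \int[leb]_(s in `[0, T]) smoothing P k s a a <= 8 * pi * ip2 a a.
Proof.
move=> T0 La; pose S := 2 * T + 1; have S0 : 0 < S by rewrite /S; lra.
have cq : continuous (fun s => smoothing P k s a a) := continuous_smoothing La La.
have cN : continuous (fun s => smoothing P k (- s) a a).
  by move=> s; apply: (@continuous_comp _ _ _ (fun s : R => - s) (fun s => smoothing P k s a a));
    [exact: oppr_continuous|exact: cq].
pose Q s := (1 - s / S) * (smoothing P k s a a + smoothing P k (- s) a a).
have cQ : continuous Q.
  move=> s; apply: cvgM; last by apply: cvgD; [exact: cq|exact: cN].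
  by apply: cvgB; [exact: cvg_cst|apply: cvgM; [exact: cvg_id|exact: cvg_cst]].
have iQ (t : R) := @continuous_itv_integrable R Q 0 t cQ.
have Q0 s : 0 <= s <= S -> 0 <= Q s.
  move=> /andP[s0 sS]; apply: mulr_ge0; last by apply: addr_ge0; exact: smoothing_ge0.
  by rewrite subr_ge0 ler_pdivrMr// mul1r.
have mI : measurable (`[0, T]%classic : set (measurableTypeR R)) by exact: measurable_itv.
have H3 : \int[leb]_(s in `[0, S]) Q s <= 4 * pi * ip2 a a := weighted_smoothing_le S0 La.
have H1 : \int[leb]_(s in `[0, T]) smoothing P k s a a <=
          \int[leb]_(s in `[0, T]) (2 * Q s).
  apply: le_Rintegral => //.
  - exact: (@continuous_itv_integrable R _ 0 T cq).
  - exact: (integrableZl mI 2 (iQ T)).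
  - move=> s /=; rewrite in_itv/= => /andP[s0 sT].
    have h1 := smoothing_ge0 P k s a; have h2 := smoothing_ge0 P k (- s) a.
    have h3 : 1 / 2 <= 1 - s / S.
      rewrite lerBrDr -lerBrDl ler_pdivrMr//; rewrite /S; lra.
    rewrite /Q; nra.
have H2 : \int[leb]_(s in `[0, T]) Q s <= \int[leb]_(s in `[0, S]) Q s.
  rewrite /Rintegral fine_le//.
  - exact: integrable_fin_num (iQ T).
  - exact: integrable_fin_num (iQ S).
  - apply: ge0_subset_integral => //.
    + by case/integrableP: (iQ S).
    + by apply: subset_itvl; rewrite bnd_simp /S; lra.
have H4 := RintegralZl 2 mI (iQ T).
apply: (le_trans H1); rewrite H4 (_ : 8 * pi * _ = 2 * (4 * pi * ip2 a a)); last by ring.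
by rewrite ler_pM2l//; exact: le_trans H2 H3.
Qed.

End TimeIntegrated.

(** * A Lyapunov functional for forced evolutions *)

Section IntervalIntegral.
Context {R : realType}.
Notation leb := (@lebesgue_measure R).
Implicit Types (f g : R -> R) (a b c x : R).

Definition cint a b f : R := \int[leb]_(x in `[a, b]) f x.

Lemma cint_split a b c f : continuous f -> a <= b -> b <= c ->
  cint a c f = cint a b f + cint b c f.
Proof.
move=> cf ab bc; have i := continuous_itv_integrable a c cf.
have := @Rintegral_itvB _ f (BLeft a) (BRight c) b i.
rewrite !bnd_simp => /(_ ab bc).
rewrite Rintegral_itv_obnd_cbnd; first by move/eqP; rewrite subr_eq addrC => /eqP.
by apply: integrableS i => //; apply: subset_itvr; rewrite bnd_simp.
Qed.

Lemma cint_le a b f g : continuous f -> continuous g ->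
  (forall x, a <= x <= b -> f x <= g x) -> cint a b f <= cint a b g.
Proof.
move=> cf cg fg; apply: le_Rintegral => //.
- exact: (continuous_itv_integrable a b cf).
- exact: (continuous_itv_integrable a b cg).
Qed.

Lemma cint_ge0 a b f : (forall x, a <= x <= b -> 0 <= f x) -> 0 <= cint a b f.
Proof. by move=> f0; apply: Rintegral_ge0 => x /=; rewrite in_itv/= => /f0. Qed.

Lemma cintD a b f g : continuous f -> continuous g ->
  cint a b (fun x => f x + g x) = cint a b f + cint a b g.
Proof.
move=> cf cg; apply: RintegralD => //.
- exact: (continuous_itv_integrable a b cf).
- exact: (continuous_itv_integrable a b cg).
Qed.

Lemma cintZ a b k f : continuous f -> cint a b (fun x => k * f x) = k * cint a b f.
Proof.
move=> cf; apply: RintegralZl => //; exact: (continuous_itv_integrable a b cf).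
Qed.

Lemma cint_cst a b k : a <= b -> cint a b (fun=> k) = k * (b - a).
Proof.
rewrite le_eqVlt => /predU1P[->|ab].
  by rewrite /cint set_itv1 Rintegral_set1 subrr mulr0.
by rewrite /cint Rintegral_cst//= lebesgue_measure_itv/= lte_fin ab -EFinB.
Qed.

Lemma cint_le_cst a b f k : a <= b -> continuous f ->
  (forall x, a <= x <= b -> f x <= k) -> cint a b f <= k * (b - a).
Proof.
by move=> ab cf fk; rewrite -cint_cst//; apply: cint_le => //; exact: cst_continuous.
Qed.

Lemma cint_ge_cst a b f k : a <= b -> continuous f ->
  (forall x, a <= x <= b -> k <= f x) -> k * (b - a) <= cint a b f.
Proof.
by move=> ab cf fk; rewrite -cint_cst//; apply: cint_le => //; exact: cst_continuous.
Qed.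

Lemma eq_cint a b f g : f =1 g -> cint a b f = cint a b g.
Proof. by move=> fg; apply: eq_Rintegral => x _. Qed.

(** The set of times up to which [psi] lies below a line of small slope is closed by the
    condition from the left and open by the condition from the right. *)
Lemma dini_decreasing (psi : R -> R) a b : a <= b ->
  (forall t e : R, a <= t < b -> 0 < e -> exists2 d : R, 0 < d &
     forall s, t < s < t + d -> s <= b -> psi s <= psi t + e * (s - t)) ->
  (forall t e : R, a < t <= b -> 0 < e -> exists2 d : R, 0 < d &
     forall s, a <= s -> t - d < s < t -> psi t <= psi s + e) ->
  psi b <= psi a.
Proof.
move=> ab right left; apply/ler_addgt0Pr => e e0.
pose A := [set t | a <= t <= b /\ psi t <= psi a + e / (b - a + 1) * (t - a)].
have ba1 : 0 < b - a + 1 by lra.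
have e'0 : 0 < e / (b - a + 1) by rewrite divr_gt0.
have Aa : A a by split; rewrite ?lexx ?ab// subrr mulr0 addr0.
have supA : has_sup A by split; [exists a|exists b => t [/andP[]]].
set m := sup A.
have am : a <= m by apply: ub_le_sup => //; case: supA.
have mb : m <= b by apply: ge_sup; [exists a|move=> t [/andP[]]].
have Am : A m.
  split; first by rewrite am mb.
  move: am; rewrite le_eqVlt => /predU1P[<-|am]; first by rewrite subrr mulr0 addr0.
  apply/ler_addgt0Pr => e1 e10.
  have [|d d0 dP] := left m e1 _ e10; first by rewrite am mb.
  have [s As ms] := sup_adherent d0 supA.
  have sm : s <= m by apply: ub_le_sup => //; case: supA.
  have [/andP[as_ sb] ps] := As.
  have [sm'|sm'] := eqVneq s m.
    rewrite sm' in ps; apply: le_trans ps _; lra.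
  have := dP s as_; rewrite ms lt_neqAle sm' sm => /(_ isT) h.
  apply: le_trans h _; rewrite lerD2r; apply: le_trans ps _.
  by rewrite lerD2l ler_wpM2l ?(ltW e'0)// lerD2r.
suff mE : m = b.
  have [_] := Am; rewrite mE => h; apply: le_trans h _; rewrite lerD2l.
  by rewrite -mulrA ler_piMr ?(ltW e0)// mulrC ler_pdivrMr// mul1r; lra.
apply/eqP; rewrite eq_le mb /= leNgt; apply/negP => mltb.
have [_ pm] := Am.
have [|d d0 dP] := right m _ _ e'0; first by rewrite am mltb.
pose s := Num.min b (m + d / 2).
have ms : m < s by rewrite /s lt_min mltb/=; lra.
have sb : s <= b by rewrite /s ge_min lexx.
have sd : s < m + d by rewrite /s gt_min; apply/orP; right; lra.
have As : A s.
  split; first by rewrite (le_trans am (ltW ms)) sb.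
  have := dP s; rewrite ms sd => /(_ isT sb) h; nra.
have : s <= m by apply: ub_le_sup => //; case: supA.
by rewrite leNgt ms.
Qed.

End IntervalIntegral.

Section Lyapunov.
Context {R : realType} (V : lmodType R) (D : V -> Prop).
Implicit Types (u v w : V) (a l s t T : R).

Hypothesis DL : forall a u v, D u -> D v -> D (a *: u + v).

(** Linearity and positivity are asked on the subspace [D] only: functions that are not square
    integrable also belong to the type [V]. *)
Record psd_form (B : V -> V -> R) : Prop := PsdForm {
  formC : forall u v, D u -> D v -> B u v = B v u;
  form_lin : forall a u v w, D u -> D v -> D w -> B (a *: u + v) w = a * B u w + B v w;
  form_ge0 : forall u, D u -> 0 <= B u u }.

Lemma DZ a u : D u -> D (a *: u).
Proof.
move=> Du; rewrite (_ : a *: u = (a - 1) *: u + u); first exact: DL.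
by rewrite scalerBl scale1r subrK.
Qed.

Lemma DD u v : D u -> D v -> D (u + v).
Proof. by move=> Du Dv; rewrite -[u]scale1r; exact: DL. Qed.

Lemma DB u v : D u -> D v -> D (u - v).
Proof. by move=> Du Dv; rewrite addrC -scaleN1r; exact: DL. Qed.

Section Form.
Variables (B : V -> V -> R) (BP : psd_form B).

Lemma formDl u v w : D u -> D v -> D w -> B (u + v) w = B u w + B v w.
Proof. by move=> Du Dv Dw; rewrite -{1}[u]scale1r (form_lin BP)// mul1r. Qed.

Lemma formZl a u w : D u -> D w -> B (a *: u) w = a * B u w.
Proof.
move=> Du Dw; have e : a *: u = (a - 1) *: u + u by rewrite scalerBl scale1r subrK.
by rewrite e (form_lin BP)//; ring.
Qed.

Lemma formBl u v w : D u -> D v -> D w -> B (u - v) w = B u w - B v w.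
Proof.
by move=> Du Dv Dw; rewrite addrC -scaleN1r (form_lin BP)// mulN1r addrC.
Qed.

Lemma form_sqr_lin a u v : D u -> D v ->
  B (a *: u + v) (a *: u + v) = a ^+ 2 * B u u + 2 * a * B u v + B v v.
Proof.
move=> Du Dv; have Duv := DL a Du Dv.
rewrite (form_lin BP)// (formC BP Du Duv) (formC BP Dv Duv) !(form_lin BP)//.
by rewrite (formC BP Dv Du); ring.
Qed.

Lemma form_sqrD u v : D u -> D v -> B (u + v) (u + v) = B u u + 2 * B u v + B v v.
Proof.
by move=> Du Dv; have := form_sqr_lin 1 Du Dv; rewrite scale1r expr1n mul1r mulr1.
Qed.

Lemma form_young l u v : 0 < l -> D u -> D v -> 2 * B u v <= l * B u u + l^-1 * B v v.
Proof.
move=> l0 Du Dv; have := form_ge0 BP (DL (- l) Du Dv).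
rewrite form_sqr_lin// => H.
rewrite -(@ler_pM2l _ l)// mulrDr !mulrA mulfV ?gt_eqF// mul1r.
nra.
Qed.

Lemma form_youngN l u v : 0 < l -> D u -> D v -> - (2 * B u v) <= l * B u u + l^-1 * B v v.
Proof.
move=> l0 Du Dv; have := form_ge0 BP (DL l Du Dv).
rewrite form_sqr_lin// => H.
rewrite -(@ler_pM2l _ l)// mulrDr !mulrA mulfV ?gt_eqF// mul1r.
nra.
Qed.

Lemma form_sqrD_le u v : D u -> D v -> B (u + v) (u + v) <= 2 * B u u + 2 * B v v.
Proof.
move=> Du Dv; rewrite form_sqrD//; have := form_young ltr01 Du Dv.
by rewrite invr1 !mul1r; lra.
Qed.

End Form.

(** The setting is [W' = F] in the norm [n]. The form [h s] measures what is visible at time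
    [s]; a fixed vector is visible for a total time [Lam], and the forcing at time [t] is
    controlled by what is visible of [W t]. *)
Variables (n : V -> V -> R) (h : R -> V -> V -> R) (Lam C : R).
Hypotheses (nP : psd_form n) (hP : forall s, psd_form (h s)).
Hypothesis h_le : forall s u, D u -> h s u u <= n u u.
Hypothesis h_cont : forall u v, D u -> D v -> continuous (fun s => h s u v).
Hypothesis h_int : forall u T, D u -> 0 <= T -> cint 0 T (fun s => h s u u) <= Lam * n u u.
Variables (W F : R -> V).
Hypotheses (DW : forall t, 0 <= t -> D (W t)) (DF : forall t, 0 <= t -> D (F t)).
Hypothesis W_deriv : forall t (e : R), 0 <= t -> 0 < e -> exists2 d : R, 0 < d &
  forall s, 0 <= s -> `|s - t| < d ->
    n (W s - W t - (s - t) *: F t) (W s - W t - (s - t) *: F t) <= e * (s - t) ^+ 2.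

Let W_rem s t : W s - W t = (s - t) *: F t + (W s - W t - (s - t) *: F t).
Proof. by rewrite [RHS]addrC subrK. Qed.

Let Drem s t : 0 <= s -> 0 <= t -> D (W s - W t - (s - t) *: F t).
Proof. by move=> s0 t0; apply: DB; [apply: DB; exact: DW|apply: DZ; exact: DF]. Qed.

Lemma n_increment_le s t e : 0 <= s -> 0 <= t ->
  n (W s - W t - (s - t) *: F t) (W s - W t - (s - t) *: F t) <= e * (s - t) ^+ 2 ->
  n (W s - W t) (W s - W t) <= 2 * (n (F t) (F t) + e) * (s - t) ^+ 2.
Proof.
move=> s0 t0 le_rem; rewrite W_rem; apply: le_trans (form_sqrD_le nP _ _) _.
- by apply: DZ; exact: DF.
- exact: Drem.
rewrite (formZl nP _ (DF t0)); last by apply: DZ; exact: DF.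
rewrite (formC nP (DF t0)); last by apply: DZ; exact: DF.
rewrite (formZl nP _ (DF t0))//; last exact: DF.
have := le_rem; lra.
Qed.

Lemma W_continuous t (e : R) : 0 <= t -> 0 < e -> exists2 d : R, 0 < d &
  forall s, 0 <= s -> `|s - t| < d -> n (W s - W t) (W s - W t) <= e.
Proof.
move=> t0 e0; have [d d0 dP] := W_deriv t0 ltr01.
have nF := form_ge0 nP (DF t0).
pose M := 2 * (n (F t) (F t) + 1) + 1; have M0 : 0 < M by rewrite /M; lra.
pose d' := Num.min d (Num.min 1 (e / M)).
have d'0 : 0 < d' by rewrite !lt_min d0 ltr01 divr_gt0.
exists d' => // s s0; rewrite !lt_min => /and3P[h1 h2 h3].
have := n_increment_le s0 t0 (dP s s0 h1).
rewrite ltr_pdivlMr// in h3.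
have e1 : (s - t) ^+ 2 = `|s - t| * `|s - t| by rewrite -expr2 real_normK ?num_real.
rewrite e1; have := normr_ge0 (s - t); move: (`|s - t|) h1 h2 h3 => x h1 h2 h3 x0.
by move=> h4; apply: le_trans h4 _; rewrite /M in h3; nra.
Qed.

Let w s := W (Num.max 0 s).
Let Dw s : D (w s).
Proof. by apply: DW; rewrite le_max lexx. Qed.
Let wE s : 0 <= s -> w s = W s.
Proof. by move=> s0; rewrite /w max_r. Qed.

Let q s := h s (w s) (w s).

Lemma q_continuous : continuous q.
Proof.
move=> s0; apply/(@cvgrPdist_le _ R^o) => e e0.
pose N := n (w s0) (w s0); have N0 : 0 <= N by exact: (form_ge0 nP (Dw s0)).
have N1 : 0 < N + 1 by lra.
have e4 : 0 < e / 4 by rewrite divr_gt0.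
pose mu := e / 4 / (N + 1); have mu0 : 0 < mu by rewrite divr_gt0.
have muN : mu * N <= e / 4 by rewrite /mu mulrAC ler_pdivrMr//; nra.
have del0 : 0 < Num.min (e / 4) (e / 4 * mu) by rewrite lt_min divr_gt0//= mulr_gt0 ?divr_gt0.
have m0 : 0 <= Num.max 0 s0 by rewrite le_max lexx.
have [d d0 dP] := W_continuous m0 del0.
have /(@cvgrPdist_le _ R^o) /(_ _ e4) hc := @h_cont _ _ (Dw s0) (Dw s0) s0.
near=> s.
have hcs : `|h s0 (w s0) (w s0) - h s (w s0) (w s0)| <= e / 4 by near: s; exact: hc.
have ds : `|s - s0| < d.
  by rewrite distrC; near: s; apply/nbhs_ballP; exists d.
have hm : `|Num.max 0 s - Num.max 0 s0| < d.
  apply: le_lt_trans ds; rewrite ler_norml.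
  have x0 := normr_ge0 (s - s0); have x1 := ler_norm (s - s0).
  have x2 : - (s - s0) <= `|s - s0| by rewrite -normrN ler_norm.
  by rewrite /Num.max; case: ltP => s1; case: ltP => s2; apply/andP; split; lra.
have {dP} := dP (Num.max 0 s) _ hm; rewrite le_max lexx => /(_ isT).
rewrite -/(w s) -/(w s0) => nd.
have Dd : D (w s - w s0) by exact: DB.
have hd : h s (w s - w s0) (w s - w s0) <= n (w s - w s0) (w s - w s0) by exact: h_le.
have hd0 := form_ge0 (hP s) Dd.
have E : q s = h s (w s0) (w s0) + 2 * h s (w s0) (w s - w s0) + h s (w s - w s0) (w s - w s0).
  have E0 : w s = w s0 + (w s - w s0) by rewrite addrC subrK.
  by rewrite /q {1 2}E0 (form_sqrD (hP s) (Dw s0) Dd).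
have y1 := form_young (hP s) mu0 (Dw s0) Dd.
have y2 := form_youngN (hP s) mu0 (Dw s0) Dd.
have hN : h s (w s0) (w s0) <= N by exact: h_le.
have mh : mu * h s (w s0) (w s0) <= e / 4 by apply: le_trans muN; rewrite ler_wpM2l// ltW.
move: nd; rewrite le_min => /andP[nd1 nd2].
have mih : mu^-1 * h s (w s - w s0) (w s - w s0) <= e / 4.
  by rewrite mulrC ler_pdivrMr//; apply: le_trans hd nd2.
rewrite E /q; move: hcs; rewrite !ler_norml => /andP[c1 c2].
by apply/andP; split; lra.
Unshelve. all: by end_near. Qed.

Hypothesis F_dual : forall t v l, 0 <= t -> D v -> 0 < l ->
  2 * n (F t) v <= l * C ^+ 2 * h t (W t) (W t) + l^-1 * h t v v.
Hypothesis F_small : forall t T, 0 <= t -> t <= T ->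
  2 * cint t T (fun s => h s (F t) (W t)) <= h t (W t) (W t) / 2.

Let qC : continuous q := q_continuous.
Let hC u (Du : D u) : continuous (fun s => h s u u) := h_cont Du Du.

Lemma near_lt (f : R -> R) t e : {for t, continuous f} -> 0 < e ->
  exists2 d : R, 0 < d & forall s, `|s - t| < d -> `|f s - f t| <= e.
Proof.
move=> /(@cvgrPdist_le _ R^o) fc e0; have /nbhs_ballP[d /= d0 dP] := fc _ e0.
by exists d => // s sd; rewrite distrC; apply: dP; rewrite /ball/= distrC.
Qed.

(** The moving end point of [\int_t^T h_s (W t) ds] contributes [- q t] to its right derivative,
    and by [F_small] the forcing at most [q t / 2]. *)
Lemma energy_right T t (e : R) : 0 <= t -> t < T -> 0 < e ->
  exists2 d : R, 0 < d & forall s, t < s < t + d -> s <= T ->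
  cint s T (fun x => h x (W s) (W s)) + cint t s q / 2 <=
  cint t T (fun x => h x (W t) (W t)) + e * (s - t).
Proof.
move=> t0 tT e0; have T0 : 0 < T by lra.
have Dt := DW t0; have DFt := DF t0.
pose N := n (W t) (W t); have N0 : 0 <= N by exact: (form_ge0 nP).
pose M := n (F t) (F t); have M0 : 0 <= M by exact: (form_ge0 nP).
have e8 : 0 < e / 8 by rewrite divr_gt0.
have [d1 d10 d1P] := @near_lt (fun s => h s (W t) (W t)) t _ (hC Dt (x:=t)) e8.
have [d2 d20 d2P] := @near_lt q t _ (qC (x:=t)) e8.
pose mu := e / 8 / (T * (N + 1)).
have TN : 0 < T * (N + 1) by rewrite mulr_gt0// ltr_pwDr.
have mu0 : 0 < mu by rewrite divr_gt0.
have mu20 : 0 < mu ^+ 2 by rewrite exprn_gt0.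
have [d3 d30 d3P] := W_deriv t0 mu20.
pose K := N + M + 2 * T * (M + mu ^+ 2) + 1.
have K0 : 0 < K.
  have x1 := mulr_ge0 (ltW T0) (addr_ge0 M0 (ltW mu20)); rewrite /K; lra.
pose d := Num.min (Num.min d1 d2) (Num.min d3 (e / 8 / K)).
exists d; first by rewrite !lt_min d10 d20 d30 divr_gt0.
move=> s /andP[ts std] sT.
have s0 : 0 <= s by lra.
have st : 0 < s - t by lra.
have : s - t < d by lra.
rewrite !lt_min => /andP[/andP[sd1 sd2] /andP[sd3 sd4]].
rewrite ltr_pdivlMr// in sd4.
have near x : t <= x <= s -> `|x - t| <= s - t.
  by move=> /andP[tx xs]; rewrite ger0_norm; lra.
set del := s - t in st sd1 sd2 sd3 sd4 near *.
pose rho := W s - W t - del *: F t.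
have Drho : D rho := Drem s0 t0.
have nrho : n rho rho <= mu ^+ 2 * del ^+ 2.
  by apply: d3P => //; rewrite ger0_norm// ltW.
have Dinc : D (W s - W t) by apply: DB => //; exact: DW.
have ninc : n (W s - W t) (W s - W t) <= 2 * (M + mu ^+ 2) * del ^+ 2.
  exact: n_increment_le.
have Ds := DW s0.
have pt x : h x (W s) (W s) <= h x (W t) (W t) + 2 * del * h x (F t) (W t)
     + (mu * del * (N + 1) + 2 * (M + mu ^+ 2) * del ^+ 2).
  have -> : h x (W s) (W s) = h x (W t) (W t) + 2 * h x (W t) (W s - W t)
     + h x (W s - W t) (W s - W t).
    by rewrite -form_sqrD// addrC subrK.
  have -> : h x (W t) (W s - W t) = del * h x (F t) (W t) + h x (W t) rho.
    rewrite W_rem -/rho (formC (hP x) Dt); last by apply: DD => //; exact: DZ.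
    by rewrite (form_lin (hP x))// (formC (hP x) Drho Dt).
  have md : 0 < mu * del by exact: mulr_gt0.
  have y := form_young (hP x) md Dt Drho.
  have h1 : h x (W t) (W t) <= N by exact: h_le.
  have h2 : h x rho rho <= mu ^+ 2 * del ^+ 2 := le_trans (h_le x Drho) nrho.
  have h3 : h x (W s - W t) (W s - W t) <= 2 * (M + mu ^+ 2) * del ^+ 2.
    exact: le_trans (h_le x Dinc) ninc.
  have h4 : (mu * del)^-1 * h x rho rho <= mu * del.
    by rewrite mulrC ler_pdivrMr// -expr2 exprMn.
  have h5 : mu * del * h x (W t) (W t) <= mu * del * N by rewrite ler_pM2l.
  lra.
have cFW := h_cont DFt Dt.
have cWW := hC Dt.
have cZ : continuous (fun x => 2 * del * h x (F t) (W t)).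
  by move=> x; apply: cvgM; [exact: cvg_cst|exact: cFW].
have cS : continuous (fun x => h x (W t) (W t) + 2 * del * h x (F t) (W t)).
  by move=> x; apply: cvgD; [exact: cWW|exact: cZ].
have I1 : cint s T (fun x => h x (W s) (W s)) <=
   cint s T (fun x => h x (W t) (W t)) + 2 * del * cint s T (fun x => h x (F t) (W t))
   + (mu * del * (N + 1) + 2 * (M + mu ^+ 2) * del ^+ 2) * (T - s).
  rewrite -cintZ// -cintD// -(cint_cst _ sT) -cintD//; last by move=> x; exact: cvg_cst.
  apply: cint_le; first exact: hC.
    by move=> x; apply: cvgD; [exact: cS|exact: cvg_cst].
  by move=> x _; exact: pt.
have I2 := cint_split cWW (ltW ts) sT.
have I3 := cint_split cFW (ltW ts) sT.
have I4 : (h t (W t) (W t) - e / 8) * (s - t) <= cint t s (fun x => h x (W t) (W t)).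
  apply: cint_ge_cst (ltW ts) cWW _ => x xts; have := d1P x (le_lt_trans (near x xts) sd1).
  by rewrite ler_norml => /andP[+ _]; rewrite lerBlDr; lra.
have I5 : cint t s q <= (h t (W t) (W t) + e / 8) * (s - t).
  apply: cint_le_cst (ltW ts) qC _ => x xts; have := d2P x (le_lt_trans (near x xts) sd2).
  by rewrite /q (wE t0) ler_norml => /andP[_]; rewrite lerBlDr addrC.
have I6 : - ((N + M) / 2) * (s - t) <= cint t s (fun x => h x (F t) (W t)).
  apply: cint_ge_cst (ltW ts) cFW _ => x _.
  have := form_youngN (hP x) ltr01 DFt Dt; rewrite invr1 !mul1r.
  have := h_le x DFt; have := h_le x Dt; rewrite -/N -/M; lra.
have I7 := F_small t0 (ltW tT).
rewrite -/del in I4 I5 I6.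
have muE : mu * (T * (N + 1)) = e / 8 by rewrite /mu divfK// gt_eqF.
have TsT : T - s <= T by lra.
have Ts0 : 0 <= T - s by lra.
have cf0 : 0 <= mu * del * (N + 1) + 2 * (M + mu ^+ 2) * del ^+ 2.
  apply: addr_ge0; first by apply: mulr_ge0; [exact: mulr_ge0 (ltW mu0) (ltW st)|lra].
  apply: mulr_ge0; last exact: sqr_ge0.
  by apply: mulr_ge0; [|exact: addr_ge0 M0 (ltW mu20)].
have J1 := ler_wpM2l cf0 TsT.
have J2 : (mu * del * (N + 1) + 2 * (M + mu ^+ 2) * del ^+ 2) * T =
   del * (e / 8) + del * (del * (2 * T * (M + mu ^+ 2))) by rewrite -muE; ring.
have J3 : del * (2 * T * (M + mu ^+ 2)) + del * (N + M) <= e / 8.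
  by apply: le_trans (ltW sd4); rewrite -mulrDr ler_pM2l// /K; lra.
have J4 := ler_wpM2l (ltW st) J3.
have J5 := ler_wpM2l (ltW st) I7.
have J6 := ler_wpM2l (ltW st) I6.
have J7 := mulr_gt0 e0 st.
clear - I1 I2 I3 I4 I5 J1 J2 J4 J5 J6 J7.
rewrite J2 in J1; rewrite I2; rewrite I3 in J5.
set A1 := cint t s (fun s => h s (W t) (W t)) in I2 I4 J1 *.
lra.
Qed.

Lemma h_close s u v mu : 0 < mu -> D u -> D v ->
  h s u u <= h s v v + (mu * n u u + mu^-1 * n (v - u) (v - u)).
Proof.
move=> mu0 Du Dv; have Dd := DB Dv Du.
have E : h s v v = h s u u + 2 * h s u (v - u) + h s (v - u) (v - u).
  by rewrite -form_sqrD// addrC subrK.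
have y := form_youngN (hP s) mu0 Du Dd.
have p := form_ge0 (hP s) Dd.
have a1 : mu * h s u u <= mu * n u u by rewrite ler_pM2l//; exact: h_le.
have a2 : mu^-1 * h s (v - u) (v - u) <= mu^-1 * n (v - u) (v - u).
  by rewrite ler_pM2l ?invr_gt0//; exact: h_le.
lra.
Qed.

(** [dini_decreasing] asks from the left only that the functional does not jump, so continuity
    of [W] is enough. *)
Lemma energy_left T t (e : R) : 0 < t -> t <= T -> 0 < e ->
  exists2 d : R, 0 < d & forall s, 0 <= s -> t - d < s < t ->
  cint t T (fun x => h x (W t) (W t)) + cint s t q / 2 <=
  cint s T (fun x => h x (W s) (W s)) + e.
Proof.
move=> t0 tT e0; have T0 : 0 < T := lt_le_trans t0 tT.
have Dt := DW (ltW t0).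
set N := n (W t) (W t); have N0 : 0 <= N by exact: (form_ge0 nP).
pose mu := e / 4 / (T * (N + 1)).
have TN : 0 < T * (N + 1) by rewrite mulr_gt0// ltr_pwDr.
have mu0 : 0 < mu by rewrite !divr_gt0.
have eta0 : 0 < mu * (e / 4 / T) by rewrite mulr_gt0// !divr_gt0.
have [d1 d10 d1P] := W_continuous (ltW t0) eta0.
have [d2 d20 d2P] := @near_lt q t _ (qC (x:=t)) ltr01.
exists (Num.min (Num.min d1 d2) (e / (N + 1))).
  by rewrite !lt_min d10 d20 divr_gt0// ltr_pwDr.
move=> s s0 /andP[tds st].
have : t - s < Num.min (Num.min d1 d2) (e / (N + 1)) by lra.
rewrite !lt_min => /andP[/andP[sd1 sd2]]; rewrite ltr_pdivlMr ?ltr_pwDr// => sd3.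
have near x : s <= x <= t -> `|x - t| <= t - s.
  by move=> /andP[sx xt]; rewrite distrC ger0_norm; lra.
have nst : n (W s - W t) (W s - W t) <= mu * (e / 4 / T).
  by apply: d1P => //; apply: le_lt_trans sd1; apply: near; rewrite lexx ltW.
have I1 : cint t T (fun x => h x (W t) (W t)) <=
    cint t T (fun x => h x (W s) (W s)) + (mu * N + e / 4 / T) * (T - t).
  have cWs : continuous (fun x => h x (W s) (W s)) by exact: hC (DW s0).
  rewrite -(cint_cst _ tT) -cintD//; last by move=> x; exact: cvg_cst.
  apply: cint_le; first exact: hC.
    by move=> x; apply: cvgD; [exact: cWs|exact: cvg_cst].
  move=> x _; apply: le_trans (h_close x mu0 Dt (DW s0)) _.
  by rewrite lerD2l lerD2l mulrC ler_pdivrMr// mulrC.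
have I2 : cint s t (fun x => h x (W s) (W s)) >= 0.
  by apply: cint_ge0 => x _; exact: form_ge0 (hP x) _ (DW s0).
have I3 := cint_split (hC (DW s0)) (ltW st) tT.
have I4 : cint s t q <= (N + 1) * (t - s).
  apply: cint_le_cst (ltW st) qC _ => x xts; have := d2P x (le_lt_trans (near x xts) sd2).
  rewrite {2}/q (wE (ltW t0)) ler_norml => /andP[_]; rewrite lerBlDr addrC => H.
  by apply: le_trans H _; rewrite lerD2r; exact: h_le.
have E1 : mu * (T * (N + 1)) = e / 4 by rewrite /mu divfK// gt_eqF.
have E2 : e / 4 / T * T = e / 4 by rewrite divfK// gt_eqF.
have E3 : (mu * N + e / 4 / T) * (T - t) <= e / 2.
  have TtT : T - t <= T by lra.
  have p : 0 <= mu * N + e / 4 / T.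
    by apply: addr_ge0; [exact: mulr_ge0 (ltW mu0) N0|rewrite !divr_ge0// ltW].
  apply: le_trans (ler_wpM2l p TtT) _; rewrite mulrDl E2.
  have := mulr_gt0 mu0 T0; move: E1; rewrite mulrDr mulr1 mulrDr; lra.
rewrite I3; lra.
Qed.

(** Compare the values at [0] and [T] of the Lyapunov functional [\int_t^T h_s (W t) ds + 1/2
    \int_0^t q], which does not increase. *)
Lemma energy_bound T : 0 <= T -> cint 0 T q <= 2 * Lam * n (W 0) (W 0).
Proof.
move=> T0; have D0 := DW (lexx 0).
pose psi t := cint t T (fun x => h x (W t) (W t)) + cint 0 t q / 2.
have : psi T <= psi 0.
  apply: dini_decreasing => // [t e /andP[t0 tT] e0|t e /andP[t0 tT] e0].
    have [d d0 dP] := energy_right t0 tT e0; exists d => // s tsd sT.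
    have [ts _] := andP tsd.
    have := dP s tsd sT; rewrite /psi (cint_split qC t0 (ltW ts)); lra.
  have [d d0 dP] := energy_left t0 tT e0; exists d => // s s0 tsd.
  have [_ ts] := andP tsd.
  have := dP s s0 tsd; rewrite /psi (cint_split qC s0 (ltW ts)); lra.
have p0 : 0 <= cint T T (fun x => h x (W T) (W T)).
  by apply: cint_ge0 => x _; exact: form_ge0 (hP x) _ (DW T0).
have q00 : cint 0 0 q = 0 by rewrite /cint set_itv1 Rintegral_set1.
have := h_int D0 T0; rewrite /psi q00; move: p0; lra.
Qed.

(** With [v = W t' - W t], the quantity [2 n (W s - W t) v] grows from [0] to [2 n v v] at the
    rate [2 n (F s) v], which [F_dual] with [l = Lam] bounds by [Lam * C ^+ 2 * q s] and
    [Lam^-1 * h s v v]; the latter integrates to at most [n v v], half of the growth. *)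
Lemma increment_le t t' : 0 <= t -> t <= t' -> 0 < Lam ->
  n (W t' - W t) (W t' - W t) <= Lam * C ^+ 2 * cint t t' q.
Proof.
move=> t0 tt' L0; have t'0 := le_trans t0 tt'.
set v := W t' - W t; have Dv : D v by apply: DB; exact: DW.
pose f x := Lam * C ^+ 2 * q x + Lam^-1 * h x v v.
have ch : continuous (fun x => h x v v) := hC Dv.
have c1 : continuous (fun x => Lam * C ^+ 2 * q x).
  by move=> x; apply: cvgM; [exact: cvg_cst|exact: qC].
have c2 : continuous (fun x => Lam^-1 * h x v v).
  by move=> x; apply: cvgM; [exact: cvg_cst|exact: ch].
have cf : continuous f by move=> x; apply: cvgD; [exact: c1|exact: c2].
pose psi s := 2 * n (W s - W t) v - cint t s f.
have N0 := form_ge0 nP Dv.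
have DWt s : 0 <= s -> D (W s - W t) by move=> s0; apply: DB; exact: DW.
have close rho (e : R) : D rho -> 0 < e -> n rho rho <= e ^+ 2 ->
    2 * n rho v <= e * (1 + n v v) /\ - (2 * n rho v) <= e * (1 + n v v).
  move=> Drho e0 H; have ei : 0 < e^-1 by rewrite invr_gt0.
  have y1 := form_young nP ei Drho Dv; have y2 := form_youngN nP ei Drho Dv.
  rewrite invrK in y1 y2.
  have : e^-1 * n rho rho <= e by rewrite mulrC ler_pdivrMr// -expr2.
  by move: y1 y2; split; lra.
have v1 : 0 < 1 + n v v by rewrite ltr_pwDl.
have : psi t' <= psi t.
  apply: dini_decreasing => // [r e /andP[tr rt'] e0|r e /andP[tr rt'] e0].
    have r0 : 0 <= r := le_trans t0 tr.
    pose a := e / 2 / (1 + n v v).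
    have a0 : 0 < a by rewrite !divr_gt0.
    have a20 : 0 < a ^+ 2 by rewrite exprn_gt0.
    have [d d0 dP] := W_deriv r0 a20.
    have e2 : 0 < e / 2 by rewrite divr_gt0.
    have [d' d'0 d'P] := @near_lt f r _ (cf r) e2.
    exists (Num.min d d') => [|s /andP[rs]]; first by rewrite lt_min d0.
    rewrite -ltrBlDl lt_min => /andP[sd sd'] st'.
    have s0 : 0 <= s := le_trans r0 (ltW rs).
    have sr : 0 < s - r by rewrite subr_gt0.
    have asr : 0 < a * (s - r) by rewrite mulr_gt0.
    have [] := close _ (a * (s - r)) (Drem s0 r0) asr.
      by rewrite exprMn; apply: dP => //; rewrite ger0_norm// ltW.
    set rho := W s - W r - _; move=> cl _.
    have E : n (W s - W t) v = (s - r) * n (F r) v + n rho v + n (W r - W t) v.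
      have -> : W s - W t = ((s - r) *: F r + rho) + (W r - W t).
        by rewrite -W_rem addrA subrK.
      have Drho : D rho := Drem s0 r0.
      have DFr : D ((s - r) *: F r) := DZ _ (DF r0).
      rewrite (formDl nP (DD DFr Drho) (DWt r r0) Dv) (formDl nP DFr Drho Dv).
      by rewrite (formZl nP _ (DF r0) Dv).
    have fd : 2 * n (F r) v <= f r.
      by rewrite /f /q (wE r0); exact: F_dual.
    have I1 : (f r - e / 2) * (s - r) <= cint r s f.
      apply: cint_ge_cst (ltW rs) cf _ => x /andP[rx xs].
      have : `|x - r| < d'.
        by apply: le_lt_trans sd'; rewrite ger0_norm ?subr_ge0// lerD2r.
      by move/d'P; rewrite ler_norml => /andP[+ _]; rewrite lerBlDr; lra.
    have I2 := cint_split cf tr (ltW rs).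
    have aE : a * (s - r) * (1 + n v v) = e / 2 * (s - r).
      by rewrite /a mulrAC divfK// gt_eqF.
    have I3 := ler_wpM2l (ltW sr) fd.
    rewrite aE in cl; rewrite /psi E I2; lra.
  have r0 : 0 <= r := le_trans t0 (ltW tr).
  pose a := e / (1 + n v v); have a0 : 0 < a by rewrite divr_gt0.
  have a20 : 0 < a ^+ 2 by rewrite exprn_gt0.
  have [d d0 dP] := W_continuous r0 a20.
  exists d => // s ts /andP[rds sr].
  have s0 : 0 <= s := le_trans t0 ts.
  have sd : `|s - r| < d by rewrite distrC ger0_norm; lra.
  have [] := close _ a (DB (DW s0) (DW r0)) a0 (dP s s0 sd).
  rewrite /a divfK ?gt_eqF// => _ cl.
  have E : n (W s - W t) v = n (W s - W r) v + n (W r - W t) v.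
    by rewrite -(formDl nP (DB (DW s0) (DW r0)) (DWt r r0) Dv) addrA subrK.
  have I1 : 0 <= cint s r f.
    apply: cint_ge0 => x _; rewrite /f addr_ge0//.
      apply: mulr_ge0; first by rewrite mulr_ge0 ?sqr_ge0 ?ltW.
      exact: form_ge0 (hP x) _ (Dw x).
    by rewrite mulr_ge0 ?invr_ge0 ?(ltW L0)//; exact: form_ge0 (hP x) _ Dv.
  rewrite /psi E (cint_split cf ts (ltW sr)); lra.
rewrite /psi subrr => H.
have n0 : n 0 v = 0 by rewrite -[X in n X](subrr v) (formBl nP)// subrr.
have c0 : cint t t f = 0 by rewrite /cint set_itv1 Rintegral_set1.
rewrite n0 c0 -/v in H.
have E : cint t t' f = Lam * C ^+ 2 * cint t t' q + Lam^-1 * cint t t' (fun x => h x v v).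
  by rewrite /f cintD// !cintZ.
have hv : cint t t' (fun x => h x v v) <= Lam * n v v.
  apply: le_trans (h_int Dv t'0).
  rewrite (cint_split ch t0 tt') lerDr; apply: cint_ge0 => x _.
  exact: form_ge0 (hP x) _ Dv.
have : Lam^-1 * cint t t' (fun x => h x v v) <= n v v by rewrite mulrC ler_pdivrMr// mulrC.
move: H E; lra.
Qed.

Lemma increment_bound t t' : 0 <= t -> t <= t' -> 0 < Lam ->
  n (W t' - W t) (W t' - W t) <= 2 * (Lam * C) ^+ 2 * n (W 0) (W 0).
Proof.
move=> t0 tt' L0; apply: le_trans (increment_le t0 tt' L0) _.
have -> : 2 * (Lam * C) ^+ 2 * n (W 0) (W 0) = Lam * C ^+ 2 * (2 * Lam * n (W 0) (W 0)).
  by ring.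
apply: ler_wpM2l; first by rewrite mulr_ge0 ?sqr_ge0 ?ltW.
apply: le_trans (energy_bound (le_trans t0 tt')).
rewrite (cint_split qC t0 tt') lerDr; apply: cint_ge0 => x _.
exact: form_ge0 (hP x) _ (Dw x).
Qed.

(** By [energy_bound], [q] is integrable over all times, so its tails tend to zero. *)
Lemma W_cauchy (e : R) : 0 < Lam -> 0 < e -> exists2 T : R, 0 <= T &
  forall t t', T <= t -> T <= t' -> n (W t' - W t) (W t' - W t) <= e.
Proof.
move=> L0 e0; pose S := [set cint 0 t q | t in [set t | 0 <= t]].
have q0 x : 0 <= q x by exact: form_ge0 (hP x) _ (Dw x).
have Cl : 0 < Lam * C ^+ 2 + 1 by rewrite ltr_pwDr// mulr_ge0 ?sqr_ge0 ?ltW.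
have supS : has_sup S.
  split; first by exists (cint 0 0 q), 0 => /=.
  by exists (2 * Lam * n (W 0) (W 0)) => _ [t t0 <-]; exact: energy_bound.
have d0 : 0 < e / (Lam * C ^+ 2 + 1) by rewrite divr_gt0.
have [_ [T /= T0 <-] TP] := sup_adherent d0 supS.
have main t t' : T <= t -> t <= t' -> n (W t' - W t) (W t' - W t) <= e.
  move=> Tt tt'; have t0 := le_trans T0 Tt.
  apply: le_trans (increment_le t0 tt' L0) _.
  have : cint 0 t' q <= sup S.
    by apply: ub_le_sup; [case: supS|exists t' => //=; exact: le_trans tt'].
  rewrite (cint_split qC t0 tt') (cint_split qC T0 Tt).
  have a1 : 0 <= cint T t q by apply: cint_ge0.
  have a2 : 0 <= cint t t' q by apply: cint_ge0.
  move=> H; have : cint t t' q <= e / (Lam * C ^+ 2 + 1) by lra.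
  rewrite ler_pdivlMr// mulrDr mulr1 mulrC; lra.
exists T => // t t' Tt Tt'; have [tt'|t't] := leP t t'; first exact: main.
have -> : W t' - W t = (-1) *: (W t - W t') by rewrite scaleN1r opprB.
have Dd : D (W t - W t') by apply: DB; apply: DW; exact: le_trans T0 _.
rewrite (formZl nP _ Dd); last exact: DZ.
rewrite (formC nP Dd); last exact: DZ.
by rewrite (formZl nP _ Dd)// mulN1r mulN1r opprK; apply: main => //; exact: ltW.
Qed.

End Lyapunov.

(** * Smooth cut-offs *)

Section SmoothFunctions.
Context {R : realType}.
Notation leb := (@lebesgue_measure R).
Implicit Types (f g : R -> R) (x y : R).

Fixpoint smooth_upto n f : Prop :=
  if n is n'.+1 then (forall x, derivable f x 1) /\ smooth_upto n' (derive1 f) else True.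

Lemma smooth_uptoW n f : smooth_upto n.+1 f -> smooth_upto n f.
Proof. by elim: n f => //= n IH f [df [ddf sf]]; split=> //; exact: IH. Qed.

Lemma smooth_is_derive n f df : (forall x, is_derive x 1 f (df x)) ->
  smooth_upto n df -> smooth_upto n.+1 f.
Proof.
move=> H sdf; split; first by move=> x; have [] := H x.
suff -> : derive1 f = df by [].
by apply/funext => x; rewrite derive1E; have [_ ->] := H x.
Qed.

Lemma smooth_deriveP n f : smooth_upto n.+1 f ->
  (forall x, is_derive x 1 f (derive1 f x)).
Proof. by move=> [df _] x; rewrite derive1E; exact: DeriveDef. Qed.

Lemma smooth_cst n (c : R) : smooth_upto n (fun=> c).
Proof.
elim: n c => // n IH c; apply: (@smooth_is_derive _ _ (fun=> 0)) => // x.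
Qed.

Lemma smoothD n f g : smooth_upto n f -> smooth_upto n g ->
  smooth_upto n (fun x => f x + g x).
Proof.
elim: n f g => // n IH f g sf sg.
apply: (@smooth_is_derive _ _ (fun x => derive1 f x + derive1 g x)).
  by move=> x; exact: (is_deriveD (smooth_deriveP sf x) (smooth_deriveP sg x)).
by apply: IH; [case: sf|case: sg].
Qed.

Lemma smoothM n f g : smooth_upto n f -> smooth_upto n g ->
  smooth_upto n (fun x => f x * g x).
Proof.
elim: n f g => // n IH f g sf sg.
apply: (@smooth_is_derive _ _ (fun x => f x * derive1 g x + g x * derive1 f x)).
  by move=> x; exact: (is_deriveM (smooth_deriveP sf x) (smooth_deriveP sg x)).
by apply: smoothD; apply: IH; try exact: smooth_uptoW; [case: sg|case: sf].
Qed.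

Lemma is_derive_affine f df (a b : R) x : is_derive (a * x + b) 1 f df ->
  is_derive x 1 (fun y => f (a * y + b)) (a * df).
Proof.
move=> H; have D : is_derive x 1 (fun y => a * y + b) a.
  by apply: is_derive_eq; rewrite /GRing.scale/=; ring.
have := @is_derive1_comp R f (fun y => a * y + b) x df a H D.
by rewrite mulrC.
Qed.

Lemma smooth_affine n f (a b : R) : smooth_upto n f ->
  smooth_upto n (fun x => f (a * x + b)).
Proof.
elim: n f => // n IH f sf.
apply: (@smooth_is_derive _ _ (fun x => a * derive1 f (a * x + b))).
  by move=> x; exact: (is_derive_affine (smooth_deriveP sf _)).
by apply: smoothM; [exact: smooth_cst|apply: IH; case: sf].
Qed.

Lemma smooth_derivable_derive1n f : (forall n, smooth_upto n f) ->
  forall n x, derivable (derive1n n f) x 1.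
Proof.
move=> sf n; have {sf} : smooth_upto n.+1 f by exact: sf.
elim: n f => [f [] //|n IH f [_ sf]] x.
by rewrite derive1Sn; exact: IH.
Qed.

(** [x^-m e^(-1/x)]: the derivative of such a function is a combination of functions of the same
    kind, which gives smoothness by induction on the number of derivatives. *)
Definition flat m x : R := if 0 < x then x^-1 ^+ m * expR (- x^-1) else 0.

Lemma flat_ge0 m x : 0 <= flat m x.
Proof.
rewrite /flat; case: ifPn => // x0.
by rewrite mulr_ge0 ?expR_ge0// exprn_ge0// invr_ge0 ltW.
Qed.

Lemma flat_le m x : flat m.+1 x <= m.+2`!%:R * `|x|.
Proof.
rewrite /flat; case: ifPn => x0; last by rewrite mulr_ge0.
rewrite gtr0_norm//.
have y0 : 0 < x^-1 by rewrite invr_gt0.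
have f0 : 0 < m.+2`!%:R :> R by rewrite ltr0n fact_gt0.
have H := expR_ge1Dxn m.+1 (ltW y0).
have : x^-1 ^+ m.+2 <= m.+2`!%:R * expR x^-1.
  by rewrite mulrC -ler_pdivrMr//; apply: le_trans H; rewrite lerDr.
rewrite expRN ler_pdivrMr ?expR_gt0// mulrAC => {}H.
have -> : x^-1 ^+ m.+1 = x^-1 ^+ m.+2 * x by rewrite (exprSr _ m.+1) mulfVK// gt_eqF.
by rewrite ler_pM2r.
Qed.

Lemma is_derive_flat m x :
  is_derive x 1 (flat m) (flat m.+2 x - m%:R * flat m.+1 x).
Proof.
have [x0|x0|->] := ltgtP x 0.
- have -> : flat m.+2 x - m%:R * flat m.+1 x = 0.
    by rewrite /flat ltNge (ltW x0)/= mulr0 subr0.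
  apply: (@near_eq_is_derive _ _ _ (fun=> 0)).
  near=> y; rewrite /flat ifF//; apply/negbTE; rewrite -leNgt ltW//.
  by near: y; exact: lt_nbhsl.
- have -> : flat m.+2 x - m%:R * flat m.+1 x =
     (x^-1 ^+ m * - expR (- x^-1) + expR (- x^-1) * (m%:R * x^-1 ^+ m.-1)) * (- x ^- 2).
    rewrite /flat x0; case: m => [|m]; first by rewrite !mul0r mulr0 addr0 subr0 expr0 exprVn; ring.
    by rewrite -exprVn /= !exprS expr0; ring.
  pose P (y : R) := y ^+ m * expR (- y).
  apply: (@near_eq_is_derive _ _ _ (P \o (fun y => y^-1))).
    near=> y; rewrite /flat ifT//; near: y; exact: lt_nbhsr.
  apply: is_derive1_comp; last first.
    have -> : - x ^- 2 = - x ^- 2 *: (1 : R) by rewrite /GRing.scale/= mulr1.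
    by apply: is_deriveV; rewrite gt_eqF.
  apply: is_deriveM.
  + have := @is_deriveX R R id m x^-1 1 1 (is_derive_id _ _).
    rewrite /GRing.scale/= mulr1 (_ : id ^+ m = (fun y : R => y ^+ m))//.
    exact: exprfctE.
  + by apply: is_derive_eq; rewrite /GRing.scale/=; ring.
- have -> : flat m.+2 0 - m%:R * flat m.+1 0 = 0 by rewrite /flat ltxx mulr0 subr0.
  have lim0 : (fun h : R => h^-1 *: (flat m (h *: 1 + 0) - flat m 0)) @ 0^' --> (0 : R).
    have -> : flat m 0 = 0 by rewrite /flat ltxx.
    have f0 : 0 < m.+2`!%:R :> R by rewrite ltr0n fact_gt0.
    apply/cvgrPdist_le => e e0; near=> h.
    have h0 : h != 0 by near: h; exact: nbhs_dnbhs_neq.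
    have -> : h^-1 *: (flat m (h *: 1 + 0) - 0) = flat m.+1 h.
      rewrite subr0 addr0 /GRing.scale/= mulr1 /flat; case: ifPn; last by rewrite mulr0.
      by rewrite exprS mulrA.
    rewrite sub0r normrN ger0_norm ?flat_ge0//; apply: le_trans (flat_le _ _) _.
    rewrite mulrC -ler_pdivlMr//; near: h.
    apply: nbhs_dnbhs; apply: (@nbhs0_le _ R^o); rewrite divr_gt0//.
  apply: DeriveDef; first by apply/cvg_ex; exists 0.
  exact: cvg_lim.
Unshelve. all: by end_near. Qed.

Lemma smooth_flat n m : smooth_upto n (flat m).
Proof.
elim: n m => // n IH m; apply: (smooth_is_derive (is_derive_flat m)).
have sc (c : R) h : smooth_upto n h -> smooth_upto n (fun x => c * h x).
  by move=> sh; apply: smoothM => //; exact: smooth_cst.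
suff -> : (fun x => flat m.+2 x - m%:R * flat m.+1 x) =
   (fun x => flat m.+2 x + (- m%:R) * flat m.+1 x) by apply: smoothD => //; exact: sc.
by apply/funext => x; rewrite mulNr.
Qed.

Definition bump x := flat 0 x * flat 0 (1 - x).

Lemma smooth_bump n : smooth_upto n bump.
Proof.
apply: smoothM; first exact: smooth_flat.
suff -> : (fun x => flat 0 (1 - x)) = (fun x => flat 0 (-1 * x + 1)).
  by apply: smooth_affine; exact: smooth_flat.
by apply/funext => x; rewrite mulN1r addrC.
Qed.

Lemma bump_ge0 x : 0 <= bump x.
Proof. by rewrite mulr_ge0 ?flat_ge0. Qed.

Lemma flat0_le1 x : flat 0 x <= 1.
Proof.
rewrite /flat expr0 mul1r; case: ifPn => // x0.
by rewrite -expR0 ler_expR oppr_le0 invr_ge0 ltW.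
Qed.

Lemma bump_le1 x : bump x <= 1.
Proof. by rewrite -[1]mulr1 ler_pM ?flat_ge0 ?flat0_le1. Qed.

Lemma bump_out x : x <= 0 \/ 1 <= x -> bump x = 0.
Proof.
rewrite /bump /flat => -[x0|x1]; first by rewrite ltNge x0/= mul0r.
by rewrite subr_gt0 (ltNge x) x1/= mulr0.
Qed.

Lemma continuous_bump : continuous bump.
Proof. exact: (is_derive_continuous (smooth_deriveP (smooth_bump 1))). Qed.

Definition bump_mass := cint 0 1 bump.

Lemma bump_mass_gt0 : 0 < bump_mass.
Proof.
have f4 y : 1 / 4 <= y -> expR (-4) <= flat 0 y.
  move=> y4; have y0 : 0 < y by lra.
  rewrite /flat y0 expr0 mul1r ler_expR lerN2 -[4]invrK lef_pV2 ?posrE//; lra.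
have c0 : 0 <= cint 0 (1 / 4) bump by apply: cint_ge0 => y _; exact: bump_ge0.
have c1 : 0 <= cint (3 / 4) 1 bump by apply: cint_ge0 => y _; exact: bump_ge0.
have c2 : expR (-4) * expR (-4) * (3 / 4 - 1 / 4) <= cint (1 / 4) (3 / 4) bump.
  apply: (cint_ge_cst _ continuous_bump) => [|y /andP[y1 y2]]; first by lra.
  by rewrite /bump ler_pM ?expR_ge0// f4//; lra.
have e0 : 0 < expR (-4) * expR (-4) :> R by rewrite mulr_gt0 ?expR_gt0.
rewrite /bump_mass (@cint_split _ 0 (1 / 4) 1) ?(@cint_split _ (1 / 4) (3 / 4) 1); try lra.
all: exact: continuous_bump.
Qed.

Definition step x := cint (-1) x bump / bump_mass.

Lemma cint_bump_out a b : b <= 0 \/ 1 <= a -> cint a b bump = 0.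
Proof.
move=> H; rewrite /cint (@eq_Rintegral _ _ _ leb _ (fun=> 0)); last first.
  move=> y; rewrite inE/= in_itv/= => /andP[y1 y2]; apply: bump_out.
  by case: H => H; [left|right]; lra.
rewrite /Rintegral integral0//.
Qed.

Lemma step_out x : x <= 0 -> step x = 0.
Proof. by move=> x0; rewrite /step cint_bump_out ?mul0r//; left. Qed.

Lemma step1 x : 1 <= x -> step x = 1.
Proof.
move=> x1; rewrite /step (@cint_split _ (-1) 0 x _ continuous_bump); try lra.
rewrite (cint_split continuous_bump ler01 x1).
rewrite (@cint_bump_out (-1) 0); last by left.
rewrite (@cint_bump_out 1 x); last by right.
by rewrite addr0 add0r divff// gt_eqF// bump_mass_gt0.
Qed.

Lemma is_derive_step x : is_derive x 1 step (bump x / bump_mass).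
Proof.
have [x0|x0] := ltP x 0.
  rewrite bump_out ?mul0r; last by left; exact: ltW.
  apply: (@near_eq_is_derive _ _ _ (fun=> 0)).
  near=> y; rewrite step_out// ltW//.
  by near: y; exact: lt_nbhsl.
have xx1 : x < x + 1 by lra.
have x1 : -1 < x by lra.
have [] := continuous_FTC1_closed xx1
  (continuous_itv_integrable (-1) (x + 1) continuous_bump) x1 (continuous_bump (x:=x)).
move=> d e; have dc : is_derive x 1 (fun y => cint (-1) y bump) (bump x).
  by rewrite -e derive1E; exact: DeriveDef.
have -> : step = bump_mass^-1 \*: (fun y => cint (-1) y bump).
  by apply/funext => y; rewrite /step mulrC.
by apply: is_derive_eq; rewrite /GRing.scale/= mulrC.
Unshelve. all: by end_near. Qed.

Lemma smooth_step n : smooth_upto n step.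
Proof.
case: n => // n; apply: (smooth_is_derive is_derive_step).
by apply: smoothM; [exact: smooth_bump|exact: smooth_cst].
Qed.

Lemma step_ge0 x : 0 <= step x.
Proof.
rewrite divr_ge0 ?(ltW bump_mass_gt0)//.
by apply: cint_ge0 => y _; exact: bump_ge0.
Qed.

Lemma step_le1 x : step x <= 1.
Proof.
have [x0|x0] := leP x 0; first by rewrite step_out.
have [x1|x1] := leP 1 x; first by rewrite step1.
rewrite ler_pdivrMr ?bump_mass_gt0// mul1r /bump_mass.
rewrite (@cint_split _ (-1) 0 x _ continuous_bump) ?(ltW x0) ?lerN10//.
rewrite (@cint_bump_out (-1) 0); last by left.
rewrite (cint_split continuous_bump (ltW x0) (ltW x1)) add0r lerDl.
by apply: cint_ge0 => y _; exact: bump_ge0.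
Qed.

End SmoothFunctions.

(** * Weak derivatives tested against steep ramps *)

Section LocallyIntegrable.
Context {R : realType}.
Notation leb := (@lebesgue_measure R).
Implicit Types (f u v b : R -> R) (x y e : R).

Record loc_int f : Prop := LocInt {
  loc_int_measurable : measurable_fun [set: measurableTypeR R] f;
  loc_int_integrable : forall x y, leb.-integrable `[x, y] (EFin \o f) }.

Lemma loc_int_continuous f : continuous f -> loc_int f.
Proof.
move=> cf; split; first exact: (continuous_measurableR cf).
by move=> x y; exact: continuous_itv_integrable.
Qed.

Lemma loc_int_mul f b (M : R) : loc_int f -> measurable_fun [set: measurableTypeR R] b ->
  (forall x, `|b x| <= M) -> loc_int (fun x => f x * b x).
Proof.
move=> lf mb bM; have mf := loc_int_measurable lf.
split=> [|x y]; first exact: measurable_funM.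
have if_ := loc_int_integrable lf x y.
apply: (le_integrable _ _ _ (integrableZl _ M if_)) => //.
  apply: measurable_funTS; apply/measurable_EFinP; exact: measurable_funM.
move=> z _ /=; rewrite lee_fin !normrM mulrC ler_wpM2r//.
by apply: le_trans (bM z) _; exact: ler_norm.
Qed.

Lemma loc_int_compactE f x y : (forall z, ~ (x <= z <= y) -> f z = 0) ->
  \int[leb]_z f z = cint x y f.
Proof.
move=> f0; rewrite /cint [RHS]Rintegral_mkcond; apply: eq_Rintegral => z _.
rewrite patchE; case: ifPn => // /negP zxy.
by rewrite f0// => h; apply: zxy; rewrite inE/= in_itv.
Qed.

Lemma loc_int_compact f x y : loc_int f -> (forall z, ~ (x <= z <= y) -> f z = 0) ->
  leb.-integrable setT (EFin \o f).
Proof.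
move=> lf f0; have fE : f \_ `[x, y] = f.
  apply/funext => z; rewrite patchE; case: ifPn => // /negP zxy.
  by rewrite f0// => h; apply: zxy; rewrite inE/= in_itv.
have := loc_int_integrable lf x y.
by rewrite integrable_mkcond// restrict_EFin fE.
Qed.

Lemma loc_intD f g : loc_int f -> loc_int g -> loc_int (fun x => f x + g x).
Proof.
move=> lf lg; split=> [|x y].
  by apply: measurable_funD; exact: loc_int_measurable.
exact: (integrableD _ (loc_int_integrable lf x y) (loc_int_integrable lg x y)).
Qed.

Definition ramp x e y := step (e^-1 * y + - (e^-1 * x)).
Definition dramp x e y := e^-1 * (bump (e^-1 * y + - (e^-1 * x)) / bump_mass).

Lemma rampE x e y : e^-1 * y + - (e^-1 * x) = (y - x) / e.
Proof. by ring. Qed.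

Lemma ramp0 x e y : 0 < e -> y <= x -> ramp x e y = 0.
Proof.
move=> e0 yx; rewrite /ramp rampE step_out//.
by rewrite pmulr_lle0 ?invr_gt0// subr_le0.
Qed.

Lemma ramp1 x e y : 0 < e -> x + e <= y -> ramp x e y = 1.
Proof. by move=> e0 yx; rewrite /ramp rampE step1// ler_pdivlMr// mul1r; lra. Qed.

Lemma dramp_out x e y : 0 < e -> ~ (x <= y <= x + e) -> dramp x e y = 0.
Proof.
move=> e0 xy; rewrite /dramp rampE bump_out ?mul0r ?mulr0//.
have [yx|yx] := leP y x; first by left; rewrite pmulr_lle0 ?invr_gt0// subr_le0.
right; rewrite ler_pdivlMr// mul1r lerBrDl leNgt; apply/negP => h; apply: xy.
by rewrite !ltW.
Qed.

Lemma is_derive_ramp x e y : is_derive y 1 (ramp x e) (dramp x e y).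
Proof. exact: (is_derive_affine (is_derive_step _)). Qed.

Lemma continuous_dramp x e : continuous (dramp x e).
Proof.
have cb := @continuous_bump R.
move=> y; apply: cvgM; first exact: cvg_cst.
apply: cvgM; last exact: cvg_cst.
apply: (@continuous_comp _ _ _ (fun y => e^-1 * y + - (e^-1 * x)) bump); last exact: cb.
apply: cvgD; last exact: cvg_cst.
by apply: cvgM; [exact: cvg_cst|exact: cvg_id].
Qed.

Lemma continuous_ramp x e : continuous (ramp x e).
Proof. exact: is_derive_continuous (is_derive_ramp x e). Qed.

Lemma norm_dramp_le x e y : 0 < e -> `|dramp x e y| <= e^-1 / bump_mass.
Proof.
move=> e0; rewrite /dramp ger0_norm.
  rewrite ler_pM2l ?invr_gt0// -[leRHS]mul1r ler_wpM2r ?bump_le1//.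
  by rewrite invr_ge0 ltW// bump_mass_gt0.
by rewrite mulr_ge0 ?invr_ge0 ?(ltW e0)// divr_ge0 ?bump_ge0// ltW// bump_mass_gt0.
Qed.

Lemma cint_dramp x e : 0 < e -> cint x (x + e) (dramp x e) = 1.
Proof.
move=> e0; rewrite /cint (Rintegral_FTC _ (is_derive_ramp x e) (@continuous_dramp x e)).
  by rewrite ramp1// ramp0// subr0.
by rewrite lerDl ltW.
Qed.

(** The derivatives of the ramps form an approximate identity from the right: they are of size
    [1 / r] on an interval of length [r], which is the scaling of a Lebesgue point. *)
Lemma dramp_approx u x e : loc_int u -> lebesgue_pt u x -> 0 < e ->
  exists2 d : R, 0 < d & forall r, 0 < r < d ->
    `|\int[leb]_y (u y * dramp x r y) - u x| <= e.
Proof.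
move=> lu xL e0; pose m : R := bump_mass; have m0 : 0 < m by exact: bump_mass_gt0.
pose e' := e * m / 4; have e'0 : 0 < e' by rewrite !(divr_gt0, mulr_gt0).
have : \forall r \near 0^'+, (davg u x r < e'%:E)%E.
  move: xL => /(_ [set z | (z < e'%:E)%E]); apply.
  exact: (@nbhs_open_ereal_lt _ _ (fun=> e')).
rewrite /at_right near_withinE => /nbhs_ballP[d /= d0 dP].
exists (d / 2) => [|r /andP[r0 rd]]; first by rewrite divr_gt0.
pose s := 2 * r; have s0 : 0 < s by rewrite mulr_gt0.
have bs : ball (0 : R) d s.
  by rewrite /ball/= sub0r normrN gtr0_norm// /s; lra.
have mu_ := loc_int_measurable lu.
have mh : measurable_fun [set: measurableTypeR R] (fun y => `|u y - u x|).
  by apply: measurableT_comp => //; apply: measurable_funB.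
have lc : loc_int (fun y => u y - u x).
  by apply: loc_intD => //; apply: loc_int_continuous => y; exact: cvg_cst.
have lh : loc_int (fun y => `|u y - u x|).
  by split=> // y z; exact: (integrable_norm (loc_int_integrable lc y z)).
have {dP} := dP s bs s0; rewrite /davg /iavg lebesgue_measure_ball ?(ltW s0)//.
rewrite inver mulrn_eq0/= gt_eqF//= muleC lte_pdivrMr ?mulrn_wgt0// -EFinM.
set J := (\int[_]_(y in _) _)%E => JP.
have cJ : ((cint x (x + r) (fun y => `|u y - u x|))%:E <= J)%E.
  rewrite /cint /Rintegral fineK; last first.
    exact: (integrable_fin_num _ (loc_int_integrable lh x (x + r))).
  apply: ge0_subset_integral => //.
  - exact: measurable_ball.
  - apply: measurable_funTS; apply/measurable_EFinP; exact: mh.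
  - move=> y /=; rewrite in_itv/= /ball/= => /andP[y1 y2].
    rewrite ltr_norml /s; apply/andP; split; lra.
have {JP}cJ := le_lt_trans cJ JP; rewrite lte_fin in cJ.
have mdr : measurable_fun [set: measurableTypeR R] (dramp x r).
  exact: (continuous_measurableR (@continuous_dramp x r)).
have ld : loc_int (fun y => (u y - u x) * dramp x r y).
  exact: (loc_int_mul lc mdr (fun y => norm_dramp_le x y r0)).
have lu1 : loc_int (fun y => u y * dramp x r y).
  exact: (loc_int_mul lu mdr (fun y => norm_dramp_le x y r0)).
rewrite (@loc_int_compactE _ x (x + r)); last first.
  by move=> y xy; rewrite dramp_out ?mulr0.
have -> : cint x (x + r) (fun y => u y * dramp x r y) - u x =
    cint x (x + r) (fun y => (u y - u x) * dramp x r y).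
  apply/eqP; rewrite subr_eq; apply/eqP.
  rewrite -[X in _ = _ + X]mulr1 -(cint_dramp x r0) -cintZ; last first.
    exact: continuous_dramp.
  rewrite /cint -RintegralD//; last 2 first.
  - exact: (loc_int_integrable ld).
  - apply: continuous_itv_integrable => y.
    by apply: cvgM; [exact: cvg_cst|exact: continuous_dramp].
  by apply: eq_Rintegral => y _; ring.
have lhr : loc_int (fun y => r^-1 / m * `|u y - u x|).
  split=> [|y z]; first exact: measurable_funM.
  exact: (integrableZl _ (r^-1 / m) (loc_int_integrable lh y z)).
apply: le_trans (le_normr_Rintegral _ (loc_int_integrable ld x (x + r))) _ => //.
apply: (@le_trans _ _ (cint x (x + r) (fun y => r^-1 / m * `|u y - u x|))).
  apply: le_Rintegral => //.
  - exact: (integrable_norm (loc_int_integrable ld x (x + r))).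
  - exact: (loc_int_integrable lhr).
  - by move=> y _; rewrite normrM mulrC ler_wpM2r// norm_dramp_le.
rewrite /cint RintegralZl//; last exact: (loc_int_integrable lh).
apply: (@le_trans _ _ (r^-1 / m * (e' * (s *+ 2)))).
  by apply: ler_wpM2l; [rewrite divr_ge0 ?invr_ge0 ?ltW|exact: ltW].
by rewrite /e' /s; have -> : r^-1 / m * (e * m / 4 * (2 * r *+ 2)) = e by field; rewrite !gt_eqF.
Qed.

Lemma ramp_approx v x x' e : loc_int v -> x < x' -> 0 < e ->
  exists2 d : R, 0 < d & forall r, 0 < r < d ->
    `|\int[leb]_y (v y * (ramp x r y - ramp x' r y)) - cint x x' v| <= e.
Proof.
move=> lv xx' e0.
pose w := v \_ `[x, x' + 1].
have iw : leb.-integrable setT (EFin \o w).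
  have := loc_int_integrable lv x (x' + 1).
  by rewrite integrable_mkcond// restrict_EFin.
have e20 : 0 < e / 2 by rewrite divr_gt0.
have [d [d0 dP]] := integral_normr_continuous iw e20.
exists (Num.min 1 (d / 2)) => [|r]; first by rewrite lt_min ltr01 divr_gt0.
rewrite lt_min => /and3P[r0 r1 rd].
pose A : set R := `[x, x + r] `|` `[x', x' + r].
have mA : measurable A by apply: measurableU.
have muA : (leb A < d%:E)%E.
  have : (leb A <= leb `[x, (x + r)%R] + leb `[x', (x' + r)%R])%E by exact: measureU2.
  move/le_lt_trans; apply.
  rewrite !lebesgue_measure_itv/= !lte_fin !ltrDl r0 -!EFinB -EFinD lte_fin.
  clear -rd; lra.
have mr z : measurable_fun [set: measurableTypeR R] (ramp z r).
  exact: (continuous_measurableR (@continuous_ramp z r)).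
pose phi y := ramp x r y - ramp x' r y.
have mphi : measurable_fun [set: measurableTypeR R] phi by exact: measurable_funB.
have phi1 y : `|phi y| <= 1.
  have h z : 0 <= ramp z r y <= 1 by rewrite /ramp step_ge0 step_le1.
  have := h x; have := h x'; rewrite /phi ler_norml; lra.
have lphi : loc_int (fun y => v y * phi y) by exact: (loc_int_mul lv mphi phi1).
have phi0 y : ~ (x <= y <= x' + r) -> phi y = 0.
  move=> /negP; rewrite negb_and -!ltNge /phi => /orP[yx|yx].
    by rewrite !ramp0 ?subrr ?mulr0//; lra.
  by rewrite !ramp1 ?subrr ?mulr0//; lra.
have ip : leb.-integrable setT (EFin \o (fun y => v y * phi y)).
  by apply: (@loc_int_compact _ x (x' + r) lphi) => y /phi0 ->; rewrite mulr0.
have iv : leb.-integrable setT (EFin \o (v \_ `[x, x'])).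
  have := loc_int_integrable lv x x'.
  by rewrite integrable_mkcond// restrict_EFin.
rewrite /cint [X in _ - X]Rintegral_mkcond -RintegralB//.
have iA : leb.-integrable setT (EFin \o ((fun y => `|w y|) \_ A)).
  rewrite -restrict_EFin -integrable_mkcond//.
  by apply: integrableS (integrable_norm iw).
have i2 : leb.-integrable setT (EFin \o (fun y => 2 * ((fun y => `|w y|) \_ A) y)).
  exact: (integrableZl _ 2 iA).
have idif : leb.-integrable setT (EFin \o (fun y => v y * phi y - (v \_ `[x, x']) y)).
  exact: (integrableB _ ip iv).
apply: le_trans (le_normr_Rintegral _ idif) _ => //.
apply: (@le_trans _ _ (\int[leb]_y (2 * ((fun y => `|w y|) \_ A) y))).
  apply: le_Rintegral => //; first exact: (integrable_norm idif).
  move=> y _; have Ay : (y \in A) = ((x <= y <= x + r) || (x' <= y <= x' + r)).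
    by rewrite /A in_setU !mem_setE !in_itv.
  have p0 : (point : R) = 0 by [].
  rewrite !patchE Ay /w patchE !mem_setE !in_itv/= p0.
  have [yA|yA] := boolP ((x <= y <= x + r) || (x' <= y <= x' + r)).
    have -> : x <= y <= x' + 1.
      by clear -yA xx' r0 r1; case/orP: yA => /andP[y1 y2]; apply/andP; split; lra.
    have -> : v y * phi y - (if x <= y <= x' then v y else 0) =
        v y * (phi y - (if x <= y <= x' then 1 else 0)) by case: ifP => _; ring.
    rewrite normrM mulrC ler_wpM2r// (le_trans (ler_normB _ _))//.
    by have := phi1 y; case: ifP => _; rewrite ?normr1 ?normr0; lra.
  rewrite mulr0; move: yA; rewrite negb_or !negb_and -!ltNge => /andP[yA1 yA2].
  case: ifPn => yx; last first.
    rewrite phi0 ?mulr0 ?subr0 ?normr0// => /andP[y1 y2].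
    by move: yx; rewrite negb_and -!ltNge; move: yA1 yA2; clear -y1 y2 xx'; move=> /orP[|] ? /orP[|] ? /orP[|] ?; lra.
  have {}y1 : x + r <= y by clear -yx yA1; case/andP: yx => ? ?; case/orP: yA1; lra.
  have {}y2 : y <= x' by case/andP: yx.
  by rewrite /phi (ramp1 r0 y1) (ramp0 r0 y2) subr0 mulr1 subrr normr0.
rewrite RintegralZl// -Rintegral_mkcond.
have := dP A mA muA; lra.
Qed.

Lemma integrable_dramp u x e : loc_int u -> 0 < e ->
  leb.-integrable setT (EFin \o (fun y => u y * dramp x e y)).
Proof.
move=> lu e0; have mdr : measurable_fun [set: measurableTypeR R] (dramp x e).
  exact: (continuous_measurableR (@continuous_dramp x e)).
have ld : loc_int (fun y => u y * dramp x e y).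
  exact: (loc_int_mul lu mdr (fun y => norm_dramp_le x y e0)).
by apply: (@loc_int_compact _ x (x + e) ld) => y xy; rewrite dramp_out ?mulr0.
Qed.

Lemma test_function_ramp (D : set R) x x' e : 0 < e -> x <= x' ->
  (forall z, x <= z <= x' + e -> D z) ->
  test_function D (fun y => ramp x e y - ramp x' e y).
Proof.
move=> e0 xx' DP; split.
  apply: smooth_derivable_derive1n => n.
  have -> : (fun y => ramp x e y - ramp x' e y) = (fun y => ramp x e y + (-1) * ramp x' e y).
    by apply/funext => y; rewrite mulN1r.
  apply: smoothD; first exact: (smooth_affine _ _ (smooth_step _)).
  by apply: smoothM; [exact: smooth_cst|exact: (smooth_affine _ _ (smooth_step _))].
exists `[x, x' + e]%classic; split.
- exact: segment_compact.
- by move=> z /=; rewrite in_itv; exact: DP.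
- move=> y /=; rewrite in_itv/= => /negP; rewrite negb_and -!ltNge => /orP[yx|yx].
    by rewrite !ramp0 ?subrr//; lra.
  by rewrite !ramp1 ?subrr//; lra.
Qed.

(** Test with a function that ramps up at [x] and down at [x']: as the ramps steepen, one side
    tends to a difference of values of [u] and the other to the integral of [u']. *)
Lemma weak_derivative_increment (D : set R) u u' x x' : weak_derivative D u u' ->
  loc_int (u \_ D) -> loc_int (u' \_ D) -> x < x' -> (forall z, x <= z <= x' -> D z) ->
  lebesgue_pt (u \_ D) x -> lebesgue_pt (u \_ D) x' ->
  u x' - u x = cint x x' (u' \_ D).
Proof.
move=> [[_ oD _] _ wd] lu lu' xx' DP Lx Lx'.
have Dx : D x by apply: DP; rewrite lexx ltW.
have Dx' : D x' by apply: DP; rewrite lexx ltW.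
have [r0 /= r00 r0P] : \forall z \near x', D z.
  exact: (open_nbhs_nbhs (conj oD Dx')).
have uE z : D z -> (u \_ D) z = u z by move=> Dz; rewrite patchE mem_set.
apply/eqP; rewrite -subr_eq0 -normr_eq0; apply/eqP/le_anti; rewrite normr_ge0 andbT.
apply/ler_addgt0Pr => e e0; rewrite add0r.
have e30 : 0 < e / 3 by rewrite divr_gt0.
have [d1 d10 d1P] := dramp_approx lu Lx e30.
have [d2 d20 d2P] := dramp_approx lu Lx' e30.
have [d3 d30 d3P] := ramp_approx lu' xx' e30.
(* below [r0], the support of the test function, which extends to [x' + r], stays in [D] *)
pose r := Num.min (Num.min d1 d2) (Num.min d3 r0) / 2.
have r2 : 0 < 2 * r by rewrite /r mulrC divfK// !lt_min d10 d20 d30.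
have rr : 0 < r by lra.
have r2E : 2 * r = Num.min (Num.min d1 d2) (Num.min d3 r0) by rewrite /r mulrC divfK.
have : r < Num.min (Num.min d1 d2) (Num.min d3 r0) by rewrite -r2E; lra.
rewrite !lt_min => /andP[/andP[rd1 rd2] /andP[rd3 rr0]].
have {}d1P := d1P r _; have {}d2P := d2P r _; have {}d3P := d3P r _.
rewrite rr in d1P d2P d3P; have {}d1P := d1P rd1; have {}d2P := d2P rd2.
have {}d3P := d3P rd3.
have tf : test_function D (fun y => ramp x r y - ramp x' r y).
  apply: test_function_ramp => //; first exact: ltW.
  move=> z /andP[xz zx]; have [zx'|zx'] := leP z x'; first by apply: DP; rewrite xz.
  by apply: r0P; rewrite /ball/= distrC gtr0_norm ?subr_gt0//; lra.
have := wd _ tf.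
have -> : derive1 (fun y => ramp x r y - ramp x' r y) = (fun y => dramp x r y - dramp x' r y).
  apply/funext => y; rewrite derive1E.
  by have [_ ->] := is_deriveB (is_derive_ramp x r y) (is_derive_ramp x' r y).
rewrite (Rintegral_mkcond leb D (fun y => u y * (dramp x r y - dramp x' r y))).
rewrite (Rintegral_mkcond leb D (fun y => u' y * (ramp x r y - ramp x' r y))).
have -> : (fun y => u y * (dramp x r y - dramp x' r y)) \_ D =
  (fun y => (u \_ D) y * dramp x r y - (u \_ D) y * dramp x' r y).
  by apply/funext => y; rewrite !patchE; case: ifP => _; rewrite ?mulrBr ?mul0r ?subr0.
have -> : (fun y => u' y * (ramp x r y - ramp x' r y)) \_ D =
  (fun y => (u' \_ D) y * (ramp x r y - ramp x' r y)).
  by apply/funext => y; rewrite !patchE; case: ifP => _; rewrite ?mul0r.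
rewrite RintegralB//; [|exact: integrable_dramp|exact: integrable_dramp].
move: d1P d2P d3P; rewrite (uE _ Dx) (uE _ Dx') !ler_norml.
move: (\int[_]_y _) (\int[_]_y _) (\int[_]_y _) (cint _ _ _) => A B C E.
move=> /andP[a1 a2] /andP[b1 b2] /andP[c1 c2] H; apply/andP; split; lra.
Qed.

End LocallyIntegrable.

(** * Absolutely continuous functions *)

Section AlmostEverywhere.
Context d (T : measurableType d) (R : realType) (mu : {measure set T -> \bar R}).

Lemma ae_mono (P Q : T -> Prop) : (forall x, P x -> Q x) ->
  {ae mu, forall x, P x} -> {ae mu, forall x, Q x}.
Proof. by move=> PQ; apply: filterS. Qed.

Lemma ae_mono2 (P Q S : T -> Prop) : (forall x, P x -> Q x -> S x) ->
  {ae mu, forall x, P x} -> {ae mu, forall x, Q x} -> {ae mu, forall x, S x}.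
Proof. by move=> PQS; apply: filterS2. Qed.

End AlmostEverywhere.

Section AbsolutelyContinuous.
Context {R : realType}.
Notation leb := (@lebesgue_measure R).
Implicit Types (f u v F G dF dG : R -> R) (a b c x y z e : R).

Lemma loc_int_split f a b c : loc_int f -> a <= b -> b <= c ->
  cint a c f = cint a b f + cint b c f.
Proof.
move=> lf ab bc; have i := loc_int_integrable lf a c.
have := @Rintegral_itvB _ f (BLeft a) (BRight c) b i.
rewrite !bnd_simp => /(_ ab bc).
rewrite Rintegral_itv_obnd_cbnd; first by move/eqP; rewrite subr_eq addrC => /eqP.
by apply: integrableS i => //; apply: subset_itvr; rewrite bnd_simp.
Qed.

Lemma integrable_patch (D : set (measurableTypeR R)) f : measurable D ->
  leb.-integrable D (EFin \o f) -> leb.-integrable setT (EFin \o (f \_ D)).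
Proof. by move=> mD fi; rewrite -restrict_EFin -integrable_mkcond. Qed.

Lemma loc_int_ae f g : loc_int f -> measurable_fun [set: measurableTypeR R] g ->
  {ae leb, forall x, f x = g x} -> loc_int g.
Proof.
move=> lf mg fg; split=> // x y.
apply/integrableP; split; first by apply: measurable_funTS; exact/measurable_EFinP.
have /integrableP[mf] := loc_int_integrable lf x y.
apply: le_lt_trans; rewrite le_eqVlt; apply/orP; left; apply/eqP.
apply: ae_eq_integral => //.
- by apply: measurableT_comp => //; apply: measurable_funTS; exact/measurable_EFinP.
- exact: measurableT_comp.
- by apply: ae_mono fg => z /= -> _.
Qed.

Lemma cint_ae x y f g : loc_int f -> loc_int g ->
  {ae leb, forall x, f x = g x} -> cint x y f = cint x y g.
Proof.
move=> lf lg fg; congr fine; apply: ae_eq_integral => //.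
- exact: measurable_int (loc_int_integrable lf x y).
- exact: measurable_int (loc_int_integrable lg x y).
- by apply: ae_mono fg => z /= -> _.
Qed.

Lemma loc_int_cst c : loc_int (fun=> c : R).
Proof. by apply: loc_int_continuous => z; exact: cvg_cst. Qed.

Lemma loc_intZ c f : loc_int f -> loc_int (fun x => c * f x).
Proof.
move=> lf; split=> [|x y]; first by apply: measurable_funM => //; exact: loc_int_measurable lf.
exact: (integrableZl _ c (loc_int_integrable lf x y)).
Qed.

(** [dF] is only determined almost everywhere. *)
Definition AC F dF : Prop :=
  loc_int dF /\ forall x y, x <= y -> F y - F x = cint x y dF.

Lemma AC_ae F dF dG : AC F dF -> measurable_fun [set: measurableTypeR R] dG ->
  {ae leb, forall x, dF x = dG x} -> AC F dG.
Proof.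
move=> [lF FE] mG FG; have lG := loc_int_ae lF mG FG.
by split=> // x y xy; rewrite FE//; exact: cint_ae.
Qed.

Lemma AC_is_derive F dF : (forall x, is_derive x 1 F (dF x)) -> continuous dF -> AC F dF.
Proof.
move=> d c; split; first exact: loc_int_continuous.
by move=> x y xy; rewrite /cint (Rintegral_FTC xy d c).
Qed.

Lemma ACD F dF G dG : AC F dF -> AC G dG ->
  AC (fun x => F x + G x) (fun x => dF x + dG x).
Proof.
move=> [lF FE] [lG GE]; split; first exact: loc_intD.
move=> x y xy; rewrite /cint RintegralD//; last 2 first.
- exact: (loc_int_integrable lF).
- exact: (loc_int_integrable lG).
by have := FE x y xy; have := GE x y xy; rewrite /cint; lra.
Qed.

Lemma ACZ c F dF : AC F dF -> AC (fun x => c * F x) (fun x => c * dF x).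
Proof.
move=> [lF FE]; split; first exact: loc_intZ.
move=> x y xy; rewrite /cint RintegralZl//; last exact: (loc_int_integrable lF).
by have := FE x y xy; rewrite /cint => <-; rewrite mulrBr.
Qed.

Lemma AC_continuous F dF : AC F dF -> continuous F.
Proof.
move=> [lF FE] x; apply/(@cvgrPdist_le _ R^o) => e e0.
pose w := dF \_ `[x - 1, x + 1].
have iw : leb.-integrable setT (EFin \o w).
  have := loc_int_integrable lF (x - 1) (x + 1).
  by rewrite integrable_mkcond// restrict_EFin.
have [d [d0 dP]] := integral_normr_continuous iw e0.
have main a b : a <= b -> x - 1 <= a -> b <= x + 1 -> b - a < d -> `|F b - F a| <= e.
  move=> ab xa bx bad; rewrite FE// /cint.
  apply: le_trans (le_normr_Rintegral _ (loc_int_integrable lF a b)) _ => //.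
  rewrite (@eq_Rintegral _ _ _ leb _ (fun z => `|w z|)).
    have lab : (leb `[a, b] < d%:E)%E; last by apply/ltW/dP.
    rewrite lebesgue_measure_itv/= lte_fin.
    by case: ifPn => _; rewrite ?EFinB// -EFinB lte_fin.
  move=> z; rewrite inE/= in_itv/= => /andP[az zb]; rewrite /w patchE mem_set//= in_itv/=.
  by rewrite (le_trans xa az) (le_trans zb bx).
near=> y.
have yx : `|y - x| < Num.min 1 d.
  rewrite distrC; near: y; apply/nbhs_ballP; exists (Num.min 1 d) => //=.
  by rewrite lt_min ltr01 d0.
move: yx; rewrite lt_min !ltr_norml => /andP[/andP[y1 y2] /andP[y3 y4]].
have [xy|yx] := leP x y.
  by rewrite distrC; apply: main; lra.
by apply: main; lra.
Unshelve. all: by end_near. Qed.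

Lemma AC_measurable F dF : AC F dF -> measurable_fun [set: measurableTypeR R] F.
Proof. by move/AC_continuous/continuous_measurableR. Qed.

Lemma AC_shift F dF c : AC F dF -> AC (fun x => F (x + c)) (fun x => dF (x + c)).
Proof.
move=> [lF FE]; have mF := loc_int_measurable lF.
have E x y : (fun z => dF (z + c)) \_ `[x, y] = tau (- c) (dF \_ `[x + c, y + c]).
  apply/funext => z; rewrite /tau !patchE !mem_setE !in_itv/= opprK.
  by rewrite !lerD2r.
have mr x y : measurable_fun [set: measurableTypeR R] (dF \_ `[x, y]).
  by apply/(measurable_restrictT _ _).1 => //; exact: measurable_funTS.
have ms : measurable_fun [set: measurableTypeR R] (fun z => dF (z + c)).
  by have := measurable_tau (- c) mF; rewrite /tau; under eq_fun do rewrite opprK.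
split; first split => // x y.
  rewrite integrable_mkcond// restrict_EFin E; apply/integrableP; split.
    apply/measurable_EFinP; exact: measurable_tau.
  have mn : measurable_fun [set: measurableTypeR R]
      (fun z => `|((dF \_ `[x + c, y + c]) z)%:E|%E).
    by apply: measurableT_comp => //; apply/measurable_EFinP.
  have := ge0_integral_shift (- c) mn (fun z => abse_ge0 _); rewrite /tau => ->.
  have := loc_int_integrable lF (x + c) (y + c).
  by rewrite integrable_mkcond// restrict_EFin => /integrableP[].
move=> x y xy; rewrite FE ?lerD2r// /cint [LHS]Rintegral_mkcond [RHS]Rintegral_mkcond E.
by rewrite /tau Rintegral_shift.
Qed.

Lemma tensor_integrable f g : leb.-integrable setT (EFin \o f) ->
  leb.-integrable setT (EFin \o g) ->
  (leb \x leb)%E.-integrable setT (EFin \o (fun z : R * R => f z.1 * g z.2)).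
Proof.
move=> fi gi.
have /measurable_EFinP mf := measurable_int _ fi.
have /measurable_EFinP mg := measurable_int _ gi.
have ma : measurable_fun [set: measurableTypeR R] (fun z => `|(f z)%:E|%E).
  by apply: measurableT_comp => //; exact/measurable_EFinP.
have mb : measurable_fun [set: measurableTypeR R] (fun z => `|(g z)%:E|%E).
  by apply: measurableT_comp => //; exact/measurable_EFinP.
have /integrableP[_ fo] := fi; have /integrableP[_ go] := gi.
apply/integrable12ltyP.
  apply/measurable_EFinP; apply: measurable_funM.
    exact: measurableT_comp mf measurable_fst.
  exact: measurableT_comp mg measurable_snd.
have -> : (\int[leb]_x \int[leb]_y `|(f x * g y)%:E|
   = (\int[leb]_x `|(f x)%:E|) * (\int[leb]_y `|(g y)%:E|))%E.
  rewrite -ge0_integralZr//; last exact: integral_ge0.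
  apply: eq_integral => x _; rewrite -ge0_integralZl//.
  by apply: eq_integral => y _; rewrite /= normrM EFinM.
apply: lte_mul_pinfty => //; first exact: integral_ge0.
by rewrite ge0_fin_numE//; exact: integral_ge0.
Qed.

(** Fubini on the two triangles of the square over [x] and [y]. *)
Lemma ACM F dF G dG : AC F dF -> AC G dG ->
  AC (fun x => F x * G x) (fun x => dF x * G x + F x * dG x).
Proof.
move=> AF AG; have [lF FE] := AF; have [lG GE] := AG.
have mF := AC_measurable AF; have mG := AC_measurable AG.
have bnd H dH x y : AC H dH -> exists M : R, forall z, x <= z <= y -> `|H z| <= M.
  move=> AH; exists (`|H x| + cint x y (fun z => `|dH z|)) => z /andP[xz zy].
  have [lH HE] := AH; have lN : loc_int (fun z => `|dH z|).
    split=> [|a b]; first by apply: measurableT_comp => //; exact: loc_int_measurable lH.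
    exact: (integrable_norm (loc_int_integrable lH a b)).
  rewrite -[H z](subrK (H x)) addrC (le_trans (ler_normD _ _))// lerD2l HE//.
  apply: le_trans (le_normr_Rintegral _ (loc_int_integrable lH x z)) _ => //.
  rewrite (loc_int_split lN xz zy) lerDl; apply: cint_ge0 => *; exact: normr_ge0.
have lmul H dH K : AC H dH -> loc_int K -> loc_int (fun z => K z * H z).
  move=> AH lK; split=> [|x y].
    by apply: measurable_funM; [exact: loc_int_measurable lK|exact: AC_measurable AH].
  have [M MP] := bnd H dH x y AH.
  apply: (le_integrable _ _ _ (integrableZl _ M (loc_int_integrable lK x y))) => //.
    apply: measurable_funTS; apply/measurable_EFinP; apply: measurable_funM.
      exact: loc_int_measurable lK.
    exact: AC_measurable AH.
  move=> z /=; rewrite in_itv/= => zxy; rewrite lee_fin !normrM mulrC ler_wpM2r//.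
  by apply: le_trans (MP z zxy) _; exact: ler_norm.
have l1 := lmul _ _ _ AG lF.
have l2 : loc_int (fun z => F z * dG z).
  by under eq_fun do rewrite mulrC; exact: lmul AF lG.
split; first exact: loc_intD.
move=> x y xy.
pose f : R -> R := dF \_ `[x, y]; pose g : R -> R := dG \_ `[x, y].
have if_ : leb.-integrable setT (EFin \o f).
  exact: integrable_patch (loc_int_integrable lF x y).
have ig : leb.-integrable setT (EFin \o g).
  exact: integrable_patch (loc_int_integrable lG x y).
pose S : set (measurableTypeR R * measurableTypeR R) := [set z | z.2 <= z.1].
have mS : measurable S.
  have -> : S = (fun z : measurableTypeR R * measurableTypeR R => z.2 <= z.1) @^-1` [set true].
    by apply/seteqP; split.
  rewrite -[X in measurable X]setTI.
  by apply: (@measurable_fun_ler _ _ R setT snd fst _ _ measurableT).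
have SE (z1 z2 : R) : ((z1, z2) \in S) = (z2 <= z1).
  by apply/idP/idP => [/set_mem|h] //; exact/mem_set.
pose A (z : R * R) : R := f z.1 * g z.2 * \1_S z.
pose B (z : R * R) : R := f z.1 * g z.2 * (1 - \1_S z).
have it := tensor_integrable if_ ig.
have mt := measurable_int _ it.
have iA : (leb \x leb)%E.-integrable setT (EFin \o A).
  apply: (le_integrable _ _ _ it) => //.
    apply/measurable_EFinP; apply: measurable_funM; first exact/measurable_EFinP.
    exact: measurable_indic.
  move=> z _ /=; rewrite lee_fin normrM ler_piMr// indicE.
  by case: (z \in S); rewrite ?normr1 ?normr0.
have iB : (leb \x leb)%E.-integrable setT (EFin \o B).
  apply: (le_integrable _ _ _ it) => //.
    apply/measurable_EFinP; apply: measurable_funM; first exact/measurable_EFinP.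
    by apply: measurable_funB => //; exact: measurable_indic.
  move=> z _ /=; rewrite lee_fin normrM ler_piMr// indicE.
  by case: (z \in S); rewrite ?subrr ?subr0 ?normr1 ?normr0.
have E : \int[leb]_s \int[leb]_r A (s, r) + \int[leb]_r \int[leb]_s B (s, r) =
    (F y - F x) * (G y - G x).
  rewrite Rintegral_prod12// Rintegral_prod21// -RintegralD//.
  have -> : F y - F x = \int[leb]_s f s by rewrite FE// /cint Rintegral_mkcond.
  have -> : G y - G x = \int[leb]_s g s by rewrite GE// /cint Rintegral_mkcond.
  transitivity (\int[(leb \x leb)%E]_z (f z.1 * g z.2)).
    by apply: eq_Rintegral => z _; rewrite /A /B; ring.
  rewrite -(Rintegral_prod12 it) /= -RintegralZr//.
  by apply: eq_Rintegral => s _; rewrite RintegralZl.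
have p0 : (point : R) = 0 by [].
have AE s : \int[leb]_r A (s, r) = f s * (G s - G x).
  have [/andP[xs sy]|sxy] := boolP (x <= s <= y); last first.
    have fs : f s = 0 by rewrite /f patchE mem_setE in_itv/= (negbTE sxy).
    by rewrite fs mul0r /A /=; under eq_Rintegral do rewrite fs !mul0r; rewrite /Rintegral integral0.
  rewrite GE// /cint (Rintegral_mkcond leb `[x, s] dG) -RintegralZl//; last first.
    exact: integrable_patch (loc_int_integrable lG x s).
  apply: eq_Rintegral => r _; rewrite /A /= -mulrA; congr (_ * _).
  rewrite /g !patchE !mem_setE !in_itv/= indicE SE p0.
  have [rs|rs] := leP r s; rewrite ?mulr1 ?mulr0 ?andbT ?andbF//.
  by rewrite (le_trans rs sy) andbT.
have BE r : \int[leb]_s B (s, r) = (F r - F x) * g r.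
  have [/andP[xr ry]|rxy] := boolP (x <= r <= y); last first.
    have gr : g r = 0 by rewrite /g patchE mem_setE in_itv/= (negbTE rxy).
    rewrite gr mulr0 /B /=; under eq_Rintegral do rewrite gr mulr0 mul0r.
    by rewrite /Rintegral integral0.
  have iF : leb.-integrable `[x, r[ (EFin \o dF).
    apply: integrableS (loc_int_integrable lF x r) => //.
    by apply: subset_itvl; rewrite bnd_simp.
  rewrite FE// /cint -Rintegral_itv_bndo_bndc//.
  rewrite (Rintegral_mkcond leb `[x, r[ dF) -RintegralZr//; last first.
    exact: integrable_patch iF.
  apply: eq_Rintegral => s _; rewrite /B /= mulrAC; congr (_ * _).
  rewrite /f !patchE !mem_setE !in_itv/= indicE SE p0.
  have [rs|sr] := leP r s; rewrite ?subr0 ?subrr ?mulr1 ?mulr0 ?andbT ?andbF//.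
  by rewrite (ltW (lt_le_trans sr ry)) andbT.
have EA : \int[leb]_s \int[leb]_r A (s, r) = \int[leb]_s (f s * (G s - G x)).
  by apply: eq_Rintegral => s _; exact: AE.
have EB : \int[leb]_r \int[leb]_s B (s, r) = \int[leb]_r ((F r - F x) * g r).
  by apply: eq_Rintegral => r _; exact: BE.
rewrite EA EB in E.
have e1 : \int[leb]_s (f s * (G s - G x)) =
    cint x y (fun s => dF s * G s) - (F y - F x) * G x.
  rewrite FE// /cint -RintegralZr//; last exact: (loc_int_integrable lF).
  rewrite -RintegralB//; [|exact: (loc_int_integrable l1)|]; last first.
    exact: (integrableZr _ (G x) (loc_int_integrable lF x y)).
  rewrite [RHS]Rintegral_mkcond; apply: eq_Rintegral => s _.
  by rewrite /f !patchE; case: ifP => _; rewrite ?mul0r// mulrBr.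
have e2 : \int[leb]_s ((F s - F x) * g s) =
    cint x y (fun s => F s * dG s) - F x * (G y - G x).
  rewrite GE// /cint -RintegralZl//; last exact: (loc_int_integrable lG).
  rewrite -RintegralB//; [|exact: (loc_int_integrable l2)|]; last first.
    exact: (integrableZl _ (F x) (loc_int_integrable lG x y)).
  rewrite [RHS]Rintegral_mkcond; apply: eq_Rintegral => s _.
  by rewrite /g !patchE; case: ifP => _; rewrite ?mulr0// mulrBl.
have e3 : cint x y (fun z => dF z * G z + F z * dG z) =
    cint x y (fun s => dF s * G s) + cint x y (fun s => F s * dG s).
  rewrite /cint RintegralD//; [exact: (loc_int_integrable l1)|exact: (loc_int_integrable l2)].
rewrite e1 e2 in E; rewrite e3; move: E; lra.
Qed.

Lemma ae_exists_itv (P : R -> Prop) a b : a < b ->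
  {ae leb, forall x, P x} -> exists2 x, a < x < b & P x.
Proof.
move=> ab aeP; apply: contrapT => nP.
have [N [mN N0 NP]] := aeP.
have abN : `]a, b[%classic `<=` N.
  move=> x /=; rewrite in_itv/= => xab; apply: NP => /= Px.
  by apply: nP; exists x.
have : (leb `]a, b[ <= leb N)%E by apply: le_measure => //; rewrite inE.
rewrite N0 lebesgue_measure_itv/= lte_fin ab -EFinB lee_fin subr_le0 leNgt.
by rewrite ab.
Qed.

(** Integrate the derivative from one Lebesgue point: by [weak_derivative_increment] the result
    agrees with [u] at every other one. *)
Lemma weak_derivative_AC (D : set R) u u' a b : weak_derivative D u u' ->
  loc_int (u \_ D) -> loc_int (u' \_ D) ->
  (forall x y z, D x -> D y -> x <= z <= y -> D z) -> a < b -> (forall x, a < x < b -> D x) ->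
  exists U, AC U (u' \_ D) /\ {ae leb, forall y, D y -> U y = u y}.
Proof.
move=> wd lu lu' conv ab abD.
have Lpt : {ae leb, forall x, lebesgue_pt (u \_ D) x}.
  apply: lebesgue_differentiation; split; [exact: loc_int_measurable lu|exact: openT|].
  move=> K _ cK; have [M [Mr MP]] := compact_bounded cK.
  have KM : K `<=` `[- (M + 1), M + 1].
    have M1 : M < M + 1 by rewrite ltrDl.
    by move=> x Kx; have := MP _ M1 x Kx; rewrite /= in_itv/= ler_norml.
  have /integrableP[mD] := loc_int_integrable lu (- (M + 1)) (M + 1).
  apply: le_lt_trans; apply: ge0_subset_integral => //.
  - exact: compact_measurable.
  - apply: measurable_funTS; apply/measurable_EFinP; apply: measurableT_comp => //.
    exact: loc_int_measurable lu.
have [x0 /abD Dx0 Lx0] := ae_exists_itv ab Lpt.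
set v := u' \_ D.
pose U y := u x0 + (if x0 <= y then cint x0 y v else - cint y x0 v).
have vv z : cint z z v = 0 by rewrite /cint set_itv1 Rintegral_set1.
exists U; split.
  split=> // x y xy; rewrite /U.
  have [x0x|xx0] := leP x0 x.
    by rewrite (le_trans x0x xy) (loc_int_split lu' x0x xy); ring.
  have [x0y|yx0] := leP x0 y.
    by rewrite (loc_int_split lu' (ltW xx0) x0y); ring.
  by rewrite (loc_int_split lu' xy (ltW yx0)); ring.
apply: ae_mono Lpt => y Ly Dy; rewrite /U.
have [x0y|yx0] := leP x0 y.
  move: x0y; rewrite le_eqVlt => /predU1P[<-|x0y]; first by rewrite vv addr0.
  have := weak_derivative_increment wd lu lu' x0y (fun z => conv _ _ _ Dx0 Dy) Lx0 Ly.
  by move=> <-; ring.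
have := weak_derivative_increment wd lu lu' yx0 (fun z => conv _ _ _ Dy Dx0) Ly Lx0.
by move=> <-; ring.
Qed.

Lemma integrable_tail f e : leb.-integrable setT (EFin \o f) -> 0 < e ->
  exists N : R, forall A, measurable A -> (forall z, A z -> N <= `|z|) ->
    \int[leb]_(z in A) `|f z| <= e.
Proof.
move=> fi e0.
have /measurable_EFinP mf := measurable_int _ fi.
have ifn := integrable_norm fi.
pose I (n : nat) : set R := ~` `[- n%:R, n%:R].
pose fn (n : nat) : R -> R := (fun z => `|f z|) \_ (I n).
have mI n : measurable (I n) by apply: measurableC.
have mfn n : measurable_fun setT (fn n).
  by apply/(measurable_restrictT _ _).1 => //; apply: measurable_funTS; exact: measurableT_comp.
have p0 : (point : R) = 0 by [].
have cvg0 z : (EFin \o fn ^~ z) n @[n --> \oo] --> (0 : \bar R)%E.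
  apply: cvg_near_cst; near=> n; rewrite /fn /= patchE /I in_setC mem_setE in_itv/= -ler_norml.
  suff -> : `|z| <= n%:R by [].
  by near: n; exact: nbhs_infty_ger.
have := @dominated_cvg _ _ _ leb setT measurableT (fun n z => (fn n z)%:E) (cst 0%E)
  (fun z => `|f z|%:E) (fun n => (measurable_EFinP _ _).2 (mfn n)) (fun z _ => cvg0 z).
move=> /(_ (fun _ _ => isT)) /(_ ifn) H.
have {H} : (\int[leb]_z (fn n z)%:E)%E @[n --> \oo] --> (0 : \bar R)%E.
  rewrite -[X in _ --> X](integral0 leb setT); apply: H => n z _ /=.
  by rewrite lee_fin /fn patchE; case: ifP => _; rewrite ?p0 ?normr_id ?normr0.
move=> /(_ [set x | (x < e%:E)%E]) [].
  exact: (@nbhs_open_ereal_lt _ _ (fun=> e)).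
move=> N _ /(_ N (leqnn N)) /= HN; exists (N.+1%:R) => A mA AP.
rewrite -lee_fin; apply: le_trans (ltW HN).
rewrite /Rintegral fineK; last first.
  have iA : leb.-integrable A (fun z => `|f z|%:E) by exact: integrableS ifn.
  exact: (integrable_fin_num _ iA).
rewrite integral_mkcond; apply: ge0_le_integral => //.
- by move=> z _; rewrite patchE; case: ifP => // _; rewrite lee_fin.
- by apply/(measurable_restrictT _ _).1 => //; apply: measurable_funTS; exact: measurable_int ifn.
- apply/measurable_EFinP; exact: mfn.
move=> z _; rewrite /fn !patchE; case: ifPn => [/set_mem/AP Nz|_].
  rewrite ifT// /I in_setC mem_setE in_itv/= -ler_norml -ltNge.
  by apply: lt_le_trans Nz; rewrite ltr_nat.
by case: ifP => //= _; rewrite lee_fin.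
Unshelve. all: by end_near. Qed.

(** Used to make boundary terms at infinity vanish: an integrable function is small somewhere on
    every sufficiently long interval. *)
Lemma integrable_small f e N : leb.-integrable setT (EFin \o f) -> 0 < e ->
  (exists2 y, N < y & `|f y| <= e) /\ (exists2 y, y < - N & `|f y| <= e).
Proof.
move=> fi e0; have ifn := integrable_norm fi.
pose I := \int[leb]_z `|f z|.
have I0 : 0 <= I by apply: Rintegral_ge0 => *; exact: normr_ge0.
have key a b : I + 1 <= e * (b - a) -> exists2 y, a < y < b & `|f y| <= e.
  move=> H; apply: contrapT => nP.
  have ab : a < b by rewrite -subr_gt0 -(pmulr_rgt0 _ e0); lra.
  have : e * (b - a) <= I.
    have -> : e * (b - a) = \int[leb]_(z in `]a, b[) e.
      by rewrite Rintegral_cst//= lebesgue_measure_itv/= lte_fin ab -EFinB.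
    apply: (@le_trans _ _ (\int[leb]_(z in `]a, b[) `|f z|)).
      apply: le_Rintegral => //.
      - apply: integrableS (loc_int_integrable (loc_int_cst e) a b) => //.
        exact: subset_itv_oo_cc.
      - exact: (integrableS measurableT _ (@subsetT _ _) ifn).
      move=> z /=; rewrite in_itv/= => zab; rewrite leNgt; apply/negP => zf.
      by apply: nP; exists z => //; exact: ltW.
    rewrite /I Rintegral_mkcond; apply: le_Rintegral => //.
      apply: integrable_patch => //.
      exact: (integrableS measurableT _ (@subsetT _ _) ifn).
    by move=> z _; rewrite patchE; case: ifP => // _; exact: normr_ge0.
  by lra.
have eE : e * ((I + 1) / e) = I + 1 by rewrite mulrC divfK// gt_eqF.
split.
  have [|y /andP[Ny _] fy] := key N (N + (I + 1) / e); last by exists y.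
  by rewrite [N + _]addrC addrK eE.
have [|y /andP[_ yN] fy] := key (- N - (I + 1) / e) (- N); last by exists y.
by rewrite (_ : - N - (- N - (I + 1) / e) = (I + 1) / e) ?eE//; ring.
Qed.

End AbsolutelyContinuous.

(** * Integration on half-lines and the resolvent of the derivative *)

Section LineIntegrals.
Context {R : realType}.
Notation leb := (@lebesgue_measure R).
Implicit Types (F dF H h : R -> R) (x y e k : R).

(** The boundary term at infinity is small at suitable points because [H] is integrable, and
    what lies beyond them because [h] is. *)
Lemma AC_integral_halfline H h x : AC H h ->
  leb.-integrable `[x, +oo[ (EFin \o H) -> leb.-integrable `[x, +oo[ (EFin \o h) ->
  \int[leb]_(z in `[x, +oo[) h z = - H x.
Proof.
move=> [lh HE] iH ih; apply/eqP; rewrite -addr_eq0 -normr_eq0; apply/eqP/le_anti.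
rewrite normr_ge0 andbT; apply/ler_addgt0Pr => e e0; rewrite add0r.
have e20 : 0 < e / 2 by rewrite divr_gt0.
have [N NP] := integrable_tail (integrable_patch (measurable_itv _) ih) e20.
have [[y Ny Hy] _] := integrable_small (Num.max N `|x|) (integrable_patch (measurable_itv _) iH) e20.
move: Ny; rewrite gt_max => /andP[Ny xy].
have {}xy : x < y by exact: le_lt_trans (ler_norm x) xy.
have := @Rintegral_itvB _ h (BLeft x) +oo%O y ih.
rewrite !bnd_simp => /(_ (ltW xy) isT).
rewrite -/(cint x y h) -HE ?(ltW xy)// => E.
have iy : leb.-integrable `]y, +oo[ (EFin \o h).
  by apply: integrableS ih => //; apply: subset_itvr; rewrite bnd_simp ltW.
have tail : `|\int[leb]_(z in `]y, +oo[) h z| <= e / 2.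
  apply: le_trans (le_normr_Rintegral _ iy) _ => //.
  have := NP `]y, +oo[%classic (measurable_itv _).
  rewrite (@eq_Rintegral _ _ _ leb _ (fun z => `|h z|)).
    by apply=> z /=; rewrite in_itv/= andbT => yz; rewrite (le_trans (ltW Ny))// (le_trans (ltW yz)) ?ler_norm.
  move=> z; rewrite inE/= in_itv/= andbT => yz; rewrite patchE mem_set//= in_itv/= andbT.
  by rewrite (ltW (lt_trans xy yz)).
have HyE : (H \_ `[x, +oo[) y = H y by rewrite patchE mem_set//= in_itv/= andbT ltW.
rewrite HyE in Hy; move: Hy tail; rewrite -E.
set J := Rintegral _ _ _; rewrite !ler_norml => /andP[a1 a2] /andP[a3 a4].
by apply/andP; split; lra.
Qed.

Lemma AC_integral_line H h : AC H h ->
  leb.-integrable setT (EFin \o H) -> leb.-integrable setT (EFin \o h) ->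
  \int[leb]_z h z = 0.
Proof.
move=> Hh iH ih.
apply/eqP; rewrite -normr_eq0; apply/eqP/le_anti.
rewrite normr_ge0 andbT; apply/ler_addgt0Pr => e e0; rewrite add0r.
have e20 : 0 < e / 2 by rewrite divr_gt0.
have [N NP] := integrable_tail ih e20.
have [_ [x xN Hx]] := integrable_small N iH e20.
have ix f : leb.-integrable setT (EFin \o f) -> leb.-integrable `[x, +oo[ (EFin \o f).
  exact: integrableS.
have := AC_integral_halfline Hh (ix _ iH) (ix _ ih).
have D : [set: R] = `]-oo, x[ `|` `[x, +oo[.
  by apply/seteqP; split => // z _ /=; rewrite !in_itv/= andbT; have [|] := ltP z x; [left|right].
have tail : `|\int[leb]_(z in `]-oo, x[) h z| <= e / 2.
  have i1 : leb.-integrable `]-oo, x[ (EFin \o h) by exact: integrableS ih.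
  apply: le_trans (le_normr_Rintegral _ i1) _ => //.
  apply: NP => // z /=; rewrite in_itv/= => zx.
  by apply: (@le_trans _ _ (- z)); [lra|rewrite -normrN ler_norm].
have -> : \int[leb]_z h z = \int[leb]_(z in `]-oo, x[) h z + \int[leb]_(z in `[x, +oo[) h z.
  rewrite [in LHS]D Rintegral_setU// -?D//.
  rewrite disj_set2E; apply/eqP/seteqP; split=> // z /=; rewrite !in_itv/= andbT => -[].
  by rewrite ltNge => /negP.
move=> ->; move: tail Hx.
set J := Rintegral _ _ _; rewrite !ler_norml => /andP[a1 a2] /andP[a3 a4].
by apply/andP; split; lra.
Qed.

End LineIntegrals.

Section ExponentialSmear.
Context {R : realType} (kap : R) (kap0 : 0 < kap).
Notation leb := (@lebesgue_measure R).
Notation P := (expP kap0).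
Implicit Types (u F dF : R -> R) (y : R).

Lemma smear_integrable u y : L2 leb u ->
  P.-integrable setT (EFin \o (fun r => u (y + r))).
Proof.
move=> Lu; have Lt := L2_tau (- y) Lu.
have tE : tau (- y) u = (fun r => u (y + r)).
  by apply/funext => r; rewrite /tau opprK addrC.
rewrite tE in Lt; have mt := L2_measurable Lt.
have msq : measurable_fun [set: measurableTypeR R] (fun r => ((u (y + r)) ^+ 2)%:E).
  by apply/measurable_EFinP; exact: measurable_funX.
have i2 : P.-integrable setT (EFin \o (fun r => (u (y + r)) ^+ 2)).
  apply/integrableP; split => //.
  under eq_integral => r _ do rewrite /= ger0_norm ?sqr_ge0//.
  apply: le_lt_trans (ge0_integral_expP_le kap0 msq _) _.
    by move=> r; rewrite lee_fin sqr_ge0.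
  apply: lte_mul_pinfty; rewrite ?lee_fin ?(ltW kap0)//.
  have /integrableP[_] := L2_sqr_integrable Lt; apply: le_lt_trans.
  by apply: ge0_le_integral => //; [move=> r _; rewrite lee_fin sqr_ge0|
    apply: measurableT_comp|move=> r _ /=; rewrite lee_fin ler_norm].
have i3 : P.-integrable setT (EFin \o (fun r => 1 + (u (y + r)) ^+ 2)).
  have i1 : P.-integrable setT (EFin \o (fun=> 1 : R)) by exact: finite_measure_integrable_cst.
  exact: (integrableD measurableT i1 i2).
apply: (le_integrable _ _ _ i3) => //.
  exact/measurable_EFinP.
move=> r _ /=; rewrite lee_fin [leRHS]ger0_norm ?addr_ge0 ?sqr_ge0//.
rewrite -real_normK ?num_real//; have := sqr_ge0 (`|u (y + r)| - 1).
rewrite sqrrB expr1n mulr1; have := normr_ge0 (u (y + r)); lra.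
Qed.

Lemma smear_expE u y : L2 leb u -> smear P (-1) u y =
  \int[leb]_(r in `[0, +oo[) (u (y + r) * (kap * expR (- kap * r))).
Proof.
move=> Lu; rewrite /smear.
have -> : \int[P]_r u (y - -1 * r) = \int[P]_r u (y + r).
  by apply: eq_Rintegral => r _; rewrite mulN1r opprK.
rewrite /Rintegral (integral_expP (smear_integrable y Lu)).
rewrite [in RHS]integral_mkcond; congr fine; apply: eq_integral => r _.
rewrite patchE mem_setE in_itv/= andbT; case: ifPn => r0.
  by rewrite exponential_pdfE//= EFinM.
by rewrite lt0_exponential_pdf ?mule0// ltNge.
Qed.

(** Integration by parts: the backward smearing by the exponential law inverts [1 - kap^-1
    d/dy]. *)
Lemma AC_smear F dF y : AC F dF -> L2 leb F -> L2 leb dF ->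
  smear P (-1) (fun z => F z - kap^-1 * dF z) y = F y.
Proof.
move=> AF LF LdF.
pose E (r : R) : R := expR (- kap * r); pose w : R -> R := E \_ `[0, +oo[.
have dE (r : R) : is_derive r 1 E (- kap * E r).
  by apply: is_derive_eq; rewrite /E /GRing.scale/=; ring.
have cE : continuous E := is_derive_continuous dE.
have cdE : continuous (fun r => - kap * E r).
  by move=> r; apply: cvgM; [exact: cvg_cst|exact: cE].
have mE : measurable_fun [set: measurableTypeR R] E := continuous_measurableR cE.
have Lw : L2 leb w.
  split; first by apply/(measurable_restrictT _ _).1 => //; exact: measurable_funTS.
  have k2 : 0 < 2 * kap by rewrite mulr_gt0.
  have -> : (EFin \o (fun x => w x ^+ 2)) =
      (fun x => ((2 * kap)^-1)%:E * (EFin \o exponential_pdf (2 * kap)) x)%E.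
    apply/funext => r /=; rewrite -EFinM; congr EFin.
    rewrite /w patchE mem_setE in_itv/= andbT; case: ifPn => r0.
      rewrite exponential_pdfE// mulKf ?gt_eqF// /E -expRM_natl; congr expR; ring.
    by rewrite lt0_exponential_pdf ?ltNge// mulr0 expr2 mul0r.
  by apply: integrableZl => //; exact: integrable_exponential_pdf.
have sh u : L2 leb u -> L2 leb (fun r => u (r + y)).
  by move=> Lu; have := L2_tau (- y) Lu; rewrite /tau; under eq_fun do rewrite opprK.
have ihalf u : L2 leb u -> leb.-integrable `[0, +oo[ (EFin \o (fun r => u (r + y) * E r)).
  move=> Lu; rewrite integrable_mkcond// restrict_EFin.
  have -> : (fun r => u (r + y) * E r) \_ `[0, +oo[ = (fun r => u (r + y) * w r).
    by apply/funext => r; rewrite /w !patchE; case: ifP => _; rewrite ?mulr0.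
  exact: L2_ip_integrable (sh _ Lu) Lw.
have AG := ACM (AC_shift y AF) (AC_is_derive dE cdE).
have iG := ihalf _ LF; have idF := ihalf _ LdF.
have idG : leb.-integrable `[0, +oo[
    (EFin \o (fun x => dF (x + y) * E x + F (x + y) * (- kap * E x))).
  have mi : measurable (`[0, +oo[%classic : set (measurableTypeR R)) by [].
  have := integrableD mi idF (integrableZl mi (- kap) iG).
  by apply: eq_integrable => // r _ /=; rewrite -EFinM -EFinD; congr EFin; ring.
have := AC_integral_halfline AG iG idG.
have E0 : E 0 = 1 by rewrite /E mulr0 expR0.
rewrite add0r E0 mulr1 => H.
rewrite smear_expE; last by apply: L2B => //; exact: L2Z.
rewrite (_ : F y = -1 * (- F y)); last by rewrite mulN1r opprK.
rewrite -H -RintegralZl//.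
apply: eq_Rintegral => r _; rewrite -/(E r) [y + r]addrC.
by field; rewrite gt_eqF.
Qed.

End ExponentialSmear.

(** * The elliptic estimate *)

Section Elliptic.
Context {R : realType}.
Notation leb := (@lebesgue_measure R).
Implicit Types (a da b db p dp r dr om f df : R -> R).

Lemma eq_ae_integrable f g : leb.-integrable setT (EFin \o f) ->
  measurable_fun [set: measurableTypeR R] g -> {ae leb, forall x, f x = g x} ->
  leb.-integrable setT (EFin \o g).
Proof.
move=> /integrableP[/measurable_EFinP mf fo] mg fg.
apply/integrableP; split; first exact/measurable_EFinP.
apply: le_lt_trans fo; rewrite le_eqVlt; apply/orP; left; apply/eqP.
apply: ae_eq_integral => //.
- by apply: measurableT_comp => //; exact/measurable_EFinP.
- by apply: measurableT_comp => //; exact/measurable_EFinP.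
- by apply: ae_mono fg => z /= -> _.
Qed.

Lemma AC_clip b db (A : R) : 0 <= A -> AC b db -> {ae leb, forall y, `|db y| <= A} ->
  exists2 db', AC b db' & forall y, `|db' y| <= A.
Proof.
move=> A0 Ab dA; exists (fun y => Num.max (- A) (Num.min A (db y))); last first.
  by move=> y; rewrite ler_norml le_max lexx /= ge_max ge_min lexx andbT ge0_cp.
apply: (AC_ae Ab).
  have [lb _] := Ab; apply: measurable_maxr => //; apply: measurable_minr => //.
  exact: loc_int_measurable lb.
by apply: ae_mono dA => y; rewrite ler_norml => /andP[d1 d2]; rewrite min_r// max_r.
Qed.

(** With [a = 1/g] and [r = g p'], the equation [(g d/dy)^2 p - kap^2 p = om] is [r' = a (om +
    kap^2 p)], and the estimate follows on integrating [(r p)']. The equations are multiplied by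
    [p] or [p'] so that they hold outside the channel too, where [p] is extended by zero but [r]
    by constants. *)
Lemma elliptic_energy (c kap : R) a da p dp r dr om : 0 < c ->
  AC a da -> AC p dp -> AC r dr -> L2 leb p -> L2 leb dp -> L2 leb om ->
  (forall y, c <= a y <= c^-1) ->
  {ae leb, forall y, r y * p y = dp y * p y / a y} ->
  {ae leb, forall y, r y * dp y = dp y ^+ 2 / a y} ->
  {ae leb, forall y, dr y * p y = a y * (om y + kap ^+ 2 * p y) * p y} ->
  c * (kap ^+ 2 * ip leb p p + ip leb dp dp) <= - ip leb (fun y => a y * p y) om.
Proof.
move=> c0 Aa Ap Ar Lp Ldp Lom ac e1 e2 e3.
have a0 y : 0 < a y by have /andP[h _] := ac y; exact: lt_le_trans h.
have ma := AC_measurable Aa; have mp := AC_measurable Ap; have mr := AC_measurable Ar.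
have mai : measurable_fun [set: measurableTypeR R] (fun y => (a y)^-1).
  apply: continuous_measurableR => y.
  by apply: cvgV; [rewrite gt_eqF|exact: (AC_continuous Aa)].
have aM y : `|a y| <= c^-1 by rewrite gtr0_norm//; case/andP: (ac y).
have aiM y : `|(a y)^-1| <= c^-1.
  by rewrite gtr0_norm ?invr_gt0// lef_pV2 ?posrE//; case/andP: (ac y).
have Lap := L2_bounded_mul ma aM Lp.
have Laidp := L2_bounded_mul mai aiM Ldp.
have := ACM Ar Ap; set dH := (fun x => _ + _) => AH.
have iH : leb.-integrable setT (EFin \o (fun x => r x * p x)).
  apply: (eq_ae_integrable (L2_ip_integrable Laidp Lp)); first exact: measurable_funM.
  by apply: ae_mono e1 => y ->; rewrite mulrC mulrA; ring.
pose h1 y := (a y * p y) * om y; pose h2 y := kap ^+ 2 * ((a y * p y) * p y).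
pose h3 y := ((a y)^-1 * dp y) * dp y.
have i1 : leb.-integrable setT (EFin \o h1) := L2_ip_integrable Lap Lom.
have i20 := L2_ip_integrable Lap Lp.
have i2 : leb.-integrable setT (EFin \o h2) := integrableZl measurableT _ i20.
have i3 : leb.-integrable setT (EFin \o h3) := L2_ip_integrable Laidp Ldp.
have i12 : leb.-integrable setT (EFin \o (fun y => h1 y + h2 y)).
  exact: (integrableD measurableT i1 i2).
have i123 : leb.-integrable setT (EFin \o (fun y => h1 y + h2 y + h3 y)).
  exact: (integrableD measurableT i12 i3).
have mdH : measurable_fun [set: measurableTypeR R] dH.
  by case: AH => /loc_int_measurable.
have eH : {ae leb, forall y, h1 y + h2 y + h3 y = dH y}.
  by apply: ae_mono2 e2 e3 => y E2 E3; rewrite /dH E2 E3 /h1 /h2 /h3; ring.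
have idH := eq_ae_integrable i123 mdH eH.
have := AC_integral_line AH iH idH.
have /measurable_EFinP m123 := measurable_int _ i123.
rewrite -(eq_ae_Rintegral m123 mdH eH).
rewrite (RintegralD measurableT i12 i3) (RintegralD measurableT i1 i2).
rewrite (RintegralZl _ measurableT i20) => E.
have q1 : c * ip leb p p <= \int[leb]_y (a y * p y * p y).
  rewrite -RintegralZl//; last exact: L2_ip_integrable.
  apply: le_Rintegral => //; first exact: (integrableZl measurableT _ (L2_ip_integrable Lp Lp)).
  move=> y _; rewrite -!expr2 -mulrA -expr2 ler_wpM2r ?sqr_ge0//; by case/andP: (ac y).
have q2 : c * ip leb dp dp <= \int[leb]_y h3 y.
  rewrite -RintegralZl//; last exact: L2_ip_integrable.
  apply: le_Rintegral => //; first exact: (integrableZl measurableT _ (L2_ip_integrable Ldp Ldp)).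
  move=> y _; rewrite /h3 -!expr2 -mulrA -expr2 ler_wpM2r ?sqr_ge0//.
  by rewrite -[c]invrK lef_pV2 ?posrE ?invr_gt0//; case/andP: (ac y).
have k2 := sqr_ge0 kap; have := ler_wpM2l k2 q1.
move: E q2; rewrite /ip -/(h1 _); clear; lra.
Qed.

(** Take [eta = b p - kap^-1 (b p)'], which smears to [b p] by [AC_smear]. *)
Lemma smear_representation (kap : R) (kap0 : 0 < kap) (A : R) b db p dp :
  AC b db -> AC p dp -> L2 leb p -> L2 leb dp ->
  (forall y, `|b y| <= A) -> (forall y, `|db y| <= A) ->
  exists eta, [/\ L2 leb eta,
    (fun y => b y * p y) = smear (expP kap0) (-1) eta &
    ip leb eta eta <= 3 * A ^+ 2 * (1 + kap ^- 2) * kap ^- 2 *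
       (kap ^+ 2 * ip leb p p + ip leb dp dp)].
Proof.
move=> Ab Ap Lp Ldp bA dbA.
have A0 : 0 <= A by apply: le_trans (bA 0).
have mb := AC_measurable Ab.
have mdb : measurable_fun [set: measurableTypeR R] db by case: Ab => /loc_int_measurable.
have Lbp := L2_bounded_mul mb bA Lp.
have Ldbp := L2_bounded_mul mdb dbA Lp.
have Lbdp := L2_bounded_mul mb bA Ldp.
have Ld := L2D Ldbp Lbdp.
pose eta y := b y * p y - kap^-1 * (db y * p y + b y * dp y).
have Leta : L2 leb eta by apply: L2B => //; exact: L2Z.
exists eta; split=> //.
  by apply/funext => y; rewrite (AC_smear kap0 y (ACM Ab Ap) Lbp Ld).
have ipp := L2_ip_integrable Lp Lp; have idd := L2_ip_integrable Ldp Ldp.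
set N := 3 * A ^+ 2 * (1 + kap ^- 2) * kap ^- 2.
have i1 : leb.-integrable setT (EFin \o (fun y => kap ^+ 2 * (p y * p y))).
  exact: (integrableZl measurableT _ ipp).
have i2 : leb.-integrable setT (EFin \o (fun y => kap ^+ 2 * (p y * p y) + dp y * dp y)).
  exact: (integrableD measurableT i1 idd).
have -> : N * (kap ^+ 2 * ip leb p p + ip leb dp dp) =
    \int[leb]_y (N * (kap ^+ 2 * (p y * p y) + dp y * dp y)).
  rewrite (RintegralZl _ measurableT i2) (RintegralD measurableT i1 idd).
  by rewrite (RintegralZl _ measurableT ipp).
apply: le_Rintegral => //.
- exact: L2_ip_integrable.
- exact: (integrableZl measurableT _ i2).
move=> y _; rewrite /eta /N.
have sqb (b' : R) : `|b'| <= A -> b' ^+ 2 <= A ^+ 2.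
  by move=> h; rewrite -real_normK ?num_real// ler_pXn2r ?nnegrE.
have B := sqb _ (bA y); have DB := sqb _ (dbA y).
move: (b y) (db y) (p y) (dp y) B DB => b' db' p' dp' B DB.
have kE : kap ^- 2 * kap ^+ 2 = 1 by rewrite mulVf// expf_neq0// gt_eqF.
have kk : kap^-1 ^+ 2 = kap ^- 2 by rewrite exprVn.
have k2 : 0 <= kap ^- 2 by rewrite invr_ge0 sqr_ge0.
(* [(x - s - t)^2 <= 3 (x^2 + s^2 + t^2)] *)
apply: (@le_trans _ _ (3 * ((b' * p') ^+ 2 + (kap^-1 * (db' * p')) ^+ 2
    + (kap^-1 * (b' * dp')) ^+ 2))).
  rewrite (mulrDr kap^-1); move: (b' * p') (kap^-1 * (db' * p')) (kap^-1 * (b' * dp')).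
  move=> x s t; have := sqr_ge0 (x + s); have := sqr_ge0 (x + t).
  have := sqr_ge0 (s - t); clear; lra.
have -> : 3 * A ^+ 2 * (1 + kap ^- 2) * kap ^- 2 * (kap ^+ 2 * (p' * p') + dp' * dp') =
   3 * A ^+ 2 * (1 + kap ^- 2) * (p' ^+ 2 + kap ^- 2 * dp' ^+ 2).
  by rewrite -[X in _ = _ * (X + _)]mul1r -kE; ring.
rewrite !exprMn kk; move: (kap ^- 2) k2 => K K0.
have P2 := sqr_ge0 p'; have D2 := sqr_ge0 dp'; have A2 := sqr_ge0 A.
have t1 := ler_wpM2r P2 B; have t2 := ler_wpM2l K0 (ler_wpM2r P2 DB).
have t3 := ler_wpM2l K0 (ler_wpM2r D2 B).
have t4 : 0 <= K * (K * (A ^+ 2 * dp' ^+ 2)).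
  exact: (mulr_ge0 K0 (mulr_ge0 K0 (mulr_ge0 A2 D2))).
move: t1 t2 t3 t4; clear; lra.
Qed.

Lemma ip_youngN l u v : 0 < l -> L2 leb u -> L2 leb v ->
  - (2 * ip leb u v) <= l * ip leb u u + l^-1 * ip leb v v.
Proof.
move=> l0 Lu Lv; have := ip_young l0 (L2Z (-1) Lu) Lv.
by rewrite !(ipZl _ Lu)//; [rewrite (ipZr _ Lu)//; lra|exact: L2Z].
Qed.

Lemma smear_expZ (kap : R) (kap0 : 0 < kap) (c : R) u : L2 leb u ->
  smear (expP kap0) (-1) (fun y => c * u y) = (fun y => c * smear (expP kap0) (-1) u y).
Proof.
move=> Lu; apply/funext => y; rewrite /smear -RintegralZl//.
have := smear_integrable kap0 y Lu.
by apply: eq_integrable => // r _ /=; rewrite mulN1r opprK.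
Qed.

End Elliptic.

Section EllipticPair.
Context {R : realType} (k : R) (k0 : 0 < `|k|).
Notation leb := (@lebesgue_measure R).
Notation P := (expP k0).
Notation cfun := ((R -> R) * (R -> R))%type.
Implicit Types (a da f df : R -> R) (p dp r dr om : cfun).

(** By [smear_representation] both [a p] and the forcing [i k f p] are smeared functions. In
    [elliptic_energy] the smearing of [a p] is moved onto [om], so the smeared vorticity alone
    controls the energy of [p], and with it the forcing. *)
Lemma elliptic_smoothing (c A B : R) a da f df p dp r dr om : 0 < c ->
  AC a da -> AC f df -> AC p.1 dp.1 -> AC p.2 dp.2 -> AC r.1 dr.1 -> AC r.2 dr.2 ->
  L2c p -> L2c dp -> L2c om ->
  (forall y, c <= a y <= c^-1) -> (forall y, `|a y| <= A) -> (forall y, `|da y| <= A) ->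
  (forall y, `|f y| <= B) -> (forall y, `|df y| <= B) ->
  {ae leb, forall y, r.1 y * p.1 y = dp.1 y * p.1 y / a y /\
                     r.2 y * p.2 y = dp.2 y * p.2 y / a y} ->
  {ae leb, forall y, r.1 y * dp.1 y = dp.1 y ^+ 2 / a y /\
                     r.2 y * dp.2 y = dp.2 y ^+ 2 / a y} ->
  {ae leb, forall y, dr.1 y * p.1 y = a y * (om.1 y + k ^+ 2 * p.1 y) * p.1 y /\
                     dr.2 y * p.2 y = a y * (om.2 y + k ^+ 2 * p.2 y) * p.2 y} ->
  exists eta, [/\ L2c eta,
    (fun y => - (k * (f y * p.2 y)), fun y => k * (f y * p.1 y)) = smear2 P (-1) eta &
    ip2 eta eta <= (3 * B * A * (1 + `|k| ^- 2) / (`|k| * c)) ^+ 2 *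
       ip2 (smear2 P 1 om) (smear2 P 1 om)].
Proof.
move=> c0 Aa Af Ap1 Ap2 Ar1 Ar2 [Lp1 Lp2] [Ldp1 Ldp2] [Lo1 Lo2] ac aA daA fB dfB e1 e2 e3.
have kk : k ^+ 2 = `|k| ^+ 2 by rewrite real_normK ?num_real.
rewrite kk in e3; set kap := `|k| in e3 *; have kap0 : 0 < kap by [].
have A0 : 0 < A.
  apply: lt_le_trans (aA 0); rewrite normr_gt0 gt_eqF//.
  by apply: lt_le_trans c0 _; case/andP: (ac 0).
pose N : R := 3 * (1 + kap ^- 2) * kap ^- 2.
have k2 : 0 < kap ^- 2 by rewrite invr_gt0 exprn_gt0.
have N0 : 0 < N by rewrite mulr_gt0// mulr_gt0// addr_gt0.
pose E (p' dp' : R -> R) : R := kap ^+ 2 * ip leb p' p' + ip leb dp' dp'.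
have NE (A' : R) : 3 * A' ^+ 2 * (1 + kap ^- 2) * kap ^- 2 = N * A' ^+ 2 by rewrite /N; ring.
have key (p' dp' o' : R -> R) : AC p' dp' -> L2 leb p' -> L2 leb dp' -> L2 leb o' ->
    c * E p' dp' <= - ip leb (fun y => a y * p' y) o' ->
    E p' dp' <= N * A ^+ 2 * c ^- 2 * ip leb (smear P 1 o') (smear P 1 o') /\
    exists eta, [/\ L2 leb eta, (fun y => f y * p' y) = smear P (-1) eta &
       ip leb eta eta <= N * B ^+ 2 * E p' dp'].
  move=> Ap Lp Ldp Lo En.
  have [ea [Lea Eea Bea]] := smear_representation kap0 Aa Ap Lp Ldp aA daA.
  have [ef [Lef Eef Bef]] := smear_representation kap0 Af Ap Lp Ldp fB dfB.
  rewrite !NE -/(E p' dp') in Bea Bef.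
  split; last by exists ef.
  rewrite Eea (ip_smear_adj P _ Lea Lo) opprK in En.
  set K := smear _ _ o' in En *.
  have NA : 0 < N * A ^+ 2 by rewrite mulr_gt0// exprn_gt0.
  (* with this weight, Young's inequality returns at most half of the energy *)
  have l0 : 0 < c / (N * A ^+ 2) by rewrite divr_gt0.
  have y := ip_youngN l0 Lea (L2_smear P 1 Lo : L2 leb K).
  have b1 : c / (N * A ^+ 2) * ip leb ea ea <= c * E p' dp'.
    by rewrite -mulrA ler_pM2l// mulrC ler_pdivrMr// mulrC.
  have b2 : c * E p' dp' <= (c / (N * A ^+ 2))^-1 * ip leb K K by move: En y b1; lra.
  rewrite -(ler_pM2l c0); apply: le_trans b2 _.
  by rewrite invf_div le_eqVlt; apply/orP; left; apply/eqP; field; rewrite gt_eqF.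
have En1 := elliptic_energy c0 Aa Ap1 Ar1 Lp1 Ldp1 Lo1 ac
  (ae_mono (fun _ h => proj1 h) e1) (ae_mono (fun _ h => proj1 h) e2)
  (ae_mono (fun _ h => proj1 h) e3).
have En2 := elliptic_energy c0 Aa Ap2 Ar2 Lp2 Ldp2 Lo2 ac
  (ae_mono (fun _ h => proj2 h) e1) (ae_mono (fun _ h => proj2 h) e2)
  (ae_mono (fun _ h => proj2 h) e3).
have [E1 [ef1 [Lef1 Eef1 Bef1]]] := key _ _ _ Ap1 Lp1 Ldp1 Lo1 En1.
have [E2 [ef2 [Lef2 Eef2 Bef2]]] := key _ _ _ Ap2 Lp2 Ldp2 Lo2 En2.
pose eta : cfun := (fun y => - k * ef2 y, fun y => k * ef1 y).
exists eta; split=> //; first by split; exact: L2Z.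
  rewrite /smear2 /= !smear_expZ// -Eef1 -Eef2.
  by congr pair; apply/funext => y; rewrite mulNr.
have -> : ip2 eta eta = kap ^+ 2 * (ip leb ef1 ef1 + ip leb ef2 ef2).
  rewrite /ip2 /= !(ipZl _ Lef1) ?(ipZr _ Lef1)//; last exact: L2Z.
  rewrite !(ipZl _ Lef2) ?(ipZr _ Lef2)//; last exact: L2Z.
  by rewrite -kk; ring.
have k20 : 0 < kap ^+ 2 by rewrite exprn_gt0.
have NB : 0 <= N * B ^+ 2 by rewrite mulr_ge0 ?sqr_ge0 ?ltW.
apply: (@le_trans _ _ (kap ^+ 2 * (N * B ^+ 2 * (E p.1 dp.1 + E p.2 dp.2)))).
  by rewrite ler_pM2l// mulrDr lerD.
set Q := ip2 _ _.
have : E p.1 dp.1 + E p.2 dp.2 <= N * A ^+ 2 * c ^- 2 * Q by rewrite /Q /ip2 mulrDr lerD.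
move=> H; have := ler_wpM2l (ltW k20) (ler_wpM2l NB H).
move/le_trans; apply; rewrite le_eqVlt; apply/orP; left; apply/eqP.
by rewrite /N; field; rewrite !gt_eqF.
Qed.

End EllipticPair.

(** * Fourier series and the Fejer kernel *)

Section FourierSeries.
Context {R : realType}.
Notation leb := (@lebesgue_measure R).
Variable (L : R).
Hypothesis L0 : 0 < L.
Notation J := (`[0, L]%classic : set R).
Notation K := (wavenumber L).
Implicit Types (u v phi psi : R -> R) (x z : R) (m : int) (N : nat).

Definition cosine_moment m phi : R := \int[leb]_x (cos (K m * x) * phi x).
Definition sine_moment m phi : R := \int[leb]_x (sin (K m * x) * phi x).

Lemma bounded_mul_integrable (b phi : R -> R) : measurable_fun [set: measurableTypeR R] b ->
  (forall x, `|b x| <= 1) -> leb.-integrable setT (EFin \o phi) ->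
  leb.-integrable setT (EFin \o (fun x => b x * phi x)).
Proof.
move=> mb b1 iphi; have /measurable_EFinP mphi := measurable_int _ iphi.
apply: le_integrable iphi => //; first by apply/measurable_EFinP; exact: measurable_funM.
by move=> x _ /=; rewrite lee_fin normrM ler_piMl.
Qed.

Lemma cos_mul_integrable (k : R) phi : leb.-integrable setT (EFin \o phi) ->
  leb.-integrable setT (EFin \o (fun x => cos (k * x) * phi x)).
Proof. by apply: bounded_mul_integrable => [|x]; [exact: measurable_cosM|exact: norm_cos_le]. Qed.

Lemma sin_mul_integrable (k : R) phi : leb.-integrable setT (EFin \o phi) ->
  leb.-integrable setT (EFin \o (fun x => sin (k * x) * phi x)).
Proof. by apply: bounded_mul_integrable => [|x]; [exact: measurable_sinM|exact: norm_sin_le]. Qed.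

Lemma trig_integral (I : Type) (r : seq I) (f : I -> int) (a b : I -> R) phi :
  leb.-integrable setT (EFin \o phi) ->
  leb.-integrable setT (EFin \o (fun x =>
    (\sum_(i <- r) (a i * cos (K (f i) * x) + b i * sin (K (f i) * x))) * phi x)) /\
  \int[leb]_x ((\sum_(i <- r) (a i * cos (K (f i) * x) + b i * sin (K (f i) * x))) * phi x) =
  \sum_(i <- r) (a i * cosine_moment (f i) phi + b i * sine_moment (f i) phi).
Proof.
move=> iphi; elim: r => [|i r [IH1 IH2]].
  split.
    rewrite (_ : _ \o _ = cst 0%E); first exact: integrable0.
    by apply/funext => x /=; rewrite big_nil mul0r.
  rewrite big_nil; rewrite (_ : (fun x => _) = cst 0) ?Rintegral_cst0//.
    by rewrite /Rintegral integral0.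
  by apply/funext => x /=; rewrite big_nil mul0r.
have ic := integrableZl measurableT (a i) (cos_mul_integrable (K (f i)) iphi).
have is_ := integrableZl measurableT (b i) (sin_mul_integrable (K (f i)) iphi).
have E : (fun x => (\sum_(j <- i :: r) (a j * cos (K (f j) * x) + b j * sin (K (f j) * x))) * phi x)
  = (fun x => (a i * (cos (K (f i) * x) * phi x) + b i * (sin (K (f i) * x) * phi x)) +
      (\sum_(j <- r) (a j * cos (K (f j) * x) + b j * sin (K (f j) * x))) * phi x).
  by apply/funext => x; rewrite big_cons mulrDl; congr (_ + _); ring.
have ii := integrableD measurableT ic is_.
rewrite E; split; first exact: (integrableD measurableT ii IH1).
rewrite big_cons RintegralD// IH2; congr (_ + _).
rewrite RintegralD// !RintegralZl//; [exact: sin_mul_integrable|exact: cos_mul_integrable].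
Qed.

Definition freq N (i : 'I_N * 'I_N) : int := (i.1 : nat)%:Z - (i.2 : nat)%:Z.

Definition fejer_kernel N (s : R) : R := \sum_(i : 'I_N * 'I_N) cos (K (freq i) * s).

Definition fejer_mean N phi x : R := \sum_(i : 'I_N * 'I_N)
  (cos (K (freq i) * x) * cosine_moment (freq i) phi +
   sin (K (freq i) * x) * sine_moment (freq i) phi).

Definition moment_pairing N phi psi : R := \sum_(i : 'I_N * 'I_N)
  (cosine_moment (freq i) phi * cosine_moment (freq i) psi +
   sine_moment (freq i) phi * sine_moment (freq i) psi).

Let freqK N (i : 'I_N * 'I_N) s : K (freq i) * s = K (i.1 : nat) * s - K (i.2 : nat) * s.
Proof. by rewrite /freq /wavenumber rmorphB/= mulrBr mulrBl. Qed.

Lemma fejer_kernelE N s : fejer_kernel N s =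
  (\sum_(j < N) cos (K (j : nat) * s)) ^+ 2 + (\sum_(j < N) sin (K (j : nat) * s)) ^+ 2.
Proof.
rewrite /fejer_kernel.
under eq_bigr => i _ do rewrite freqK cosB.
rewrite big_split /=; congr (_ + _).
  by rewrite expr2 big_distrlr /= pair_big.
by rewrite expr2 big_distrlr /= pair_big.
Qed.

Lemma fejer_kernel_ge0 N s : 0 <= fejer_kernel N s.
Proof. by rewrite fejer_kernelE addr_ge0 ?sqr_ge0. Qed.

(** The geometric sum [\sum_(j < N) e^{ij theta}], multiplied by [1 - e^{i theta}], telescopes. *)
Lemma geometric_sum_trig N (theta : R) :
  let c := \sum_(j < N) cos (j%:R * theta) in
  let d := \sum_(j < N) sin (j%:R * theta) in
  (1 - cos theta) * c + sin theta * d = 1 - cos (N%:R * theta) /\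
  (1 - cos theta) * d - sin theta * c = - sin (N%:R * theta).
Proof.
elim: N => [|N [IH1 IH2]] /=.
  by rewrite !big_ord0 !mul0r cos0 sin0 subrr oppr0 !mulr0 addr0 subr0.
have E : N.+1%:R * theta = N%:R * theta + theta by rewrite -natr1 mulrDl mul1r.
rewrite !big_ord_recr /= E cosD sinD.
move: IH1 IH2; set c := \sum_(i < N) _; set d := \sum_(i < N) _.
move=> IH1 IH2; split.
  have -> : forall x y : R, (1 - cos theta) * (c + x) + sin theta * (d + y) =
    ((1 - cos theta) * c + sin theta * d) + (1 - cos theta) * x + sin theta * y by move=> x y; ring.
  by rewrite IH1; ring.
have -> : forall x y : R, (1 - cos theta) * (d + y) - sin theta * (c + x) =
    ((1 - cos theta) * d - sin theta * c) + (1 - cos theta) * y - sin theta * x by move=> x y; ring.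
by rewrite IH2; ring.
Qed.

Lemma fejer_kernel_le N s : (2 - 2 * cos (K 1 * s)) * fejer_kernel N s <= 4.
Proof.
rewrite fejer_kernelE.
have KE (j : nat) : K j * s = j%:R * (K 1 * s).
  by rewrite /wavenumber -pmulrn mulr1 !mulrA; congr (_ * _); rewrite mulrC !mulrA.
under eq_bigr => j _ do rewrite KE.
under [X in _ + X ^+ 2]eq_bigr => j _ do rewrite KE.
have [] := geometric_sum_trig N (K 1 * s).
set c := \sum_(i < N) _; set d := \sum_(i < N) _; set th := K 1 * s => h1 h2.
have T1 := cos2Dsin2 th; have T2 := cos2Dsin2 (N%:R * th).
have E : (2 - 2 * cos th) * (c ^+ 2 + d ^+ 2) =
    (1 - cos (N%:R * th)) ^+ 2 + (- sin (N%:R * th)) ^+ 2.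
  rewrite -h1 -h2.
  have -> : 2 - 2 * cos th = 1 - 2 * cos th + (cos th ^+ 2 + sin th ^+ 2) by rewrite T1; ring.
  ring.
rewrite E sqrrN.
have : -1 <= cos (N%:R * th) by exact: cos_geN1.
move: T2; set x := cos _; set y := sin _ => T2 x1; nra.
Qed.

Lemma fejer_meanE N phi x : leb.-integrable setT (EFin \o phi) ->
  leb.-integrable setT (EFin \o (fun z => fejer_kernel N (x - z) * phi z)) /\
  \int[leb]_z (fejer_kernel N (x - z) * phi z) = fejer_mean N phi x.
Proof.
move=> iphi; have [h1 h2] := trig_integral (index_enum _) (@freq N)
  (fun i => cos (K (freq i) * x)) (fun i => sin (K (freq i) * x)) iphi.
have E : (fun z => fejer_kernel N (x - z) * phi z) = (fun z =>
   (\sum_(i : 'I_N * 'I_N) (cos (K (freq i) * x) * cos (K (freq i) * z) +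
      sin (K (freq i) * x) * sin (K (freq i) * z))) * phi z).
  apply/funext => z; congr (_ * _); apply: eq_bigr => i _.
  by rewrite mulrBr cosB.
by rewrite E; split.
Qed.

Lemma fejer_pairing N phi psi : leb.-integrable setT (EFin \o phi) ->
  leb.-integrable setT (EFin \o (fun x => fejer_mean N psi x * phi x)) /\
  \int[leb]_x (fejer_mean N psi x * phi x) = moment_pairing N psi phi.
Proof.
move=> iphi; have [h1 h2] := trig_integral (index_enum _) (@freq N)
  (fun i => cosine_moment (freq i) psi) (fun i => sine_moment (freq i) psi) iphi.
have E : (fun x => fejer_mean N psi x * phi x) = (fun x =>
   (\sum_(i : 'I_N * 'I_N) (cosine_moment (freq i) psi * cos (K (freq i) * x) +
      sine_moment (freq i) psi * sin (K (freq i) * x))) * phi x).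
  apply/funext => x; congr (_ * _); apply: eq_bigr => i _.
  by congr (_ + _); rewrite mulrC.
by rewrite E; split.
Qed.

Lemma moment_pairingC N phi psi : moment_pairing N phi psi = moment_pairing N psi phi.
Proof. by apply: eq_bigr => i _; congr (_ + _); rewrite mulrC. Qed.

(** The constant function of the circle, extended by zero like every other function on it. *)
Definition circle_one : R -> R := (fun=> 1 : R) \_ J.

Lemma circle_one_in x : J x -> circle_one x = 1.
Proof. by move=> Jx; rewrite /circle_one patchE mem_set. Qed.

Lemma circle_one_out x : ~ J x -> circle_one x = 0.
Proof. by move=> nJ; rewrite /circle_one patchE memNset. Qed.

Section Energy.
Variable u : R -> R.
Hypotheses (Lu : L2 leb u) (uJ : forall x, ~ J x -> u x = 0).

Lemma circle_one_sqr x : circle_one x ^+ 2 = circle_one x.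
Proof. by rewrite /circle_one patchE; case: ifP => _; rewrite ?expr1n ?expr0n. Qed.

Lemma circle_one_id x : u x * circle_one x = u x.
Proof.
rewrite /circle_one patchE; case: ifPn => [_|/negP nJ]; first by rewrite mulr1.
by rewrite uJ ?mul0r// => Jx; apply: nJ; rewrite mem_set.
Qed.

Lemma circle_one_integrable : leb.-integrable setT (EFin \o circle_one).
Proof.
apply: integrable_patch; first exact: measurable_itv.
apply: (@continuous_itv_integrable R (fun=> 1 : R)); exact: cst_continuous.
Qed.

Lemma L2_circle_one : L2 leb circle_one.
Proof.
split; first by have /measurable_EFinP := measurable_int _ circle_one_integrable.
rewrite (_ : (fun x => circle_one x ^+ 2) = circle_one); first exact: circle_one_integrable.
by apply/funext => x; rewrite circle_one_sqr.
Qed.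

Let iu : leb.-integrable setT (EFin \o u).
Proof.
rewrite (_ : u = fun x => u x * circle_one x); first exact: L2_ip_integrable Lu L2_circle_one.
by apply/funext => x; rewrite circle_one_id.
Qed.

Let iu2 : leb.-integrable setT (EFin \o (fun x => u x ^+ 2)).
Proof. exact: L2_sqr_integrable. Qed.

Let dist2 x z : R := (u x * circle_one z - u z * circle_one x) ^+ 2.

Let dist2E x : dist2 x = fun z => u x ^+ 2 * circle_one z + (- (2 * u x)) * u z + circle_one x * u z ^+ 2.
Proof.
apply/funext => z; rewrite /dist2.
have h1 := circle_one_sqr x; have h2 := circle_one_sqr z.
have h3 := circle_one_id x; have h4 := circle_one_id z.
have -> : (u x * circle_one z - u z * circle_one x) ^+ 2 = u x ^+ 2 * circle_one z ^+ 2
  - 2 * (u x * circle_one x) * (u z * circle_one z) + circle_one x ^+ 2 * u z ^+ 2 by ring.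
by rewrite h1 h2 h3 h4; ring.
Qed.

(** Expanding the square and the kernel, every term factors into moments. The factors
    [circle_one] confine both variables to one period. *)
Lemma circle_energy N :
  [/\ forall x, leb.-integrable setT (EFin \o (fun z => fejer_kernel N (x - z) * dist2 x z)),
      leb.-integrable setT (EFin \o (fun x => \int[leb]_z (fejer_kernel N (x - z) * dist2 x z))) &
      \int[leb]_x (\int[leb]_z (fejer_kernel N (x - z) * dist2 x z)) =
      2 * (moment_pairing N circle_one (fun x => u x ^+ 2) - moment_pairing N u u)].
Proof.
have i1 := circle_one_integrable.
have inner x : leb.-integrable setT (EFin \o (fun z => fejer_kernel N (x - z) * dist2 x z)) /\
    \int[leb]_z (fejer_kernel N (x - z) * dist2 x z) =
    fejer_mean N circle_one x * u x ^+ 2 + (- 2) * (fejer_mean N u x * u x) +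
    fejer_mean N (fun x => u x ^+ 2) x * circle_one x.
  have [k1 m1] := fejer_meanE N x i1; have [k2 m2] := fejer_meanE N x iu.
  have [k3 m3] := fejer_meanE N x iu2.
  rewrite -m1 -m2 -m3 dist2E.
  have k1' := integrableZl measurableT (u x ^+ 2) k1.
  have k2' := integrableZl measurableT (- (2 * u x)) k2.
  have k3' := integrableZl measurableT (circle_one x) k3.
  have k12 := integrableD measurableT k1' k2'.
  have E : (fun z => fejer_kernel N (x - z) * (u x ^+ 2 * circle_one z + - (2 * u x) * u z +
      circle_one x * u z ^+ 2)) =
    (fun z => (u x ^+ 2 * (fejer_kernel N (x - z) * circle_one z) +
     - (2 * u x) * (fejer_kernel N (x - z) * u z)) +
     circle_one x * (fejer_kernel N (x - z) * u z ^+ 2)).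
    by apply/funext => z; ring.
  rewrite E; split; first exact: (integrableD measurableT k12 k3').
  rewrite (RintegralD measurableT k12 k3') (RintegralD measurableT k1' k2').
  by rewrite !RintegralZl//; ring.
have [i0 p1] := fejer_pairing N circle_one iu2.
have [i2 p2] := fejer_pairing N u iu.
have [i3 p3] := fejer_pairing N (fun x => u x ^+ 2) circle_one_integrable.
have i2' := integrableZl measurableT (- 2) i2.
have i02 := integrableD measurableT i0 i2'.
have -> : (fun x => \int[leb]_z (fejer_kernel N (x - z) * dist2 x z)) = fun x =>
    fejer_mean N circle_one x * u x ^+ 2 + (- 2) * (fejer_mean N u x * u x) +
    fejer_mean N (fun x => u x ^+ 2) x * circle_one x.
  by apply/funext => x; rewrite (inner x).2.
split; first by move=> x; have [] := inner x.
  exact: (integrableD measurableT i02 i3).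
rewrite (RintegralD measurableT i02 i3) (RintegralD measurableT i0 i2').
rewrite RintegralZl// p1 p2 p3.
by rewrite [moment_pairing N (fun x => _) _]moment_pairingC; ring.
Qed.

Let KL m : cos (K m * L) = 1 /\ sin (K m * L) = 0.
Proof.
have KE (n : nat) : K n * L = 0 + (pi *+ 2) *+ n.
  rewrite /wavenumber add0r -pmulrn -mulrA [n%:R * L]mulrC mulrA divfK ?gt_eqF//.
  by rewrite mulr_natr mulr_natl.
have H (n : nat) : cos (K n * L) = 1 /\ sin (K n * L) = 0.
  by rewrite KE !(periodicn (@cosD2pi R), periodicn (@sinD2pi R)) cos0 sin0.
case: m => n; first exact: H.
rewrite NegzE /wavenumber rmorphN mulrN mulNr cosN sinN.
by have [-> ->] := H n.+1; rewrite oppr0.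
Qed.

Lemma cosine_moment_one m : cosine_moment m circle_one = if m == 0 then L else 0.
Proof.
have E : (fun x => cos (K m * x) * circle_one x) = (fun x => cos (K m * x)) \_ J.
  apply/funext => x; rewrite /circle_one !patchE; case: ifP => _; first by rewrite mulr1.
  by rewrite mulr0.
rewrite /cosine_moment E -Rintegral_mkcond.
have [->|m0] := eqVneq m 0.
  have dF x : is_derive (x : R) 1 (id : R -> R) (cos (K 0 * x)).
    by rewrite /wavenumber mulr0 mul0r cos0; exact: is_derive_id.
  by rewrite (Rintegral_FTC (ltW L0) dF) ?subr0//; exact: continuous_cosM.
have k0 : K m != 0.
  by rewrite /wavenumber mulf_neq0 ?intr_eq0// gt_eqF// divr_gt0// mulr_gt0// pi_gt0.
have dF x : is_derive (x : R) 1 (fun x : R => (K m)^-1 * sin (K m * x)) (cos (K m * x)).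
  by apply: is_derive_eq; rewrite /GRing.scale/=; field.
rewrite (Rintegral_FTC (ltW L0) dF); last exact: continuous_cosM.
by rewrite (KL m).2 !mulr0 sin0 mulr0 subrr.
Qed.

Lemma sine_moment_one m : sine_moment m circle_one = 0.
Proof.
have E : (fun x => sin (K m * x) * circle_one x) = (fun x => sin (K m * x)) \_ J.
  apply/funext => x; rewrite /circle_one !patchE; case: ifP => _; first by rewrite mulr1.
  by rewrite mulr0.
rewrite /sine_moment E -Rintegral_mkcond.
have [->|m0] := eqVneq m 0.
  rewrite (_ : (fun x => _) = cst 0) ?Rintegral_cst0//; first by rewrite /Rintegral integral0.
  by apply/funext => x; rewrite /wavenumber mulr0 mul0r sin0.
have k0 : K m != 0.
  by rewrite /wavenumber mulf_neq0 ?intr_eq0// gt_eqF// divr_gt0// mulr_gt0// pi_gt0.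
have dF x : is_derive (x : R) 1 (fun x : R => - ((K m)^-1 * cos (K m * x))) (sin (K m * x)).
  by apply: is_derive_eq; rewrite /GRing.scale/=; field.
rewrite (Rintegral_FTC (ltW L0) dF); last exact: continuous_sinM.
by rewrite (KL m).1 mulr0 cos0 subrr.
Qed.

Lemma moment_pairing_one N phi : moment_pairing N circle_one phi = N%:R * (L * \int[leb]_x phi x).
Proof.
have -> : moment_pairing N circle_one phi =
    \sum_(j < N) \sum_(l < N) (if j == l then L * \int[leb]_x phi x else 0).
  rewrite pair_big /=; apply: eq_bigr => -[j l] _.
  rewrite /= cosine_moment_one sine_moment_one mul0r addr0 /freq subr_eq0 /=.
  rewrite eqz_nat -val_eqE/=; case: ifP => [/eqP jl|_]; last by rewrite mul0r.
  congr (_ * _); apply: eq_Rintegral => x _.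
  by rewrite jl subrr /wavenumber mulr0 mul0r cos0 mul1r.
rewrite (eq_bigr (fun=> L * \int[leb]_x phi x)) ?sumr_const ?card_ord ?mulr_natl// => j _.
by rewrite (bigD1 j)//= eqxx big1 ?addr0// => l /negPf lj; rewrite eq_sym lj.
Qed.

(** The difference of the two sides is half of the integral in [circle_energy], which is
    nonnegative. *)
Lemma circle_bessel N : moment_pairing N u u <= N%:R * (L * ip leb u u).
Proof.
have [_ _ E] := circle_energy N; rewrite moment_pairing_one in E.
have -> : ip leb u u = \int[leb]_x (u x ^+ 2) by apply: eq_Rintegral => x _; rewrite expr2.
rewrite -subr_ge0 -(pmulr_rge0 _ (ltr0n R 2)) -E.
apply: Rintegral_ge0 => x _; apply: Rintegral_ge0 => z _.
by rewrite mulr_ge0 ?fejer_kernel_ge0 ?sqr_ge0.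
Qed.

(** [fejer_kernel_le] bounds the kernel times the squared chord [2 - 2 cos], so the integrand of
    [circle_energy] is bounded independently of [N]. *)
Lemma circle_parseval_lipschitz N (C : R) : 0 <= C ->
  (forall x z, J x -> J z -> (u x - u z) ^+ 2 <= C * (2 - 2 * cos (K 1 * (x - z)))) ->
  N%:R * (L * ip leb u u) - moment_pairing N u u <= 2 * C * L ^+ 2.
Proof.
move=> C0 uC.
have [k1 k2 E] := circle_energy N; rewrite moment_pairing_one in E.
have -> : ip leb u u = \int[leb]_x (u x ^+ 2) by apply: eq_Rintegral => x _; rewrite expr2.
rewrite -(@ler_pM2l _ 2)// -E.
have i1 := circle_one_integrable.
have I1 : \int[leb]_x circle_one x = L.
  have := cosine_moment_one 0; rewrite eqxx => <-.
  by apply: eq_Rintegral => x _; rewrite /wavenumber mulr0 mul0r cos0 mul1r.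
have i1Z (a : R) := integrableZl measurableT a i1.
have inner x : \int[leb]_z (fejer_kernel N (x - z) * dist2 x z) <= 4 * C * L * circle_one x.
  have -> : 4 * C * L * circle_one x = \int[leb]_z (4 * C * circle_one x * circle_one z).
    by rewrite RintegralZl// I1; ring.
  apply: (le_Rintegral _ (k1 x) (i1Z (4 * C * circle_one x))) => // z _.
  rewrite /dist2; have [Jx|nJx] := pselect (J x); last first.
    by rewrite (circle_one_out nJx) (uJ nJx) mul0r mulr0 subrr expr0n/= !mulr0 mul0r.
  have [Jz|nJz] := pselect (J z); last first.
    by rewrite (circle_one_out nJz) (uJ nJz) mul0r mulr0 subrr expr0n/= !mulr0.
  rewrite (circle_one_in Jx) (circle_one_in Jz) !mulr1.
  apply: le_trans (ler_wpM2l (fejer_kernel_ge0 N (x - z)) (uC x z Jx Jz)) _.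
  rewrite mulrCA [4 * C]mulrC ler_wpM2l// mulrC; exact: fejer_kernel_le.
apply: le_trans (le_Rintegral _ k2 (i1Z (4 * C * L)) _) _ => //.
rewrite RintegralZl// I1 le_eqVlt; apply/orP; left; apply/eqP; ring.
Qed.

End Energy.

End FourierSeries.

(** * Completeness of the trigonometric system *)

Section CircleDistance.
Context {R : realType}.
Implicit Types (a t : R).

Lemma sin_ge_half a : 0 <= a <= 1 -> a / 2 <= sin a.
Proof.
move=> /andP[a0 a1].
have cc : continuous (fun x : R => cos x) by exact: continuous_cos.
have E : cint 0 a (fun x => cos x) = sin a.
  by rewrite /cint (Rintegral_FTC a0 (fun x => is_derive_sin x) cc) sin0 subr0.
rewrite -E; have := @cint_ge_cst R 0 a (fun x => cos x) 2^-1 a0 cc.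
rewrite subr0 mulrC; apply => x /andP[x0 xa].
have := one_sub_cos_le_sqr x.
have : x ^+ 2 <= 1 by rewrite expr_le1// (le_trans xa).
lra.
Qed.

Lemma sin_ge_quarter a : 0 <= a <= pi / 2 -> a / 4 <= sin a.
Proof.
move=> /andP[a0 ap].
have [a1|a1] := leP a 1; first by have := @sin_ge_half a; rewrite a0 a1 => /(_ isT); lra.
have p2 := @pihalf_lt2 R.
have s1 : 1 / 2 <= sin (1 : R) by apply: sin_ge_half; rewrite ler01 lexx.
have : sin (1 : R) < sin a.
  by rewrite ltr_sin// in_itv/=; apply/andP; split; lra.
lra.
Qed.

Lemma chord_ge t : 0 <= t <= pi -> t ^+ 2 / 16 <= 2 - 2 * cos t.
Proof.
move=> /andP[t0 tp].
have tE : t = t / 2 + t / 2 by exact: splitr.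
have h0 : 0 <= t / 2 by rewrite divr_ge0.
have := @sin_ge_quarter (t / 2); rewrite h0 ler_pM2r// tp => /(_ isT) hs.
have T := cos2Dsin2 (t / 2).
rewrite {2}tE cosD -!expr2.
have : (t / 2 / 4) ^+ 2 <= sin (t / 2) ^+ 2 by rewrite ler_sqr// nnegrE; lra.
move: T; set c := cos _; set s := sin _ => T; lra.
Qed.

End CircleDistance.

Section Density.
Context {R : realType}.
Notation leb := (@lebesgue_measure R).
Variable (L : R).
Hypothesis L0 : 0 < L.
Notation J := (`[0, L]%classic : set R).
Notation K := (wavenumber L).
Implicit Types (u v w : R -> R) (x z e : R) (N : nat).

(** The shorter arc between two points may run through the ends of the period, where [v]
    vanishes. *)
Lemma lipschitz_circle v (l : R) : 0 <= l -> (forall x z, x <= z -> `|v z - v x| <= l * (z - x)) ->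
  v 0 = 0 -> v L = 0 ->
  forall x z, J x -> J z ->
    (v x - v z) ^+ 2 <= (4 * l ^+ 2 * L ^+ 2) * (2 - 2 * cos (K 1 * (x - z))).
Proof.
move=> l0 vl v0 vL.
have key r (d : R) : 0 <= r <= L / 2 -> `|d| <= l * r ->
    d ^+ 2 <= (4 * l ^+ 2 * L ^+ 2) * (2 - 2 * cos (K 1 * r)).
  move=> /andP[r0 rL] dr.
  have pi0 := @pi_gt0 R; have pi2 := @pi_ge2 R.
  have KE : K 1 * r = 2 * pi / L * r by rewrite /wavenumber mulr1.
  have th : 0 <= K 1 * r <= pi.
    rewrite KE; apply/andP; split; first by rewrite !mulr_ge0 ?invr_ge0// ltW.
    rewrite mulrAC ler_pdivrMr// -mulrA mulrCA ler_pM2l// mulrC.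
    by move: rL; rewrite ler_pdivlMr.
  have C0 : 0 <= 4 * l ^+ 2 * L ^+ 2 by rewrite mulr_ge0 ?sqr_ge0// mulr_ge0 ?sqr_ge0.
  apply: le_trans (ler_wpM2l C0 (chord_ge th)).
  have d2 : d ^+ 2 <= (l * r) ^+ 2 by exact: sqr_le_of_norm.
  apply: le_trans d2 _; rewrite KE.
  have -> : 4 * l ^+ 2 * L ^+ 2 * ((2 * pi / L * r) ^+ 2 / 16) = (l * r) ^+ 2 * pi ^+ 2.
    by field; rewrite gt_eqF.
  by rewrite ler_peMr ?sqr_ge0// expr_ge1//; lra.
have sym x z : (4 * l ^+ 2 * L ^+ 2) * (2 - 2 * cos (K 1 * (x - z))) =
    (4 * l ^+ 2 * L ^+ 2) * (2 - 2 * cos (K 1 * (z - x))).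
  by rewrite -[z - x]opprB mulrN cosN.
suff H x z : J x -> J z -> x <= z ->
    (v x - v z) ^+ 2 <= (4 * l ^+ 2 * L ^+ 2) * (2 - 2 * cos (K 1 * (z - x))).
  move=> x z Jx Jz; have [xz|/ltW zx] := leP x z; first by rewrite sym; exact: H.
  by rewrite -sqrrN opprB; exact: H.
rewrite /= !in_itv/= => /andP[x0 xL] /andP[z0 zL] xz.
have [s|s] := leP (z - x) (L / 2).
  apply: key; first by rewrite subr_ge0 xz.
  by rewrite distrC; exact: vl.
have -> : cos (K 1 * (z - x)) = cos (K 1 * (L - (z - x))).
  rewrite [in RHS]mulrBr (_ : K 1 * L = pi *+ 2); last first.
    by rewrite /wavenumber mulr1 divfK ?gt_eqF// mulr_natl.
  by rewrite [in RHS]addrC cosD2pi cosN.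
apply: key; first by apply/andP; split; lra.
have -> : v x - v z = (v x - v 0) + (v L - v z) by rewrite v0 vL; ring.
have h1 := vl 0 x x0; have h2 := vl z L zL.
apply: le_trans (ler_normD _ _) _; apply: le_trans (lerD h1 h2) _.
by rewrite -mulrDr le_eqVlt; apply/orP; left; apply/eqP; congr (_ * _); ring.
Qed.


Definition on_circle u := L2 leb u /\ (forall x, ~ J x -> u x = 0).

(** [N * L] times what the Fejer mean of order [N] misses of the inner product. *)
Definition fejer_defect N u v : R := N%:R * (L * ip leb u v) - moment_pairing L N u v.

Lemma on_circle_lin (a : R) u v : on_circle u -> on_circle v -> on_circle (fun x => a * u x + v x).
Proof.
move=> [Lu u0] [Lv v0]; split; first exact: L2D (L2Z a Lu) Lv.
by move=> x nJ; rewrite u0// v0// mulr0 addr0.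
Qed.

Lemma on_circle_integrable u : on_circle u -> leb.-integrable setT (EFin \o u).
Proof.
move=> [Lu u0].
have -> : u = (fun x => u x * circle_one L x) by apply/funext => x; rewrite circle_one_id.
exact: L2_ip_integrable Lu (L2_circle_one L).
Qed.

Lemma moment_lin (b : R -> R) (a : R) u v : measurable_fun [set: measurableTypeR R] b ->
  (forall x, `|b x| <= 1) -> on_circle u -> on_circle v ->
  \int[leb]_x (b x * (a * u x + v x)) = a * \int[leb]_x (b x * u x) + \int[leb]_x (b x * v x).
Proof.
move=> mb b1 /on_circle_integrable iu /on_circle_integrable iv.
have ibu := bounded_mul_integrable mb b1 iu; have ibv := bounded_mul_integrable mb b1 iv.
have E : a * \int[leb]_x (b x * u x) = \int[leb]_x (a * (b x * u x)) by rewrite RintegralZl.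
rewrite E -(RintegralD _ (integrableZl _ a ibu) ibv)//.
by apply: eq_Rintegral => x _; ring.
Qed.

Lemma fejer_defect_lin N (a : R) u v w : on_circle u -> on_circle v -> on_circle w ->
  fejer_defect N (fun x => a * u x + v x) w = a * fejer_defect N u w + fejer_defect N v w.
Proof.
move=> Du Dv Dw; rewrite /fejer_defect.
have [Lu _] := Du; have [Lv _] := Dv; have [Lw _] := Dw.
have -> : ip leb (fun x => a * u x + v x) w = a * ip leb u w + ip leb v w.
  by rewrite -ipZl// -ipDl//; exact: L2Z.
have -> : moment_pairing L N (fun x => a * u x + v x) w =
    a * moment_pairing L N u w + moment_pairing L N v w.
  rewrite mulr_sumr -big_split /=; apply: eq_bigr => i _.
  rewrite /cosine_moment /sine_moment.
  rewrite (moment_lin a (measurable_cosM (K (freq i))) (fun x => norm_cos_le _) Du Dv).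
  rewrite (moment_lin a (measurable_sinM (K (freq i))) (fun x => norm_sin_le _) Du Dv).
  by ring.
by ring.
Qed.

Let circle_lin (a : R) (u v : R -> R^o) : on_circle u -> on_circle v -> on_circle (a *: u + v).
Proof. exact: on_circle_lin. Qed.

Lemma fejer_defect_psd N :
  psd_form (on_circle : (R -> R^o) -> Prop) (fejer_defect N : (R -> R^o) -> (R -> R^o) -> R).
Proof.
split.
- by move=> u v _ _; rewrite /fejer_defect ipC moment_pairingC.
- by move=> a u v w; exact: fejer_defect_lin.
- by move=> u [Lu u0]; rewrite subr_ge0; exact: circle_bessel.
Qed.

Lemma moment_pairing_ge0 N u : 0 <= moment_pairing L N u u.
Proof. by apply: sumr_ge0 => i _; rewrite -!expr2 addr_ge0 ?sqr_ge0. Qed.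

Lemma fejer_defect_le N u : fejer_defect N u u <= N%:R * (L * ip leb u u).
Proof. by rewrite gerBl moment_pairing_ge0. Qed.

Definition fejer_complete u := forall e : R, 0 < e ->
  exists N0 : nat, forall N, (N0 <= N)%N -> fejer_defect N u u <= e * N%:R.

Lemma fejer_complete_lipschitz v (l : R) : on_circle v -> 0 <= l ->
  (forall x z, x <= z -> `|v z - v x| <= l * (z - x)) -> v 0 = 0 -> v L = 0 -> fejer_complete v.
Proof.
move=> [Lv vJ] l0 vl v0 vL e e0; pose C := 4 * l ^+ 2 * L ^+ 2.
have C0 : 0 <= C by rewrite mulr_ge0 ?sqr_ge0// mulr_ge0 ?sqr_ge0.
pose B := 2 * C * L ^+ 2; exists (Num.bound (B / e)) => N NN.
have B0 : 0 <= B by rewrite mulr_ge0 ?sqr_ge0// mulr_ge0.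
apply: le_trans (circle_parseval_lipschitz L0 Lv vJ N C0 (lipschitz_circle l0 vl v0 vL)) _.
rewrite -ler_pdivrMl// mulrC; apply: le_trans (_ : _ <= (Num.bound (B / e))%:R) _.
  by rewrite ltW// archi_boundP// divr_ge0// ltW.
by rewrite ler_nat.
Qed.

(** The defect divided by [N] is a nonnegative form, bounded by the square norm uniformly in
    [N]. *)
Lemma fejer_complete_closed u : on_circle u ->
  (forall e : R, 0 < e -> exists v, [/\ on_circle v, fejer_complete v &
     ip leb (fun x => u x - v x) (fun x => u x - v x) <= e]) -> fejer_complete u.
Proof.
move=> Du app e e0.
have d0 : 0 < e / 4 / L by rewrite !divr_gt0.
have [v [Dv cv uv]] := app _ d0; have e40 : 0 < e / 4 by rewrite divr_gt0.
have [N0 N0P] := cv _ e40; exists N0 => N /N0P vN.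
pose u' : R -> R^o := u; pose v' : R -> R^o := v.
have Dw : on_circle (u' - v') by exact: (DB circle_lin).
have uE : fejer_defect N u u = fejer_defect N (v' + (u' - v')) (v' + (u' - v')) by rewrite addrC subrK.
have h1 : fejer_defect N u u <= 2 * fejer_defect N v v + 2 * fejer_defect N (u' - v') (u' - v').
  by rewrite uE; exact: (form_sqrD_le circle_lin (fejer_defect_psd N) Dv Dw).
have h2 : fejer_defect N (u' - v') (u' - v') <= N%:R * (e / 4).
  apply: le_trans (fejer_defect_le _ _) _; apply: ler_wpM2l => //.
  by rewrite mulrC -ler_pdivlMr.
move: h1 h2 vN; move: (fejer_defect N u u) (fejer_defect N v v) (fejer_defect N _ _) => p q r.
by clear; move: N%:R => n h1 h2 h3; lra.
Qed.

Lemma integral_bounded_le (u : R -> R) (M a b : R) : leb.-integrable setT (EFin \o u) -> a <= b ->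
  (forall x, `|u x| <= M) -> `|\int[leb]_(x in `]a, b]) u x| <= M * (b - a).
Proof.
move=> iu ab uM.
have iab : leb.-integrable `]a, b] (EFin \o u) by exact: integrableS iu.
apply: le_trans (le_normr_Rintegral _ iab) _ => //.
have icst : leb.-integrable `[a, b] (EFin \o (fun=> M)).
  by apply: continuous_itv_integrable; exact: cst_continuous.
have icst' : leb.-integrable `]a, b] (EFin \o (fun=> M)).
  by apply: integrableS icst => //; apply: subset_itvr; rewrite bnd_simp.
rewrite -(cint_cst M ab) /cint -(Rintegral_itv_obnd_cbnd icst').
by apply: le_Rintegral => //; exact: integrable_norm.
Qed.

Lemma lipschitz_continuous_fun (v : R -> R) (l : R) :
  (forall x z, x <= z -> `|v z - v x| <= l * (z - x)) -> continuous v.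
Proof.
move=> vl x; apply/cvgrPdist_lt => e e0.
have l1 : 0 < `|l| + 1 by rewrite ltr_wpDl.
near=> z.
have xz : `|x - z| < e / (`|l| + 1) by near: z; apply: cvgr_dist_lt; [exact: cvg_id|rewrite divr_gt0].
have H : `|v x - v z| <= (`|l| + 1) * `|x - z|.
  have ll : l <= `|l| + 1 by rewrite (le_trans (ler_norm l))// lerDl.
  have [h|/ltW h] := leP x z.
    rewrite distrC [`|x - z|]distrC (ger0_norm (_ : 0 <= z - x)) ?subr_ge0//.
    by apply: le_trans (vl _ _ h) _; rewrite ler_wpM2r ?subr_ge0.
  rewrite (ger0_norm (_ : 0 <= x - z)) ?subr_ge0//.
  by apply: le_trans (vl _ _ h) _; rewrite ler_wpM2r ?subr_ge0.
by apply: le_lt_trans H _; rewrite mulrC -ltr_pdivlMr.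
Unshelve. all: by end_near. Qed.

(** The averages [h^-1 * \int_x^(x+h) u] are Lipschitz, vanish at the ends of the period, and
    converge to [u] almost everywhere by Lebesgue's differentiation theorem. *)
Lemma fejer_complete_bounded u (M d : R) : measurable_fun [set: measurableTypeR R] u ->
  0 < d -> (forall x, `|u x| <= M) -> (forall x, u x != 0 -> d <= x <= L - d) -> fejer_complete u.
Proof.
move=> mu0 d0 uM usupp.
have M0 : 0 <= M := le_trans (normr_ge0 _) (uM 0).
have uJ x : ~ J x -> u x = 0.
  move=> nJ; apply/eqP; apply: contra_notT nJ => /usupp /andP[h1 h2].
  by rewrite /= in_itv/=; apply/andP; split; lra.
pose G x := M * circle_one L x.
have LG : L2 leb G by exact: L2Z (L2_circle_one L).
have G_of w : (forall x, `|w x| <= M) -> (forall x, ~ J x -> w x = 0) -> forall x, `|w x| <= G x.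
  move=> wM wJ x; rewrite /G; have [Jx|nJ] := pselect (J x).
    by rewrite circle_one_in// mulr1.
  by rewrite wJ// normr0 circle_one_out// mulr0.
have Du : on_circle u.
  split=> //; apply: (L2_le mu0 LG) => x; exact: sqr_le_of_norm (G_of _ uM uJ x).
have iu := on_circle_integrable Du.
pose U (x : R) : R := \int[leb]_(z in `]-oo, x]) u z.
have iuD (A : set (measurableTypeR R)) : measurable A -> leb.-integrable A (EFin \o u).
  by move=> mA; exact: integrableS iu.
have UE x z : x <= z -> U z - U x = \int[leb]_(y in `]x, z]) u y.
  move=> xz; have := @Rintegral_itvB _ u -oo%O (BRight z) x (iuD `]-oo, z]%classic (measurable_itv _)).
  by rewrite !bnd_simp => /(_ isT xz).
have Ulip x z : x <= z -> `|U z - U x| <= M * (z - x).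
  by move=> xz; rewrite UE//; exact: integral_bounded_le.
have U0 x z : x <= z -> (forall y, x < y <= z -> u y = 0) -> U z - U x = 0.
  move=> xz u0; rewrite UE// (@eq_Rintegral _ _ _ _ _ (cst 0)) ?Rintegral_cst ?mul0r//.
  by move=> y; rewrite inE/= in_itv/= => /u0.
pose h (n : nat) : R := d / (n.+2)%:R.
have h0 n : 0 < h n by rewrite divr_gt0.
have hd n : h n < d.
  by rewrite ltr_pdivrMr// ltr_pMr// ltr1n.
pose v n (x : R) : R := (h n)^-1 * (U (x + h n) - U x).
have v_lip n x z : x <= z -> `|v n z - v n x| <= (2 * M / h n) * (z - x).
  move=> xz; rewrite /v -mulrBr normrM gtr0_norm ?invr_gt0//.
  have -> : 2 * M / h n * (z - x) = (h n)^-1 * (M * (z - x) + M * (z - x)) by ring.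
  apply: ler_wpM2l; first by rewrite invr_ge0 ltW.
  have -> : U (z + h n) - U z - (U (x + h n) - U x) = (U (z + h n) - U (x + h n)) - (U z - U x) by ring.
  apply: le_trans (ler_normB _ _) (lerD _ _); last exact: Ulip.
  have := @Ulip (x + h n) (z + h n); rewrite lerD2r => /(_ xz).
  by rewrite opprD addrACA subrr addr0.
have vM n x : `|v n x| <= M.
  rewrite /v normrM gtr0_norm ?invr_gt0// mulrC ler_pdivrMr//.
  have := @Ulip x (x + h n); rewrite lerDl (ltW (h0 n)) => /(_ isT).
  by rewrite addrAC subrr add0r.
have v0 n x : ~ (0 < x < L) -> v n x = 0.
  move=> nx; rewrite /v U0 ?mulr0// ?lerDl ?(ltW (h0 n))// => y /andP[xy yx].
  apply/eqP; apply: contra_notT nx => /usupp /andP[dy yL].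
  by have := hd n; move=> hn; apply/andP; split; lra.
have vJ n x : ~ J x -> v n x = 0.
  move=> nJ; apply: v0 => /andP[x0 xL]; apply: nJ.
  by rewrite /= in_itv/= !ltW.
have cv n : continuous (v n) := lipschitz_continuous_fun (v_lip n).
have mv n : measurable_fun [set: measurableTypeR R] (v n) by exact: continuous_measurableR.
have Dv n : on_circle (v n).
  split; last exact: vJ.
  by apply: (L2_le (mv n) LG) => x; exact: sqr_le_of_norm (G_of _ (vM n) (vJ n) x).
have vu : {ae leb, forall x, (fun n => v n x) @ \oo --> u x}.
  have li : locally_integrable [set: R] u by exact: open_integrable_locally openT iu.
  have := FTC1Ny (fun y => iuD `]-oo, y]%classic (measurable_itv _)) li.
  apply: ae_mono => x [dU dUE].
  have c : (fun r => r^-1 *: (U (r + x) - U x)) @ 0^' --> u x.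
    have E : (fun r => r^-1 *: ((U \o shift x) (r *: 1) - U x)) =
        (fun r => r^-1 *: (U (r + x) - U x)).
      by apply/funext => r; rewrite /= [r *: 1]mulr1.
    by move: dU dUE; rewrite /derivable /derive1 E => dU <-; exact: dU.
  have hc : h @ \oo --> (0 : R).
    have -> : h = (fun n => d * harmonic n.+1) by [].
    rewrite -(mulr0 d); apply: cvgM; first exact: cvg_cst.
    by have := @cvg_harmonic R; rewrite -cvg_shiftS.
  have := (cvgr_dnbhsP _ _ _).1 c h (conj (fun n => lt0r_neq0 (h0 n)) hc).
  have -> // : (fun n => (h n)^-1 *: (U (h n + x) - U x)) = (fun n => v n x).
  by apply/funext => n; rewrite [h n + x]addrC.
apply: fejer_complete_closed => // e e0.
have [n ne] := L2_dominated mv mu0 LG (fun n => G_of _ (vM n) (vJ n)) (G_of _ uM uJ) vu e0.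
exists (v n); split=> //.
apply: (@fejer_complete_lipschitz _ (2 * M / h n)) => //.
- by rewrite divr_ge0 ?(ltW (h0 n))// mulr_ge0.
- exact: v_lip.
- by apply: v0; rewrite ltxx.
- by apply: v0; rewrite ltxx andbF.
Qed.

(** Truncate [u] in size and away from the ends of the period. *)
Theorem circle_parseval u : on_circle u -> fejer_complete u.
Proof.
move=> Du; have [Lu uJ] := Du; have [mu0 _] := Lu.
pose d n : R := (n.+1)%:R^-1.
pose A n := [set x | `|u x| <= n%:R] `&` `[d n, L - d n].
pose w n := u \_ (A n).
have mA n : measurable (A n : set (measurableTypeR R)).
  apply: measurableI; last exact: measurable_itv.
  rewrite (_ : [set x | _] = setT `&` u @^-1` `[- n%:R, n%:R]%classic).
    by apply: mu0 => //; exact: measurable_itv.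
  by rewrite setTI; apply/seteqP; split=> x /=; rewrite in_itv/= ler_norml.
have mw n : measurable_fun [set: measurableTypeR R] (w n).
  by apply: (measurable_restrictT u (mA n)).1; exact: measurable_funTS mu0.
have wu n x : `|w n x| <= `|u x|.
  by rewrite /w patchE; case: ifP => _; rewrite ?lexx// normr0.
have LG : L2 leb (fun x => `|u x|).
  apply: (L2_le _ Lu); first exact: measurableT_comp.
  by move=> x; rewrite real_normK ?num_real.
have Dw n : on_circle (w n).
  split.
    by apply: (L2_le (mw n) LG) => x; exact: sqr_le_of_norm.
  by move=> x nJ; rewrite /w patchE uJ//; case: ifP.
have inner x : 0 < x < L -> (fun n => w n x) @ \oo --> u x.
  move=> /andP[x0 xL]; apply: cvg_near_cst.
  pose N := maxn (Num.bound `|u x|) (maxn (Num.bound x^-1) (Num.bound (L - x)^-1)).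
  have small (r : R) n : 0 < r -> (Num.bound r^-1 <= n)%N -> d n <= r.
    move=> r0 rn; rewrite /d -[leRHS]invrK lef_pV2 ?posrE ?invr_gt0//.
    apply: le_trans (ltW (archi_boundP (ltW (_ : 0 < r^-1)))) _; first by rewrite invr_gt0.
    by rewrite ler_nat (leq_trans rn).
  exists N => // n /=; rewrite !geq_max => /and3P[n1 n2 n3].
  rewrite /w patchE mem_set//; split=> /=.
    by apply: le_trans (ltW (archi_boundP (normr_ge0 _))) _; rewrite ler_nat.
  rewrite in_itv/= (small x)//=.
  have Lx : 0 < L - x by rewrite subr_gt0.
  by have := small (L - x) n Lx n3; lra.
have wcvg : {ae leb, forall x, (fun n => w n x) @ \oo --> u x}.
  exists [set 0; L]; split; first exact: measurableU.
    apply/eqP; rewrite eq_le measure_ge0 andbT.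
    have : (leb ([set 0%R] `|` [set L]) <= leb [set 0%R] + leb [set L])%E by exact: measureU2.
    by rewrite !lebesgue_measure_set1 adde0.
  move=> x /=; have [xi|nxi] := boolP (0 < x < L); first by move=> nc; exfalso; apply/nc/inner.
  move=> nc; have [Jx|nJ] := pselect (J x); last first.
    exfalso; apply: nc; rewrite uJ//.
    have -> : (fun n => w n x) = (fun=> 0); last exact: cvg_cst.
    by apply/funext => n; have [_ ->] := Dw n.
  move: Jx nxi; rewrite /= in_itv/= => /andP[x0 xL]; rewrite negb_and -!leNgt => /orP[h|h].
    by left; apply/le_anti; rewrite h x0.
  by right; apply/le_anti; rewrite h xL.
apply: fejer_complete_closed => // e e0.
have [n ne] := L2_dominated mw mu0 LG wu (fun x => lexx _) wcvg e0.
exists (w n); split=> //.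
apply: (@fejer_complete_bounded _ n%:R (d n)) => //.
- by rewrite invr_gt0.
- move=> x; rewrite /w patchE; case: ifPn => [/set_mem[]//|_].
  by rewrite normr0.
- move=> x; rewrite /w patchE; case: ifPn => [/set_mem[_ /=]|_]; first by rewrite in_itv.
  by rewrite eqxx.
Qed.

End Density.

(** * Cesaro means over frequencies *)

Section FrequencySums.
Context {R : realType}.
Implicit Types (b e : int -> R) (B : R) (N m K : nat).

Definition fejer_sum N e : R := \sum_(i : 'I_N * 'I_N) e (freq i).

Definition frequency_sum m e : R := e 0 + \sum_(0 <= n < m) (e n.+1%:Z + e (- n.+1%:Z)).

Lemma fejer_sum_opp N e : fejer_sum N (fun n => e (- n)) = fejer_sum N e.
Proof.
rewrite /fejer_sum (reindex (fun i : 'I_N * 'I_N => (i.2, i.1))) /=.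
  by apply: eq_bigr => i _; rewrite /freq /= opprB.
by exists (fun i : 'I_N * 'I_N => (i.2, i.1)) => -[].
Qed.

(** A frequency of modulus [n < N] is a difference of two numbers below [N] in [N - n] ways, and
    it enters the partial sums from the [n]-th on. *)
Lemma fejer_sumE N e : fejer_sum N e = \sum_(0 <= m < N) frequency_sum m e.
Proof.
have E M : fejer_sum M e = \sum_(j < M) \sum_(l < M) e ((j : nat)%:Z - (l : nat)%:Z).
  by rewrite pair_big.
elim: N => [|N IH]; first by rewrite E big_ord0 big_geq.
rewrite big_nat_recr//= -IH !E big_ord_recr /=.
under eq_bigr => j _ do rewrite big_ord_recr /=.
rewrite big_split /= -addrA; congr (_ + _).
rewrite big_ord_recr /= subrr addrA addrC /frequency_sum; congr (_ + _).
rewrite big_split /= addrC; congr (_ + _).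
  rewrite big_mkord (reindex_inj rev_ord_inj) /=; apply: eq_bigr => i _.
  by congr e; rewrite subzn ?leq_subr// subKn.
rewrite big_mkord (reindex_inj rev_ord_inj) /=; apply: eq_bigr => i _.
by congr e; rewrite -opprB subzn ?leq_subr// subKn.
Qed.

Lemma frequency_sumB K m e : (K <= m)%N -> frequency_sum m e - frequency_sum K e =
  \sum_(K <= n < m) (e n.+1%:Z + e (- n.+1%:Z)).
Proof.
move=> Km; rewrite /frequency_sum (@big_cat_nat _ _ _ K 0 m)//=.
by rewrite opprD addrACA subrr add0r addrAC subrr add0r.
Qed.

Lemma frequency_sum_mono K m e : (forall n, 0 <= e n) -> (K <= m)%N ->
  frequency_sum K e <= frequency_sum m e.
Proof.
by move=> e0 Km; rewrite -subr_ge0 frequency_sumB// sumr_ge0// => n _; rewrite addr_ge0.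
Qed.

Lemma frequency_sum_ge0 m e : (forall n, 0 <= e n) -> 0 <= frequency_sum m e.
Proof. by move=> e0; rewrite addr_ge0// sumr_ge0// => n _; rewrite addr_ge0. Qed.

(** The mean of the first [2 m] terms of an increasing sequence is at least half of its [m]-th
    term. *)
Lemma frequency_sum_bounded b B m : (forall n, 0 <= b n) ->
  (forall N, fejer_sum N b <= N%:R * B) -> frequency_sum m b <= 2 * B.
Proof.
move=> b0 bB; apply: le_trans (frequency_sum_mono b0 (leqnSn m)) _.
have := bB (m.+1 + m.+1)%N; rewrite fejer_sumE (@big_cat_nat _ _ _ m.+1) ?leq_addr//=.
have h1 : 0 <= \sum_(0 <= i < m.+1) frequency_sum i b.
  by apply: sumr_ge0 => i _; exact: frequency_sum_ge0.
have h2 : m.+1%:R * frequency_sum m.+1 b <= \sum_(m.+1 <= i < m.+1 + m.+1) frequency_sum i b.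
  rewrite mulr_natl -[X in _ *+ X](addnK m.+1) -sumr_const_nat.
  by apply: ler_sum_nat => i /andP[h _]; exact: frequency_sum_mono.
move=> h3; have m0 : 0 < m.+1%:R :> R by rewrite ltr0n.
rewrite -(ler_pM2l m0); apply: le_trans h2 _; apply: le_trans (_ : _ <= (m.+1 + m.+1)%:R * B) _.
  by apply: le_trans h3; rewrite lerDr.
by rewrite natrD le_eqVlt; apply/orP; left; apply/eqP; ring.
Qed.

(** The bound makes [b] summable over the frequencies, and a small tail of [b] dominates the
    same tail of every [e] below [b]. *)
Lemma frequency_tail b B (eps : R) : (forall n, 0 <= b n) ->
  (forall N, fejer_sum N b <= N%:R * B) -> 0 < eps ->
  exists K, forall e, (forall n, 0 <= e n <= b n) -> forall N,
    fejer_sum N e <= N%:R * (frequency_sum K e + eps).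
Proof.
move=> b0 bB eps0; pose S := range (fun m => frequency_sum m b).
have hS : has_sup S.
  split; first by exists (frequency_sum 0 b), 0%N.
  by exists (2 * B) => _ [m _ <-]; exact: frequency_sum_bounded.
have [_ [K _ <-] KS] := sup_adherent eps0 hS.
exists K => e eb N.
have e0 n : 0 <= e n by have /andP[] := eb n.
have tail m : frequency_sum m e <= frequency_sum K e + eps.
  have [Km|/ltnW mK] := leqP K m; last first.
    by apply: le_trans (frequency_sum_mono e0 mK) _; rewrite lerDl ltW.
  rewrite -lerBlDl frequency_sumB//.
  apply: le_trans (_ : _ <= \sum_(K <= n < m) (b n.+1%:Z + b (- n.+1%:Z))) _.
    apply: ler_sum => n _; apply: lerD; first by have /andP[] := eb n.+1%:Z.
    by have /andP[] := eb (- n.+1%:Z).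
  rewrite -frequency_sumB// lerBlDl; apply: le_trans (_ : _ <= sup S) _.
    by apply: sup_upper_bound => //; exists m.
  by rewrite -lerBlDr ltW.
rewrite fejer_sumE mulr_natl -[X in _ *+ X](subn0 N) -sumr_const_nat.
by apply: ler_sum_nat => i _.
Qed.

End FrequencySums.

(** * Stability of a single mode *)

Opaque ip.

Lemma le_half_of_quarters {R : realType} (x1 x2 y z : R) :
  x1 <= y -> x2 <= 1 / 4 * z -> y <= 1 / 4 * z -> x1 + x2 <= z / 2.
Proof. lra. Qed.

Section ModeStability.
Context {R : realType} (k : R) (k0 : 0 < `|k|).
Notation leb := (@lebesgue_measure R).
Notation P := (expP k0).
Notation cfun := ((R -> R^o) * (R -> R^o))%type.
Implicit Types (u v w eta : cfun) (s t T : R).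

Lemma L2c_lin (a : R) u v : L2c u -> L2c v -> L2c (a *: u + v).
Proof. by move=> [u1 u2] [v1 v2]; split; apply: L2D => //; exact: L2Z. Qed.

Lemma ip2_psd : psd_form (@L2c R) (@ip2 R).
Proof.
split.
- by move=> u v _ _; rewrite /ip2 ipC [X in _ + X]ipC.
- move=> a u v w [u1 u2] [v1 v2] [w1 w2].
  have e (f g h : R -> R) : L2 leb f -> L2 leb g -> L2 leb h ->
      ip leb (fun y => a * f y + g y) h = a * ip leb f h + ip leb g h.
    by move=> Lf Lg Lh; rewrite ipDl ?ipZl//; exact: L2Z.
  rewrite /ip2 /= (e u.1 v.1 w.1 u1 v1 w1) (e u.2 v.2 w.2 u2 v2 w2); ring.
- by move=> u _; apply: addr_ge0; exact: ip_ge0.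
Qed.

Lemma smoothing_linl (a : R) s u v w : L2c u -> L2c v -> L2c w ->
  smoothing P k s (a *: u + v) w = a * smoothing P k s u w + smoothing P k s v w.
Proof.
move=> Lu Lv Lw.
rewrite (smoothingE P k s (L2c_lin a Lu Lv) Lw) (smoothingE P k s Lu Lw) (smoothingE P k s Lv Lw).
have iu := rcor_integrable P k s Lu Lw; have iv := rcor_integrable P k s Lv Lw.
rewrite -(RintegralZl _ measurableT iu) -(RintegralD measurableT (integrableZl measurableT a iu) iv).
apply: eq_Rintegral => z _; rewrite /rcor /cor /cori.
have [u1 u2] := Lu; have [v1 v2] := Lv; have [w1 w2] := Lw.
have e (f g h : R -> R) : L2 leb f -> L2 leb g -> L2 leb h ->
    ip leb (fun y => a * f y + g y) h = a * ip leb f h + ip leb g h.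
  by move=> Lf Lg Lh; rewrite ipDl ?ipZl//; exact: L2Z.
rewrite /= !e//; try exact: L2_tau.
ring.
Qed.

Lemma smoothing_psd s : psd_form (@L2c R) (smoothing P k s).
Proof.
split.
- by move=> u v _ _; exact: smoothingC.
- by move=> a u v w; exact: smoothing_linl.
- by move=> u _; exact: smoothing_ge0.
Qed.

Lemma cint_translate f a b c : continuous f ->
  cint a b (fun s => f (s - c)) = cint (a - c) (b - c) f.
Proof.
move=> cf; rewrite /cint [LHS]Rintegral_mkcond [RHS]Rintegral_mkcond.
rewrite -[RHS](@Rintegral_shift _ c); last first.
  apply/(measurable_restrictT _ _).1 => //; apply: measurable_funTS.
  exact: continuous_measurableR.
by apply: eq_Rintegral => s _; rewrite !patchE !mem_setE !in_itv/= !lerD2r.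
Qed.

(** The size of the forcing relative to the smoothed vorticity that the Lyapunov functional
    tolerates: [8 * pi] comes from [time_smoothing_le], and the product of the two is [1 / 4]. *)
Definition coupling : R := (32 * pi)^-1.

Lemma coupling_gt0 : 0 < coupling.
Proof. by rewrite invr_gt0 mulr_gt0// pi_gt0. Qed.

Lemma coupling8 : 8 * pi * coupling = 1 / 4 :> R.
Proof.
have p : pi != 0 :> R by rewrite gt_eqF ?pi_gt0.
by rewrite /coupling invfM mulrACA divff// mulr1; lra.
Qed.

Let h_le s u : L2c u -> smoothing P k s u u <= ip2 u u.
Proof. exact: smoothing_le. Qed.

Let h_cont u v : L2c u -> L2c v -> continuous (fun s => smoothing P k s u v).
Proof. exact: continuous_smoothing. Qed.

Let h_int u T : L2c u -> 0 <= T ->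
  cint 0 T (fun s => smoothing P k s u u) <= (8 * pi) * ip2 u u.
Proof. by move=> Lu T0; exact: time_smoothing_le. Qed.

Variables (W F : R -> cfun).
Hypothesis LW : forall t, 0 <= t -> L2c (W t).
Hypothesis LF : forall t, 0 <= t -> L2c (F t).
Hypothesis F_eta : forall t, 0 <= t -> exists eta, [/\ L2c eta,
  rot k t (F t) = smear2 P (-1) eta &
  ip2 eta eta <= coupling ^+ 2 *
    ip2 (smear2 P 1 (rot k t (W t))) (smear2 P 1 (rot k t (W t)))].
Hypothesis W_deriv : forall t (e : R), 0 <= t -> 0 < e -> exists2 d : R, 0 < d &
  forall s, 0 <= s -> `|s - t| < d ->
    ip2 (W s - W t - (s - t) *: F t) (W s - W t - (s - t) *: F t) <= e * (s - t) ^+ 2.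

Let F_dual t v (l : R) : 0 <= t -> L2c v -> 0 < l ->
  2 * ip2 (F t) v <= l * coupling ^+ 2 * smoothing P k t (W t) (W t)
    + l^-1 * smoothing P k t v v.
Proof.
move=> t0 Lv l0; have [eta [Leta Feta eta_le]] := F_eta t0.
rewrite -(ip2_rot k t (LF t0) Lv) Feta.
have [eta1 eta2] := Leta; have [v1 v2] := L2c_rot k t Lv.
have -> : ip2 (smear2 P (-1) eta) (rot k t v) = ip2 eta (smear2 P 1 (rot k t v)).
  by rewrite /ip2 /= (ip_smear_adj P _ eta1 v1) (ip_smear_adj P _ eta2 v2) opprK.
apply: le_trans (form_young L2c_lin ip2_psd l0 Leta (L2c_smear P 1 (L2c_rot k t Lv))) _.
rewrite -!smoothing_def in eta_le *; rewrite -mulrA; apply: lerD; last exact: lexx.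
by rewrite ler_pM2l.
Qed.

(** By [smoothing_smear], the form of [F t] and [W t] at time [s] is the form of [eta] and of
    the smoothed vorticity at the elapsed time [s - t]; [time_smoothing_le] bounds the time
    integrals of both. *)
Let F_small t T : 0 <= t -> t <= T ->
  2 * cint t T (fun s => smoothing P k s (F t) (W t)) <= smoothing P k t (W t) (W t) / 2.
Proof.
move=> t0 tT; have [eta [Leta Feta eta_le]] := F_eta t0.
set b := rot k t (W t) in eta_le; have Lb : L2c b := L2c_rot k t (LW t0).
set Kb := smear2 P 1 b in eta_le; have LKb : L2c Kb := L2c_smear P 1 Lb.
have E s : smoothing P k s (F t) (W t) = smoothing P k (s - t) eta Kb.
  rewrite -{1}(subrK t s) (smoothing_rot P k (s - t) t (F t) (W t)).
    by rewrite -[RHS](smoothing_smear P k (s - t) Leta Lb) -Feta.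
have cs u v : L2c u -> L2c v -> continuous (fun s => smoothing P k s u v).
  exact: continuous_smoothing.
rewrite (eq_cint _ _ E) (cint_translate t T t (cs _ _ Leta LKb)) subrr.
have Tt : 0 <= T - t by rewrite subr_ge0.
have c0 := coupling_gt0.
have ci0 : 0 < coupling^-1 by rewrite invr_gt0.
have Q : ip2 Kb Kb = smoothing P k t (W t) (W t) by rewrite smoothing_def.
have Y s : 2 * smoothing P k s eta Kb <=
    coupling^-1 * smoothing P k s eta eta + coupling * smoothing P k s Kb Kb.
  by have := form_young L2c_lin (smoothing_psd s) ci0 Leta LKb; rewrite invrK.
have c1 := cs _ _ Leta Leta; have c2 := cs _ _ LKb LKb.
have cZ (c : R) f : continuous f -> continuous (fun s => c * f s : R).
  by move=> cf s; apply: cvgM; [exact: cvg_cst|exact: cf].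
have cS : continuous (fun s => coupling^-1 * smoothing P k s eta eta
     + coupling * smoothing P k s Kb Kb).
  by move=> s; apply: cvgD; [exact: (cZ _ _ c1 s)|exact: (cZ _ _ c2 s)].
rewrite -cintZ; last exact: cs.
apply: le_trans (cint_le _ cS (fun s _ => Y s)) _; first exact: cZ (cs _ _ Leta LKb).
rewrite (cintD _ _ (cZ _ _ c1) (cZ _ _ c2)) (cintZ _ _ _ c1) (cintZ _ _ _ c2).
have I1 := time_smoothing_le k0 Tt Leta; have I2 := time_smoothing_le k0 Tt LKb.
rewrite -/(cint _ _ _) in I1; rewrite -/(cint _ _ _) in I2.
have J1 := ler_wpM2l (ltW ci0) I1; have J2 := ler_wpM2l (ltW c0) I2.
have pi0 := @pi_gt0 R.
have J3 : coupling^-1 * (8 * pi * ip2 eta eta) <= 8 * pi * coupling * ip2 Kb Kb.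
  rewrite mulrC ler_pdivrMr// -!mulrA ler_pM2l// ler_pM2l//.
  by apply: le_trans eta_le _; rewrite expr2 -mulrA mulrC mulrA.
have J4 := coupling8.
have E2 : coupling * (8 * pi * ip2 Kb Kb) = 8 * pi * coupling * ip2 Kb Kb.
  by rewrite mulrA [coupling * _]mulrC.
rewrite J4 in J3; rewrite E2 J4 in J2; rewrite -Q.
exact: le_half_of_quarters J1 J2 J3.
Qed.

Lemma mode_bound t t' : 0 <= t -> t <= t' ->
  ip2 (W t' - W t) (W t' - W t) <= ip2 (W 0) (W 0).
Proof.
move=> t0 tt'; have pi0 := @pi_gt0 R.
have Lam0 : 0 < 8 * pi :> R by rewrite mulr_gt0.
have := increment_bound L2c_lin ip2_psd smoothing_psd h_le h_cont h_int
  LW LF W_deriv F_dual F_small t0 tt' Lam0.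
move/le_trans; apply; rewrite ler_piMl ?(form_ge0 ip2_psd)//; first exact: LW.
by rewrite coupling8 expr2; lra.
Qed.

Lemma mode_cauchy (e : R) : 0 < e -> exists2 T : R, 0 <= T &
  forall t t', T <= t -> T <= t' -> ip2 (W t' - W t) (W t' - W t) <= e.
Proof.
move=> e0; have pi0 := @pi_gt0 R.
have Lam0 : 0 < 8 * pi :> R by rewrite mulr_gt0.
exact: (W_cauchy L2c_lin ip2_psd smoothing_psd h_le h_cont h_int
  LW LF W_deriv F_dual F_small Lam0 e0).
Qed.

End ModeStability.

Transparent ip.

(** * Complex-valued square-integrable functions *)

Section ComplexL2.
Context d (T : measurableType d) (R : realType) (m : {measure set T -> \bar R}).
Variables (D : set T) (mD : measurable D).
Implicit Types (u v : T -> R[i]).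

Definition re_on u : T -> R := (fun x => complex.Re (u x)) \_ D.
Definition im_on u : T -> R := (fun x => complex.Im (u x)) \_ D.
Definition sqr_norm u : R := ip m (re_on u) (re_on u) + ip m (im_on u) (im_on u).

Lemma measurable_re_on u : complex_measurable D u -> measurable_fun setT (re_on u).
Proof. by move=> [mr _]; exact/(measurable_restrictT _ _).1. Qed.

Lemma measurable_im_on u : complex_measurable D u -> measurable_fun setT (im_on u).
Proof. by move=> [_ mi]; exact/(measurable_restrictT _ _).1. Qed.

Let L2norm_poweR u : L2norm m D u =
  ((\int[m]_x ((re_on u x) ^+ 2 + (im_on u x) ^+ 2)%:E) `^ 2^-1)%E.
Proof.
rewrite /L2norm unlock; congr (_ `^ _)%E; apply: eq_integral => x _.
rewrite /re_on /im_on !patchE; case: ifP => _; last first.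
  by rewrite /= normr0 powR_mulrn// expr2 mul0r addr0.
rewrite /=; case: (u x) => a b /=.
rewrite ger0_norm ?sqrtr_ge0// powR_mulrn ?sqrtr_ge0// sqr_sqrtr//.
by rewrite addr_ge0 ?sqr_ge0.
Qed.

Lemma in_L2P u : in_L2 m D u <->
  complex_measurable D u /\ L2 m (re_on u) /\ L2 m (im_on u).
Proof.
split=> [[mu Lu]|[mu [Lr Li]]]; split=> //; last first.
  rewrite L2norm_poweR; apply: poweR_lty.
  have /integrableP[_] := integrableD measurableT (L2_sqr_integrable Lr) (L2_sqr_integrable Li).
  apply: le_lt_trans; rewrite le_eqVlt; apply/orP; left; apply/eqP.
  by apply: eq_integral => x _ /=; rewrite ger0_norm// addr_ge0 ?sqr_ge0.
have mr := measurable_re_on mu; have mi := measurable_im_on mu.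
move: Lu; rewrite L2norm_poweR => Lu.
have fin : (\int[m]_x ((re_on u x) ^+ 2 + (im_on u x) ^+ 2)%:E < +oo)%E.
  have i0 : (2^-1 != 0 :> R) by rewrite invr_neq0.
  exact: lty_poweRy i0 Lu.
have key (f : T -> R) : measurable_fun setT f ->
    (forall x, f x ^+ 2 <= (re_on u x) ^+ 2 + (im_on u x) ^+ 2) -> L2 m f.
  move=> mf fle; split=> //; apply/integrableP; split.
    by apply/measurable_EFinP; exact: measurable_funX.
  apply: le_lt_trans fin; apply: ge0_le_integral => //.
  - by apply: measurableT_comp => //; apply/measurable_EFinP; exact: measurable_funX.
  - by apply/measurable_EFinP; apply: measurable_funD; exact: measurable_funX.
  - by move=> x _ /=; rewrite lee_fin ger0_norm ?sqr_ge0.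
by split; apply: key => // x; rewrite ?lerDl ?lerDr sqr_ge0.
Qed.

Lemma L2normE u : in_L2 m D u -> L2norm m D u = (Num.sqrt (sqr_norm u))%:E.
Proof.
move=> /in_L2P[_ [Lr Li]]; rewrite L2norm_poweR.
have ir := L2_sqr_integrable Lr; have ii := L2_sqr_integrable Li.
have E : (\int[m]_x ((re_on u x) ^+ 2 + (im_on u x) ^+ 2)%:E = (sqr_norm u)%:E)%E.
  have irr := L2_ip_integrable Lr Lr; have iii := L2_ip_integrable Li Li.
  rewrite /sqr_norm /ip -(RintegralD measurableT irr iii) /Rintegral fineK; last first.
    exact: (integrable_fin_num _ (integrableD measurableT irr iii)).
  by apply: eq_integral => x _; rewrite !expr2.
by rewrite E poweR_EFin powR12_sqrt// addr_ge0// ip_ge0.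
Qed.

Lemma sqr_norm_ge0 u : 0 <= sqr_norm u.
Proof. by rewrite addr_ge0// ip_ge0. Qed.

Lemma re_onB u v : re_on (fun x => u x - v x) = (fun x => re_on u x - re_on v x).
Proof.
apply/funext => x; rewrite /re_on !patchE; case: ifP => _; last by rewrite subrr.
by case: (u x) => a b; case: (v x).
Qed.

Lemma im_onB u v : im_on (fun x => u x - v x) = (fun x => im_on u x - im_on v x).
Proof.
apply/funext => x; rewrite /im_on !patchE; case: ifP => _; last by rewrite subrr.
by case: (u x) => a b; case: (v x).
Qed.

Lemma in_L2B u v : in_L2 m D u -> in_L2 m D v -> in_L2 m D (fun x => u x - v x).
Proof.
move=> /in_L2P[[mu1 mu2] [u1 u2]] /in_L2P[[mv1 mv2] [v1 v2]]; apply/in_L2P; split.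
  split.
    rewrite (_ : (fun x => _) = (fun x => complex.Re (u x) - complex.Re (v x))).
      exact: measurable_funB.
    by apply/funext => x; case: (u x) => a b; case: (v x).
  rewrite (_ : (fun x => _) = (fun x => complex.Im (u x) - complex.Im (v x))).
    exact: measurable_funB.
  by apply/funext => x; case: (u x) => a b; case: (v x).
by rewrite re_onB im_onB; split; exact: L2B.
Qed.

Lemma re_on_realZ (c : R) u : re_on (fun x => c%:C%C * u x) = (fun x => c * re_on u x).
Proof.
apply/funext => x; rewrite /re_on !patchE; case: ifP => _; last by rewrite mulr0.
by case: (u x) => a b /=; rewrite mul0r subr0.
Qed.

Lemma im_on_realZ (c : R) u : im_on (fun x => c%:C%C * u x) = (fun x => c * im_on u x).
Proof.
apply/funext => x; rewrite /im_on !patchE; case: ifP => _; last by rewrite mulr0.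
by case: (u x) => a b /=; rewrite mul0r addr0.
Qed.

Lemma in_L2_realZ (c : R) u : in_L2 m D u -> in_L2 m D (fun x => c%:C%C * u x).
Proof.
move=> /in_L2P[[mu1 mu2] [u1 u2]]; apply/in_L2P; split.
  split.
    rewrite (_ : (fun x => _) = (fun x => c * complex.Re (u x))).
      exact: measurable_funM.
    by apply/funext => x; case: (u x) => a b /=; rewrite mul0r subr0.
  rewrite (_ : (fun x => _) = (fun x => c * complex.Im (u x))).
    exact: measurable_funM.
  by apply/funext => x; case: (u x) => a b /=; rewrite mul0r addr0.
by rewrite re_on_realZ im_on_realZ; split; exact: L2Z.
Qed.

End ComplexL2.

(** * The cross section and Sobolev functions on it *)

Section ChannelGeometry.
Context {R : realType}.
Notation leb := (@lebesgue_measure R).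
Variable ch : channel.
Notation D := (@cross_section R ch).
Implicit Types (u v b db : R -> R) (x y : R).

Lemma measurable_cross_section : measurable (D : set (measurableTypeR R)).
Proof. by case: ch => /=; [exact: measurableT|exact: measurable_itv]. Qed.

Lemma cross_section_interior : D° = match ch with
  | InfiniteChannel => setT | FiniteChannel => `]0, 1[%classic end.
Proof.
case: ch => /=; last by rewrite interior_itv_bnd.
by apply/interior_id; exact: openT.
Qed.

Lemma measurable_interior : measurable (D° : set (measurableTypeR R)).
Proof. by rewrite cross_section_interior; case: ch. Qed.

Lemma interior_convex x y z : D° x -> D° y -> x <= z <= y -> D° z.
Proof.
rewrite cross_section_interior; case: ch => //= + + /andP[xz zy].
rewrite !in_itv/= => /andP[x0 _] /andP[_ y1].
by rewrite (lt_le_trans x0 xz) (le_lt_trans zy y1).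
Qed.

Lemma unit_interval_interior x : 0 < x < 1 -> D° x.
Proof. by rewrite cross_section_interior; case: ch => //= h; rewrite in_itv. Qed.

Lemma interior_subD x : D° x -> D x.
Proof. exact: interior_subset. Qed.

Lemma ae_interior : {ae leb, forall x, D x -> D° x}.
Proof.
rewrite cross_section_interior; case: ch => /=; first exact: aeW.
exists [set 0; 1]; split.
- by apply: measurableU.
- apply/eqP; rewrite eq_le measure_ge0 andbT.
  have : (leb ([set 0%R] `|` [set 1%R]) <= leb [set 0%R] + leb [set 1%R])%E.
    exact: measureU2.
  by rewrite !lebesgue_measure_set1 adde0.
move=> x /= /not_implyP[]; rewrite !in_itv/= => /andP[x0 x1] /negP.
rewrite negb_and -!leNgt => /orP[h|h]; [left|right]; apply/eqP; rewrite eq_le ?h//.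
  by rewrite ?x0 ?x1.
Qed.

Lemma AC_boundary b v x x' : ch = FiniteChannel -> AC b (v \_ D°) -> x <= x' ->
  x' <= 0 \/ 1 <= x -> b x' = b x.
Proof.
move=> E [_ bE] xx' h; apply/eqP; rewrite -subr_eq0 bE// cross_section_interior E.
rewrite /cint (@eq_Rintegral _ _ _ leb _ (fun=> 0)) ?/Rintegral ?integral0//.
move=> w; rewrite inE/= in_itv/= => /andP[w1 w2].
rewrite patchE ifF// mem_setE in_itv/=; apply/negP => /andP[w3 w4].
by case: h; lra.
Qed.

(** Values outside the channel are copied from the nearest boundary point. *)
Lemma AC_nearest b v y : AC b (v \_ D°) -> exists2 z, b y = b z &
  forall d : R, 0 < d -> exists x x' : R, x < x' /\
    forall w, x < w < x' -> D° w /\ `|w - z| < d.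
Proof.
move=> Ab; have out := fun E x x' => @AC_boundary b v x x' E Ab.
rewrite cross_section_interior; case: ch out => /= out.
  exists y => // d d0; exists (y - d), (y + d); split; first lra.
  by move=> w /andP[w1 w2]; split=> //; rewrite ltr_norml; apply/andP; split; lra.
exists (Num.max 0 (Num.min 1 y)) => [|d d0].
  have [y1|y1] := leP 1 y; first by rewrite max_r//; apply: out => //; right.
  have [y0|y0] := leP 0 y => //.
  by apply/esym/out => //; [exact: ltW|left].
set z := Num.max _ _.
have z01 : 0 <= z <= 1 by rewrite /z le_max lexx/= ge_max ler01/= ge_min lexx.
exists (Num.max 0 (z - d)), (Num.min 1 (z + d)); move: z01 => /andP[z0 z1]; split.
  rewrite gt_max !lt_min; apply/andP; split; apply/andP; split; lra.
move=> w; rewrite gt_max lt_min => /andP[/andP[w0 wz] /andP[w1 wz']].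
by rewrite in_itv/= w0 w1 ltr_norml; split=> //; apply/andP; split; lra.
Qed.

Lemma AC_ge b v (m : R) : AC b (v \_ D°) -> {ae leb, forall y, D° y -> m <= b y} ->
  forall y, m <= b y.
Proof.
move=> Ab aem y; have cb := AC_continuous Ab.
have [z -> near] := AC_nearest y Ab.
rewrite leNgt; apply/negP => bz.
have e0 : 0 < m - b z by rewrite subr_gt0.
have [d d0 dP] : exists2 d : R, 0 < d & forall w, `|w - z| < d -> `|b w - b z| <= (m - b z) / 2.
  by apply: near_lt; [exact: cb|rewrite divr_gt0].
have [x [x' [xx' P]]] := near d d0.
have [w /P[Dw wz] /(_ Dw) mw] := ae_exists_itv xx' aem.
by have := dP w wz; rewrite ler_norml => /andP[_]; lra.
Qed.

Lemma AC_le b v (m : R) : AC b (v \_ D°) -> {ae leb, forall y, D° y -> b y <= m} ->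
  forall y, b y <= m.
Proof.
move=> Ab aem y; rewrite -lerN2.
have AN : AC (fun x => -1 * b x) ((fun x => -1 * v x) \_ D°).
  have -> : (fun x => -1 * v x) \_ D° = (fun x => -1 * (v \_ D°) x).
    by apply/funext => x; rewrite !patchE; case: ifP => _; rewrite ?mulr0.
  exact: ACZ.
have := @AC_ge _ _ (- m) AN _ y; rewrite mulN1r; apply.
by apply: ae_mono aem => x h /h; rewrite mulN1r lerN2.
Qed.

Lemma ae_restrict_interior u : {ae leb, forall x, (u \_ D) x = (u \_ D°) x}.
Proof.
apply: ae_mono (@ae_interior) => x H; rewrite !patchE.
case: ifPn => [/set_mem/H Di|/negP nD]; first by rewrite mem_set.
by rewrite ifN//; apply/negP => /set_mem/interior_subD Dx; apply: nD; rewrite mem_set.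
Qed.

Lemma locally_integrable_measurable u : locally_integrable D° u ->
  measurable_fun [set: measurableTypeR R] (u \_ D°).
Proof. by case=> mu _ _; exact: ((measurable_restrictT u measurable_interior).1 mu). Qed.

Lemma weak_derivative_primitive u u' : weak_derivative D° u u' ->
  loc_int (u \_ D°) -> loc_int (u' \_ D°) ->
  exists U, AC U (u' \_ D°) /\ {ae leb, forall y, D° y -> U y = u y}.
Proof.
move=> wd lu lu'; apply: weak_derivative_AC ltr01 unit_interval_interior => //.
by move=> x y z; exact: interior_convex.
Qed.

Lemma loc_int_bounded u (M : R) : measurable_fun [set: measurableTypeR R] u ->
  {ae leb, forall x, `|u x| <= M} -> loc_int u.
Proof.
move=> mu uM; pose v x := Num.max (- M) (Num.min M (u x)).
have mv : measurable_fun [set: measurableTypeR R] v.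
  by apply: measurable_maxr => //; exact: measurable_minr.
have lv : loc_int v.
  apply: (@loc_int_ae _ (fun x => 1 * v x)) => //; last by apply: aeW => x; rewrite mul1r.
  apply: (@loc_int_mul _ _ _ `|M|) => //; first exact: loc_int_cst.
  move=> x; rewrite /v ler_norml le_max ge_max lerN2 ler_norm /= ge_min ler_norm /= andbT.
  by rewrite -(normrN M) ler_norm.
apply: (loc_int_ae lv) => //.
by apply: ae_mono uM => x; rewrite ler_norml => /andP[h1 h2]; rewrite /v min_r// max_r.
Qed.

Lemma Linfty_le u (s : R) : ('N[leb]_(+oo)[(fun x => (u x)%:E) \_ D] <= s%:E)%E ->
  {ae leb, forall x, `|(u \_ D) x| <= s}.
Proof.
rewrite unlock.
have -> : (0 < leb [set: measurableTypeR R])%E.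
  apply: (@lt_le_trans _ _ (leb `]0%R, 1%R[)).
    by rewrite lebesgue_measure_itv/= lte_fin ltr01 -EFinB subr0 lte_fin.
  by apply: le_measure; rewrite ?inE.
move/ess_sup_inf.ess_supP; apply: ae_mono => x /=; rewrite !patchE; case: ifP => _ //=.
Qed.

(** The primitive of the weak derivative inherits the almost everywhere bound on [u] by
    continuity. *)
Lemma sobolev_AC (n : nat) u (s : R) : (sobolev_oo_norm n.+1 D u < s%:E)%E ->
  exists b v, [/\ AC b (v \_ D°), {ae leb, forall y, D° y -> b y = u y},
    forall y, `|b y| <= s & {ae leb, forall y, `|(v \_ D°) y| <= s}].
Proof.
move=> /ereal_inf_lt[_ [h [h0 wd ->]] hs].
have hN j : (j < n.+2)%N -> {ae leb, forall y, `|((h j) \_ D°) y| <= s}.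
  move=> jn; have : ('N[leb]_(+oo)[(fun x => (h j x)%:E) \_ D] <= s%:E)%E.
    apply: le_trans (ltW hs); rewrite (bigD1 (Ordinal jn))//= leeDl//.
    by apply: sume_ge0 => i _; exact: Lnorm_ge0.
  move/Linfty_le => H; apply: ae_mono2 H (ae_restrict_interior (h j)).
  by move=> x + <-.
have wd0 := wd 0%N isT.
have [lu lu' _] := wd0.
have N0 := hN 0%N isT; have N1 := hN 1%N isT.
have [b [Ab bE]] := weak_derivative_primitive wd0
  (loc_int_bounded (locally_integrable_measurable lu) N0)
  (loc_int_bounded (locally_integrable_measurable lu') N1).
have bs : {ae leb, forall y, D° y -> `|b y| <= s}.
  by apply: ae_mono2 N0 bE => y + E Dy; rewrite patchE mem_set// E.
exists b, (h 1%N); split=> //; first by rewrite -h0.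
move=> y; rewrite ler_norml; apply/andP; split.
  by apply: (AC_ge Ab); apply: ae_mono bs => z H /H; rewrite ler_norml => /andP[].
by apply: (AC_le Ab); apply: ae_mono bs => z H /H; rewrite ler_norml => /andP[].
Qed.

End ChannelGeometry.

(** * Slices of functions on the channel *)

Section Slices.
Context {R : realType}.
Notation leb := (@lebesgue_measure R).
Notation plane := (@plane_measure R).
Variables (ch : channel) (L : R).
Hypothesis L0 : 0 < L.
Notation J := (`[0, L]%classic : set R).
Notation D := (@cross_section R ch).
Notation DD := (@channel_domain R ch L).
Implicit Types (w : R * R -> R[i]) (n : int) (x y : R) (N : nat).

Lemma measurable_channel_domain :
  measurable (DD : set (measurableTypeR R * measurableTypeR R)%type).
Proof. by apply: measurableX; [exact: measurable_itv|exact: measurable_cross_section]. Qed.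

Definition re_slice w y : R -> R := fun x => re_on DD w (x, y).
Definition im_slice w y : R -> R := fun x => im_on DD w (x, y).

Lemma slice_sqr_integrable (p : R * R -> R) : L2 plane p ->
  {ae leb, forall y, L2 leb (fun x => p (x, y))}.
Proof.
move=> [mp ip].
apply: ae_mono (ae_integrable2 ip) => y iy; split=> //.
exact: measurableT_comp mp (measurable_pair2 y).
Qed.

Lemma slice_ip_integrable (p : R * R -> R) : L2 plane p ->
  leb.-integrable setT (EFin \o (fun y => ip leb (fun x => p (x, y)) (fun x => p (x, y)))) /\
  \int[leb]_y ip leb (fun x => p (x, y)) (fun x => p (x, y)) = ip plane p p.
Proof.
move=> Lp; have i := L2_ip_integrable Lp Lp; split; last exact: Rintegral_prod21 i.
have mF : measurable_fun setT (EFin \o (fun z => p z * p z)) := measurable_int _ i.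
have mI : measurable_fun [set: measurableTypeR R]
    (EFin \o (fun y => ip leb (fun x => p (x, y)) (fun x => p (x, y)))).
  apply/measurable_EFinP; apply: (measurable_Rintegral_fst leb (f := fun z => p z * p z)).
  exact/measurable_EFinP.
apply/integrableP; split=> //; apply: le_lt_trans ((integrable21ltyP leb leb mF).1 i).
apply: ge0_le_integral => //.
- exact: measurableT_comp.
- have mA : measurable_fun setT (abse \o (EFin \o (fun z => p z * p z))) by exact: measurableT_comp.
  exact: (measurable_fun_fubini_tonelli_G (m1 := leb) _ mA (fun z => abse_ge0 _)).
move=> y _ /=; rewrite /ip /Rintegral.
have -> : (\int[leb]_x `|(p (x, y) * p (x, y))%:E| = \int[leb]_x (p (x, y) * p (x, y))%:E)%E.
  by apply: eq_integral => x _; rewrite /= ger0_norm// -expr2 sqr_ge0.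
have : (0 <= \int[leb]_x (p (x, y) * p (x, y))%:E)%E.
  by apply: integral_ge0 => x _; rewrite lee_fin -expr2 sqr_ge0.
by case: (integral _ _ _) => [r| |] //=; rewrite ?normr0 ?leey// !lee_fin => r0; rewrite ger0_norm.
Qed.

Lemma ae_le_Rintegral (f g : R -> R) : leb.-integrable setT (EFin \o f) ->
  leb.-integrable setT (EFin \o g) -> (forall x, 0 <= f x) -> (forall x, 0 <= g x) ->
  {ae leb, forall x, f x <= g x} -> \int[leb]_x f x <= \int[leb]_x g x.
Proof.
move=> fi gi f0 g0 fg; apply: fine_le.
- exact: integrable_fin_num fi.
- exact: integrable_fin_num gi.
- apply: ae_ge0_le_integral => //.
  + by move=> x _; rewrite lee_fin.
  + exact: measurable_int fi.
  + by move=> x _; rewrite lee_fin.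
  + exact: measurable_int gi.
  + by apply: ae_mono fg => x h _; rewrite lee_fin.
Qed.

Section Function.
Variable w : R * R -> R[i].
Hypothesis Lw : in_L2 plane DD w.

Let mDD := measurable_channel_domain.
Let mD := @measurable_cross_section R ch.

Lemma re_sliceE y x : re_slice w y x = if (x \in J) && (y \in D) then complex.Re (w (x, y)) else 0.
Proof. by rewrite /re_slice /re_on patchE /channel_domain in_setX. Qed.

Lemma im_sliceE y x : im_slice w y x = if (x \in J) && (y \in D) then complex.Im (w (x, y)) else 0.
Proof. by rewrite /im_slice /im_on patchE /channel_domain in_setX. Qed.

Lemma on_circle_slices : {ae leb, forall y, on_circle L (re_slice w y) /\ on_circle L (im_slice w y)}.
Proof.
have [_ [Lr Li]] := (in_L2P plane mDD w).1 Lw.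
apply: ae_mono2 (slice_sqr_integrable Lr) (slice_sqr_integrable Li) => y hr hi.
by split; split=> // x nJ; rewrite ?re_sliceE ?im_sliceE memNset.
Qed.

Lemma re_fourier_mode n y : re_on D (fourier_mode L n w) y = L^-1 *
  \int[leb]_x (cos (wavenumber L n * x) * re_slice w y x + sin (wavenumber L n * x) * im_slice w y x).
Proof.
rewrite /re_on patchE /fourier_mode /=; case: ifPn => [yD|ynD]; last first.
  under eq_Rintegral => x _ do rewrite re_sliceE im_sliceE (negPf ynD) andbF !mulr0 addr0.
  by rewrite Rintegral_cst// mul0r mulr0.
congr (_ * _); rewrite (Rintegral_mkcond leb J (fun x => complex.Re _)).
apply: eq_Rintegral => x _; rewrite patchE re_sliceE im_sliceE yD andbT.
case: ifP => _; last by rewrite !mulr0 addr0.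
by case: (w (x, y)) => a b; rewrite /expi cosN sinN /=; ring.
Qed.

Lemma im_fourier_mode n y : im_on D (fourier_mode L n w) y = L^-1 *
  \int[leb]_x (cos (wavenumber L n * x) * im_slice w y x - sin (wavenumber L n * x) * re_slice w y x).
Proof.
rewrite /im_on patchE /fourier_mode /=; case: ifPn => [yD|ynD]; last first.
  under eq_Rintegral => x _ do rewrite re_sliceE im_sliceE (negPf ynD) andbF !mulr0 subr0.
  by rewrite Rintegral_cst// mul0r mulr0.
congr (_ * _); rewrite (Rintegral_mkcond leb J (fun x => complex.Im _)).
apply: eq_Rintegral => x _; rewrite patchE re_sliceE im_sliceE yD andbT.
case: ifP => _; last by rewrite !mulr0 subr0.
by case: (w (x, y)) => a b; rewrite /expi cosN sinN /=; ring.
Qed.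

Let mcos n : measurable_fun setT (fun z : measurableTypeR R * measurableTypeR R => cos (wavenumber L n * z.1) : R).
Proof. exact: measurableT_comp (measurable_cosM (wavenumber L n)) measurable_fst. Qed.

Let msin n : measurable_fun setT (fun z : measurableTypeR R * measurableTypeR R => sin (wavenumber L n * z.1) : R).
Proof. exact: measurableT_comp (measurable_sinM (wavenumber L n)) measurable_fst. Qed.

Lemma fourier_mode_measurable n : complex_measurable D (fourier_mode L n w).
Proof.
have [mw _] := Lw.
have mr := measurable_re_on mDD mw; have mi := measurable_im_on mDD mw.
split; apply: (measurable_restrictT _ mD).2.
  have -> : (fun y => complex.Re (fourier_mode L n w y)) \_ D = fun y => L^-1 * \int[leb]_x
     (cos (wavenumber L n * x) * re_slice w y x + sin (wavenumber L n * x) * im_slice w y x).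
  by apply/funext => y; exact: re_fourier_mode.
    apply: measurable_funM => //.
  apply: (measurable_Rintegral_fst leb (f := fun z : measurableTypeR R * measurableTypeR R => cos (wavenumber L n * z.1) * re_on DD w z +
     sin (wavenumber L n * z.1) * im_on DD w z)).
  apply: measurable_funD; apply: measurable_funM;
    [exact: mcos|exact: mr|exact: msin|exact: mi].
have -> : (fun y => complex.Im (fourier_mode L n w y)) \_ D = fun y => L^-1 * \int[leb]_x
     (cos (wavenumber L n * x) * im_slice w y x - sin (wavenumber L n * x) * re_slice w y x).
  by apply/funext => y; exact: im_fourier_mode.
apply: measurable_funM => //.
apply: (measurable_Rintegral_fst leb (f := fun z : measurableTypeR R * measurableTypeR R => cos (wavenumber L n * z.1) * im_on DD w z -
   sin (wavenumber L n * z.1) * re_on DD w z)).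
apply: measurable_funB; apply: measurable_funM;
  [exact: mcos|exact: mi|exact: msin|exact: mr].
Qed.

Definition mode_energy n y : R :=
  (re_on D (fourier_mode L n w) y) ^+ 2 + (im_on D (fourier_mode L n w) y) ^+ 2.

Definition slice_energy y : R := ip leb (re_slice w y) (re_slice w y) + ip leb (im_slice w y) (im_slice w y).

(** The mixed products of real and imaginary parts cancel between the frequencies [n] and [- n]. *)
Lemma mode_energy_pair n y : on_circle L (re_slice w y) -> on_circle L (im_slice w y) ->
  mode_energy n y + mode_energy (- n) y = 2 * L ^- 2 *
  ((cosine_moment L n (re_slice w y) ^+ 2 + sine_moment L n (re_slice w y) ^+ 2) +
   (cosine_moment L n (im_slice w y) ^+ 2 + sine_moment L n (im_slice w y) ^+ 2)).
Proof.
move=> /(on_circle_integrable) ir /on_circle_integrable ii.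
have E m : mode_energy m y = L ^- 2 *
    ((cosine_moment L m (re_slice w y) + sine_moment L m (im_slice w y)) ^+ 2 +
     (cosine_moment L m (im_slice w y) - sine_moment L m (re_slice w y)) ^+ 2).
  rewrite /mode_energy re_fourier_mode im_fourier_mode.
  rewrite (RintegralD _ (cos_mul_integrable _ ir) (sin_mul_integrable _ ii))// (RintegralB _ (cos_mul_integrable _ ii) (sin_mul_integrable _ ir))//.
  by rewrite !exprMn -mulrDr exprVn.
have wN : wavenumber L (- n) = - wavenumber L n by rewrite /wavenumber rmorphN mulrN.
have cN phi : cosine_moment L (- n) phi = cosine_moment L n phi.
  by apply: eq_Rintegral => x _; rewrite wN mulNr cosN.
have sN phi : leb.-integrable setT (EFin \o phi) -> sine_moment L (- n) phi = - sine_moment L n phi.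
  move=> iphi; have -> : sine_moment L (- n) phi =
      \int[leb]_x (-1 * (sin (wavenumber L n * x) * phi x)).
    by apply: eq_Rintegral => x _; rewrite wN (mulNr (wavenumber L n)) sinN; ring.
  by rewrite RintegralZl ?mulN1r//; exact: sin_mul_integrable.
by rewrite !E !cN (sN _ ir) (sN _ ii); ring.
Qed.


Lemma fejer_sum_mode_energy N y : on_circle L (re_slice w y) -> on_circle L (im_slice w y) ->
  fejer_sum N (fun n => mode_energy n y) = L ^- 2 *
  (moment_pairing L N (re_slice w y) (re_slice w y) + moment_pairing L N (im_slice w y) (im_slice w y)).
Proof.
move=> cr ci; have two0 : (2 : R) != 0 by [].
apply: (mulfI two0); rewrite mulr_natl mulr2n -{2}fejer_sum_opp /fejer_sum -big_split /=.
rewrite mulrA /moment_pairing -big_split /= mulr_sumr; apply: eq_bigr => i _.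
by rewrite mode_energy_pair// -!expr2.
Qed.

Lemma slice_bessel N y : on_circle L (re_slice w y) -> on_circle L (im_slice w y) ->
  fejer_sum N (fun n => mode_energy n y) <= N%:R * (L^-1 * slice_energy y).
Proof.
move=> cr ci; rewrite fejer_sum_mode_energy//.
have [Lr r0] := cr; have [Li i0] := ci.
have -> : N%:R * (L^-1 * slice_energy y) = L ^- 2 *
    (N%:R * (L * ip leb (re_slice w y) (re_slice w y)) +
     N%:R * (L * ip leb (im_slice w y) (im_slice w y))).
  by rewrite /slice_energy; field; rewrite gt_eqF.
apply: ler_wpM2l; first by rewrite invr_ge0 sqr_ge0.
by apply: lerD; apply: circle_bessel.
Qed.

Lemma mode_energy_ge0 n y : 0 <= mode_energy n y.
Proof. by rewrite addr_ge0 ?sqr_ge0. Qed.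

Lemma mode_energy_le n y : on_circle L (re_slice w y) -> on_circle L (im_slice w y) ->
  mode_energy n y <= (`|n|.+1)%:R * (L^-1 * slice_energy y).
Proof.
move=> cr ci; apply: le_trans (slice_bessel `|n|.+1 cr ci).
have [i fi] : exists i : 'I_(`|n|.+1) * 'I_(`|n|.+1), freq i = n.
  case: n => m /=.
    by exists (ord_max, ord0); rewrite /freq /= subr0.
  by exists (ord0, ord_max); rewrite /freq /= sub0r NegzE.
rewrite /fejer_sum (bigD1 i)//= fi lerDl sumr_ge0// => j _.
exact: mode_energy_ge0.
Qed.

Lemma slice_energy_integrable : leb.-integrable setT (EFin \o slice_energy) /\
  \int[leb]_y slice_energy y = sqr_norm plane DD w.
Proof.
have [_ [Lr Li]] := (in_L2P plane mDD w).1 Lw.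
have [ir Er] := slice_ip_integrable Lr; have [ii Ei] := slice_ip_integrable Li.
split; first exact: (integrableD measurableT ir ii).
by rewrite /sqr_norm -Er -Ei -(RintegralD measurableT ir ii).
Qed.

Lemma measurable_mode_energy n : measurable_fun [set: measurableTypeR R] (mode_energy n).
Proof.
have mf := fourier_mode_measurable n.
have mr := measurable_re_on mD mf; have mi := measurable_im_on mD mf.
by apply: measurable_funD; apply: measurable_funX.
Qed.

Lemma mode_energy_integrable n : leb.-integrable setT (EFin \o mode_energy n).
Proof.
have [is_ _] := slice_energy_integrable.
have iZ := integrableZl measurableT ((`|n|.+1)%:R * L^-1) is_.
apply/integrableP; split; first by apply/measurable_EFinP; exact: measurable_mode_energy.
have /integrableP[mz] := iZ; apply: le_lt_trans.
apply: ae_ge0_le_integral => //.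
- by apply: measurableT_comp => //; apply/measurable_EFinP; exact: measurable_mode_energy.
- exact: measurableT_comp.
apply: ae_mono on_circle_slices => y [cr ci] _ /=.
rewrite lee_fin ger0_norm ?mode_energy_ge0//; apply: le_trans (ler_norm _).
by rewrite -mulrA; exact: mode_energy_le.
Qed.

Lemma fourier_mode_in_L2 n : in_L2 leb D (fourier_mode L n w).
Proof.
have mf := fourier_mode_measurable n; apply/(in_L2P leb mD); split=> //.
have key (u : R -> R) : measurable_fun [set: measurableTypeR R] u ->
    (forall y, u y ^+ 2 <= mode_energy n y) -> L2 leb u.
  move=> mu0 ue; split=> //; apply: le_integrable (mode_energy_integrable n) => //.
    by apply/measurable_EFinP; exact: measurable_funX.
  by move=> y _ /=; rewrite lee_fin !ger0_norm ?sqr_ge0// mode_energy_ge0.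
split; apply: key.
- exact: measurable_re_on.
- by move=> y; rewrite lerDl sqr_ge0.
- exact: measurable_im_on.
- by move=> y; rewrite lerDr sqr_ge0.
Qed.

Lemma sqr_norm_fourier_mode n : sqr_norm leb D (fourier_mode L n w) = \int[leb]_y mode_energy n y.
Proof.
have [_ [Lr Li]] := (in_L2P leb mD _).1 (fourier_mode_in_L2 n).
rewrite /sqr_norm /ip -(RintegralD measurableT (L2_ip_integrable Lr Lr) (L2_ip_integrable Li Li)).
by apply: eq_Rintegral => y _; rewrite /mode_energy !expr2.
Qed.

Lemma fejer_sum_integral N :
  leb.-integrable setT (EFin \o (fun y => fejer_sum N (fun n => mode_energy n y))) /\
  fejer_sum N (fun n => sqr_norm leb D (fourier_mode L n w)) =
  \int[leb]_y fejer_sum N (fun n => mode_energy n y).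
Proof.
rewrite /fejer_sum; elim: (index_enum _) => [|i r [IH1 IH2]].
  split.
    rewrite (_ : _ \o _ = cst 0%E); first exact: integrable0.
    by apply/funext => y /=; rewrite big_nil.
  by rewrite big_nil; under eq_Rintegral => y _ do rewrite big_nil; rewrite Rintegral_cst// mul0r.
have im := mode_energy_integrable (freq i).
have E : (fun y => \sum_(j <- i :: r) mode_energy (freq j) y) =
   (fun y => mode_energy (freq i) y + \sum_(j <- r) mode_energy (freq j) y).
  by apply/funext => y; rewrite big_cons.
rewrite E; split; first exact: (integrableD measurableT im IH1).
by rewrite big_cons IH2 sqr_norm_fourier_mode -(RintegralD measurableT im IH1).
Qed.

Lemma plane_bessel N : fejer_sum N (fun n => sqr_norm leb D (fourier_mode L n w)) <=
  N%:R * (L^-1 * sqr_norm plane DD w).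
Proof.
have [iF ->] := fejer_sum_integral N; have [is_ <-] := slice_energy_integrable.
have iZ := integrableZl measurableT (N%:R * L^-1) is_.
have -> : N%:R * (L^-1 * \int[leb]_y slice_energy y) = \int[leb]_y (N%:R * L^-1 * slice_energy y).
  by rewrite RintegralZl// mulrA.
have e0 y : 0 <= slice_energy y by rewrite addr_ge0 ?ip_ge0.
apply: ae_le_Rintegral => // [y|y|].
- by apply: sumr_ge0 => i _; exact: mode_energy_ge0.
- by rewrite !mulr_ge0 ?invr_ge0// ltW.
- by apply: ae_mono on_circle_slices => y [cr ci]; rewrite -mulrA; exact: slice_bessel.
Qed.

(** The Fejer means converge at almost every height by [circle_parseval], and [slice_bessel]
    dominates them. *)
Lemma plane_parseval (c : R) :
  (forall N, fejer_sum N (fun n => sqr_norm leb D (fourier_mode L n w)) <= N%:R * c) ->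
  sqr_norm plane DD w <= L * c.
Proof.
move=> ec; have [is_ <-] := slice_energy_integrable.
pose f N y : R := N.+1%:R^-1 * fejer_sum N.+1 (fun n => mode_energy n y).
pose g y : R := L^-1 * slice_energy y.
have fF N := fejer_sum_integral N.+1.
have fi N : leb.-integrable setT (EFin \o f N) := integrableZl measurableT N.+1%:R^-1 (fF N).1.
have gi : leb.-integrable setT (EFin \o g) := integrableZl measurableT L^-1 is_.
have fc N : \int[leb]_y f N y <= c.
  rewrite /f RintegralZl//; last exact: (fF N).1.
  by rewrite -(fF N).2 ler_pdivrMl// ltr0n.
have fg : {ae leb, forall y, setT y -> (fun N => (f N y)%:E) @ \oo --> (g y)%:E}.
  apply: ae_mono on_circle_slices => y [cr ci] _; apply: cvgn_EFin.
  apply/cvgrPdist_le => e e0.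
  have e20 : 0 < e * L ^+ 2 / 2 by rewrite divr_gt0 ?mulr_gt0 ?exprn_gt0.
  have [N0 h0] := circle_parseval L0 cr e20; have [N1 h1] := circle_parseval L0 ci e20.
  exists (maxn N0 N1) => // N /=; rewrite geq_max => /andP[n0 n1].
  have {h0} := h0 N.+1 (leqW n0); have {h1} := h1 N.+1 (leqW n1).
  have rN : N.+1%:R != 0 :> R by rewrite pnatr_eq0.
  have := fejer_defect_psd L0 N.+1 => P.
  have := form_ge0 P cr; have {P} := form_ge0 P ci.
  have -> : g y - f N y = N.+1%:R^-1 * L ^- 2 *
      (fejer_defect L N.+1 (re_slice w y) (re_slice w y) +
       fejer_defect L N.+1 (im_slice w y) (im_slice w y)).
    rewrite /g /f fejer_sum_mode_energy// /slice_energy /fejer_defect.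
    move: (N.+1%:R : R) rN => r r0; by field; rewrite gt_eqF// r0.
  move: (fejer_defect _ _ _ _) (fejer_defect _ _ _ _) => q p q0 p0 q1 p1.
  have c0 : 0 <= N.+1%:R^-1 * L ^- 2 by rewrite mulr_ge0 ?invr_ge0 ?sqr_ge0.
  rewrite ger0_norm; last by rewrite mulr_ge0// addr_ge0.
  apply: le_trans (ler_wpM2l c0 (lerD p1 q1)) _.
  rewrite le_eqVlt; apply/orP; left; apply/eqP.
  by move: (N.+1%:R : R) rN => r r0; field; rewrite gt_eqF// r0.
have fle : {ae leb, forall y N, setT y -> (`|(f N y)%:E| <= (g y)%:E)%E}.
  apply: ae_mono on_circle_slices => y [cr ci] N _.
  have f0 : 0 <= f N y by rewrite mulr_ge0 ?invr_ge0// sumr_ge0// => i _; exact: mode_energy_ge0.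
  rewrite /= lee_fin ger0_norm// /f ler_pdivrMl ?ltr0n//.
  exact: slice_bessel.
have mf N : measurable_fun setT (EFin \o f N) := measurable_int _ (fi N).
have mg : measurable_fun setT (EFin \o g) := measurable_int _ gi.
have [_ _ cv] := @dominated_convergence _ _ _ leb setT measurableT (fun N => EFin \o f N)
  (EFin \o g) (EFin \o g) mf mg fg gi fle.
have gc : (\int[leb]_y (g y)%:E <= c%:E)%E.
  rewrite -(cvg_lim _ cv)//; apply: lime_le; first by apply/cvg_ex; eexists; exact: cv.
  apply: nearW => N; have := fc N.
  by rewrite -lee_fin /Rintegral fineK//; exact: integrable_fin_num (fi N).
have : \int[leb]_y g y <= c.
  by rewrite -lee_fin /Rintegral fineK//; exact: integrable_fin_num gi.
by rewrite /g RintegralZl// ler_pdivrMl.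
Qed.

End Function.
End Slices.

(** * The stream function of a mode *)

Lemma ae_mono3 d (T : measurableType d) (R : realType) (mu : {measure set T -> \bar R})
  (P1 P2 P3 Q : T -> Prop) : (forall x, P1 x -> P2 x -> P3 x -> Q x) ->
  {ae mu, forall x, P1 x} -> {ae mu, forall x, P2 x} -> {ae mu, forall x, P3 x} ->
  {ae mu, forall x, Q x}.
Proof.
move=> PQ h1 h2; apply: (ae_mono2 (P := fun x => P1 x /\ P2 x)).
  by move=> x []; exact: PQ.
by apply: ae_mono2 h1 h2 => x.
Qed.

Section ChannelStage.
Context {R : realType}.
Notation leb := (@lebesgue_measure R).
Variable ch : channel.
Notation D := (@cross_section R ch).
Notation cfun := ((R -> R^o) * (R -> R^o))%type.
Implicit Types (u v w : R -> R[i]) (b db h : R -> R) (x y k t : R).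

Definition on_channel u : cfun := (re_on D u, im_on D u).

Lemma L2_loc_int h : L2 leb h -> loc_int h.
Proof.
move=> Lh; have mh := L2_measurable Lh; split=> // x y.
have i1 : leb.-integrable `[x, y] (EFin \o (fun=> 1 : R)) := loc_int_integrable (loc_int_cst 1) x y.
have i2 : leb.-integrable `[x, y] (EFin \o (fun z => h z ^+ 2)).
  exact: integrableS (L2_sqr_integrable Lh).
have i3 : leb.-integrable `[x, y] (EFin \o (fun z => 1 + h z ^+ 2)).
  exact: (integrableD _ i1 i2).
apply: (le_integrable _ _ _ i3) => //; first by apply: measurable_funTS; exact/measurable_EFinP.
move=> z _ /=; rewrite lee_fin [leRHS]ger0_norm ?addr_ge0 ?sqr_ge0//.
rewrite -real_normK ?num_real//; have := sqr_ge0 (`|h z| - 1).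
by rewrite sqrrB expr1n mulr1; have := normr_ge0 (h z); lra.
Qed.

Lemma loc_int_interior h : L2 leb (h \_ D) -> locally_integrable D° h ->
  loc_int (h \_ D°).
Proof.
move=> Lh lh; apply: (loc_int_ae (L2_loc_int Lh)); first exact: locally_integrable_measurable.
exact: ae_restrict_interior.
Qed.

Lemma L2_primitive h h' : L2 leb (h \_ D) -> L2 leb (h' \_ D) -> weak_derivative D° h h' ->
  exists H, AC H (h' \_ D°) /\ {ae leb, forall y, D° y -> H y = h y}.
Proof.
move=> Lh Lh' wd; have [l l' _] := wd.
by apply: weak_derivative_primitive => //; exact: loc_int_interior.
Qed.

(** The primitive is constant on either side of the unit interval, and equals the boundary
    values there by continuity. *)
Lemma boundary_zero h H h' : ch = FiniteChannel ->
  {within `[0, 1], continuous h} -> h 0 = 0 -> h 1 = 0 ->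
  AC H (h' \_ D°) -> {ae leb, forall y, D° y -> H y = h y} ->
  forall y, ~ D° y -> H y = 0.
Proof.
move=> E /(continuous_within_itvP _ ltr01)[_ h0c h1c] h0 h1 AH aeH.
have cH := AC_continuous AH.
have H0 : H 0 = 0.
  apply/eqP; rewrite -normr_eq0; apply/eqP/le_anti; rewrite normr_ge0 andbT.
  apply/ler_addgt0Pr => e e0; rewrite add0r; have e20 : 0 < e / 2 by rewrite divr_gt0.
  have [d d0 dP] := @near_lt _ H 0 _ (cH 0) e20.
  have : \forall x \near 0^'+, `|h 0 - h x| < e / 2 by exact: (@cvgr_dist_lt _ R^o).
  rewrite /at_right near_withinE => /nbhs_ballP[d' /= d'0 d'P].
  have m0 : 0 < Num.min 1 (Num.min d d') by rewrite !lt_min ltr01 d0.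
  have [x] := ae_exists_itv m0 aeH.
  rewrite !lt_min => /and4P[x0 x1 xd xd'] /(_ _) Hx.
  have {}Hx : H x = h x by apply: Hx; apply: unit_interval_interior; rewrite x0.
  have /d'P : ball (0 : R) d' x by rewrite /ball/= sub0r normrN gtr0_norm.
  move=> /(_ x0); rewrite h0 sub0r normrN => a1.
  have := dP x; rewrite subr0 gtr0_norm// => /(_ xd) a2.
  rewrite Hx in a2; move: a1 a2; rewrite !ler_norml ltr_norml => /andP[b1 b2] /andP[b3 b4].
  by apply/andP; split; lra.
have H1 : H 1 = 0.
  apply/eqP; rewrite -normr_eq0; apply/eqP/le_anti; rewrite normr_ge0 andbT.
  apply/ler_addgt0Pr => e e0; rewrite add0r; have e20 : 0 < e / 2 by rewrite divr_gt0.
  have [d d0 dP] := @near_lt _ H 1 _ (cH 1) e20.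
  have : \forall x \near 1^'-, `|h 1 - h x| < e / 2 by exact: (@cvgr_dist_lt _ R^o).
  rewrite /at_left near_withinE => /nbhs_ballP[d' /= d'0 d'P].
  have m0 : Num.max 0 (Num.max (1 - d) (1 - d')) < 1 by rewrite !gt_max ltr01/=; lra.
  have [x] := ae_exists_itv m0 aeH.
  rewrite !gt_max => /andP[/and3P[x0 xd xd'] x1] /(_ _) Hx.
  have {}Hx : H x = h x by apply: Hx; apply: unit_interval_interior; rewrite x0.
  have /d'P : ball (1 : R) d' x by rewrite /ball/= gtr0_norm ?subr_gt0//; lra.
  move=> /(_ x1); rewrite h1 sub0r normrN => a1.
  have := dP x; rewrite distrC gtr0_norm ?subr_gt0// => /(_ _) a2.
  have {}a2 : `|H x - H 1| <= e / 2 by apply: a2; lra.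
  rewrite Hx in a2; move: a1 a2; rewrite !ler_norml ltr_norml => /andP[b1 b2] /andP[b3 b4].
  by apply/andP; split; lra.
move=> y; rewrite cross_section_interior E /= in_itv/= => /negP.
rewrite negb_and -!leNgt => /orP[y0|y1].
  by rewrite -(AC_boundary E AH y0) //; left.
by rewrite (AC_boundary E AH y1) //; right.
Qed.

Lemma AC_cos k t : AC (fun y => cos (k * t * y)) (fun y => - (k * t) * sin (k * t * y)).
Proof.
apply: AC_is_derive => [y|y].
  by apply: is_derive_eq; rewrite /GRing.scale/=; ring.
apply: cvgM; first exact: cvg_cst.
exact: (@continuous_sinM R (k * t) y).
Qed.

Lemma AC_sin k t : AC (fun y => sin (k * t * y)) (fun y => k * t * cos (k * t * y)).
Proof.
apply: AC_is_derive => [y|y].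
  by apply: is_derive_eq; rewrite /GRing.scale/=; ring.
apply: cvgM; first exact: cvg_cst.
exact: (@continuous_cosM R (k * t) y).
Qed.

(** Multiplication by [e^(-ikty)] turns the sheared derivative [d_y - ikt] into [d_y]. *)
Lemma AC_rot k t (U dU : cfun) : AC U.1 dU.1 -> AC U.2 dU.2 ->
  let dV := rot k t (fun y => dU.1 y + k * t * U.2 y, fun y => dU.2 y - k * t * U.1 y) in
  AC (rot k t U).1 dV.1 /\ AC (rot k t U).2 dV.2.
Proof.
move=> A1 A2; have C := AC_cos k t; have S := AC_sin k t.
have c1 := ACM C A1; have c2 := ACM C A2; have s1 := ACM S A1; have s2 := ACM S A2.
split.
  have := ACD c1 s2; rewrite /rot /=; congr AC; apply/funext => y; ring.
have := ACD c2 (ACZ (-1) s1); rewrite /rot /=; congr AC; apply/funext => y; ring.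
Qed.

Lemma L2c_on_channel u : in_L2 leb D u -> L2c (on_channel u).
Proof. by move=> /(in_L2P leb (measurable_cross_section ch))[_ []]. Qed.

Lemma sheared_derivative_primitive (g : R -> R) k t u v : sheared_derivative ch g k t u v ->
  exists (U : cfun) (d1 d2 : R -> R),
  [/\ AC U.1 (d1 \_ D°), AC U.2 (d2 \_ D°),
      {ae leb, forall y, D° y -> U.1 y = (on_channel u).1 y /\ U.2 y = (on_channel u).2 y} &
      {ae leb, forall y, D° y ->
         (on_channel v).1 y = g y * (d1 y + k * t * U.2 y) /\
         (on_channel v).2 y = g y * (d2 y - k * t * U.1 y)}].
Proof.
move=> [du [Lu Ldu Lv [wr wi] vE]].
have [u1 u2] := L2c_on_channel Lu; have [du1 du2] := L2c_on_channel Ldu.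
have [U1 [A1 E1]] := L2_primitive u1 du1 wr; have [U2 [A2 E2]] := L2_primitive u2 du2 wi.
exists (U1, U2), (fun y => complex.Re (du y)), (fun y => complex.Im (du y)).
have onE y : D° y -> forall w, (on_channel w).1 y = complex.Re (w y) /\
    (on_channel w).2 y = complex.Im (w y).
  by move=> /interior_subD Dy w; rewrite /on_channel /re_on /im_on /= !patchE mem_set.
split=> //.
  apply: ae_mono2 E1 E2 => y e1 e2 Dy; have [-> ->] := onE _ Dy u.
  by split; [exact: e1|exact: e2].
have E12 : {ae leb, forall y, D° y -> U1 y = complex.Re (u y) /\ U2 y = complex.Im (u y)}.
  by apply: ae_mono2 E1 E2 => y e1 e2 Dy; split; [exact: e1|exact: e2].
apply: ae_mono2 E12 vE => y E12 vE Dy; have [-> ->] := onE _ Dy v.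
rewrite vE; last exact: interior_subD Dy.
have [/= -> ->] := E12 Dy.
case: (du y) => a b; case: (u y) => a' b' /=.
by split; ring.
Qed.

(** The rotated stream function solves an elliptic equation with [g d_y] twice, so
    [elliptic_smoothing] applies to its extension by zero. The flux [V], extended by constants,
    is continuous across the boundary, and the products with the stream function vanish outside. *)
Lemma stage_smoothing (g f a da fb dfb : R -> R) (c A B k t : R) (k0 : 0 < `|k|) w Phi :
  0 < c -> AC a da -> AC fb dfb -> (forall y, c <= a y <= c^-1) ->
  (forall y, `|a y| <= A) -> (forall y, `|da y| <= A) ->
  (forall y, `|fb y| <= B) -> (forall y, `|dfb y| <= B) ->
  {ae leb, forall y, D° y -> a y * g y = 1} -> {ae leb, forall y, D° y -> fb y = f y} ->
  in_L2 leb D w -> stream_function ch g k t w Phi ->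
  exists F : cfun, [/\ L2c F,
    (let dw := on_channel (fun y => 'i%C * (k * f y)%:C%C * Phi y) in
     {ae leb, forall y, F.1 y = dw.1 y /\ F.2 y = dw.2 y}) &
    exists eta, [/\ L2c eta, rot k t F = smear2 (expP k0) (-1) eta &
      ip2 eta eta <= (3 * B * A * (1 + `|k| ^- 2) / (`|k| * c)) ^+ 2 *
        ip2 (smear2 (expP k0) 1 (rot k t (on_channel w)))
            (smear2 (expP k0) 1 (rot k t (on_channel w)))]].
Proof.
move=> c0 Aa Afb ac aA daA fB dfB ag fbE Lw [bc [v [z [sv sz wE]]]].
have [_ [LPhi _ Lv _ _]] := sv; have [_ [_ _ Lz _ _]] := sz.
have [U [d1 [d2 [AU1 AU2 UE vE]]]] := sheared_derivative_primitive sv.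
have [V [e1 [e2 [AV1 AV2 VE zE]]]] := sheared_derivative_primitive sz.
have onDE u : {ae leb, forall y, D° y -> (on_channel u).1 y = complex.Re (u y) /\
    (on_channel u).2 y = complex.Im (u y)}.
  apply: aeW => y /interior_subD Dy.
  by rewrite /on_channel /re_on /im_on /= !patchE mem_set.
have U0 y : ~ D° y -> U.1 y = 0 /\ U.2 y = 0.
  move=> nD; have [E|E] : ch = InfiniteChannel \/ ch = FiniteChannel by case: ch; [left|right].
    by case: nD; rewrite cross_section_interior E.
  move: bc; rewrite /boundary_condition E => -[cr ci P0 P1].
  have aer : {ae leb, forall y, D° y -> U.1 y = complex.Re (Phi y)}.
    by apply: ae_mono2 UE (onDE Phi) => x H1 H2 Dx; have [-> _] := H1 Dx; have [-> _] := H2 Dx.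
  have aei : {ae leb, forall y, D° y -> U.2 y = complex.Im (Phi y)}.
    by apply: ae_mono2 UE (onDE Phi) => x H1 H2 Dx; have [_ ->] := H1 Dx; have [_ ->] := H2 Dx.
  split.
    by apply: (boundary_zero E cr _ _ AU1 aer nD); rewrite ?P0 ?P1.
  by apply: (boundary_zero E ci _ _ AU2 aei nD); rewrite ?P0 ?P1.
have offD y w' : ~ D y -> (on_channel w').1 y = 0 /\ (on_channel w').2 y = 0.
  by move=> nD; rewrite /on_channel /re_on /im_on /= !patchE !ifN//; apply/negP => /set_mem.
have [lP1 lP2] := L2c_on_channel LPhi; have [lv1 lv2] := L2c_on_channel Lv.
have LU : L2c U.
  split; [apply: (L2_ae (AC_measurable AU1) _ lP1)|apply: (L2_ae (AC_measurable AU2) _ lP2)].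
    apply: ae_mono2 UE (ae_interior ch) => y E DD.
    have [/DD/E[-> _]//|nD] := pselect (D y).
    by rewrite (offD _ _ nD).1 (U0 y _).1// => /interior_subD.
  apply: ae_mono2 UE (ae_interior ch) => y E DD.
  have [/DD/E[_ ->]//|nD] := pselect (D y).
  by rewrite (offD _ _ nD).2 (U0 y _).2// => /interior_subD.
pose X : cfun := (fun y => (d1 \_ D°) y + k * t * U.2 y, fun y => (d2 \_ D°) y - k * t * U.1 y).
pose Y : cfun := (fun y => (e1 \_ D°) y + k * t * V.2 y, fun y => (e2 \_ D°) y - k * t * V.1 y).
have patchD (h : R -> R) y : D° y -> (h \_ D°) y = h y by move=> Dy; rewrite patchE mem_set.
have patch0 (h : R -> R) y : ~ D° y -> (h \_ D°) y = 0.
  by move=> nD; rewrite patchE ifN//; apply/negP => /set_mem.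
have inside : {ae leb, forall y, D° y -> [/\ X.1 y = a y * V.1 y, X.2 y = a y * V.2 y,
    Y.1 y = a y * ((on_channel w).1 y + k ^+ 2 * U.1 y) &
    Y.2 y = a y * ((on_channel w).2 y + k ^+ 2 * U.2 y)]}.
  have h1 : {ae leb, forall y, D° y -> X.1 y = a y * V.1 y /\ X.2 y = a y * V.2 y}.
    apply: ae_mono3 ag vE VE => y agy vy Vy Dy.
    have [-> ->] := Vy Dy; have [-> ->] := vy Dy.
    by rewrite /X /= !patchD// !mulrA agy// !mul1r.
  have h2 : {ae leb, forall y, D° y -> Y.1 y = a y * (on_channel z).1 y /\
      Y.2 y = a y * (on_channel z).2 y}.
    apply: ae_mono2 ag zE => y agy zy Dy; have [-> ->] := zy Dy.
    by rewrite /Y /= !patchD// !mulrA agy// !mul1r.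
  have h3 : {ae leb, forall y, D° y ->
      (on_channel z).1 y = (on_channel w).1 y + k ^+ 2 * U.1 y /\
      (on_channel z).2 y = (on_channel w).2 y + k ^+ 2 * U.2 y}.
    apply: ae_mono2 wE UE => y wy Uy Dy; have [-> ->] := Uy Dy.
    have Dy' := interior_subD Dy; rewrite /on_channel /re_on /im_on /= !patchE mem_set//.
    rewrite -(wy Dy'); case: (Phi y) => p1 p2; case: (z y) => z1 z2 /=.
    by split; ring.
  apply: ae_mono3 h1 h2 h3 => y x1 x2 x3 Dy.
  have [X1 X2] := x1 Dy; have [Y1 Y2] := x2 Dy; have [Z1 Z2] := x3 Dy.
  by split; rewrite // ?Y1 ?Y2 ?Z1 ?Z2.
have X0 y : ~ D° y -> X.1 y = 0 /\ X.2 y = 0.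
  by move=> nD; have [u1 u2] := U0 y nD; rewrite /X /= !patch0// u1 u2 mulr0 addr0 subr0.
have ma := AC_measurable Aa.
have mX1 : measurable_fun [set: measurableTypeR R] X.1.
  by case: AU1 => /loc_int_measurable m1 _; apply: measurable_funD => //;
    apply: measurable_funM => //; exact: AC_measurable AU2.
have mX2 : measurable_fun [set: measurableTypeR R] X.2.
  by case: AU2 => /loc_int_measurable m1 _; apply: measurable_funB => //;
    apply: measurable_funM => //; exact: AC_measurable AU1.
have LX : L2c X.
  have key y : (D y -> D° y) -> (D° y -> X.1 y = a y * V.1 y /\ X.2 y = a y * V.2 y) ->
      (D° y -> V.1 y = (on_channel v).1 y /\ V.2 y = (on_channel v).2 y) ->
      a y * (on_channel v).1 y = X.1 y /\ a y * (on_channel v).2 y = X.2 y.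
    move=> DD XE VEy; have [/DD Dy|nD] := pselect (D y).
      by have [-> ->] := XE Dy; have [-> ->] := VEy Dy.
    have [-> ->] := X0 y (fun q => nD (interior_subD q)).
    by have [-> ->] := offD y v nD; rewrite mulr0.
  have aeX : {ae leb, forall y,
      a y * (on_channel v).1 y = X.1 y /\ a y * (on_channel v).2 y = X.2 y}.
    apply: ae_mono3 (ae_interior ch) inside VE => y DD iy Vy.
    by apply: key DD _ Vy => Dy; have [] := iy Dy.
  split; [apply: (L2_ae mX1 _ (L2_bounded_mul ma aA lv1))|
          apply: (L2_ae mX2 _ (L2_bounded_mul ma aA lv2))].
    by apply: ae_mono aeX => y [].
  by apply: ae_mono aeX => y [].
have [Ap1 Ap2] := AC_rot k t (U := U) (dU := (d1 \_ D°, d2 \_ D°)) AU1 AU2.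
have [Ar1 Ar2] := AC_rot k t (U := V) (dU := (e1 \_ D°, e2 \_ D°)) AV1 AV2.
have Lp := L2c_rot k t LU; have Ldp := L2c_rot k t LX.
have Lom := L2c_rot k t (L2c_on_channel Lw).
have a0 y : a y != 0 by rewrite gt_eqF//; apply: lt_le_trans c0 _; case/andP: (ac y).
pose p := rot k t U; pose r := rot k t V; pose om := rot k t (on_channel w).
have rot1 (q : cfun) y : (rot k t q).1 y = cos (k * t * y) * q.1 y + sin (k * t * y) * q.2 y.
  by [].
have rot2 (q : cfun) y : (rot k t q).2 y = cos (k * t * y) * q.2 y - sin (k * t * y) * q.1 y.
  by [].
(* the equations hold inside the channel; outside, everything they are multiplied with vanishes *)
have all y : (D° y -> [/\ X.1 y = a y * V.1 y, X.2 y = a y * V.2 y,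
    Y.1 y = a y * ((on_channel w).1 y + k ^+ 2 * U.1 y) &
    Y.2 y = a y * ((on_channel w).2 y + k ^+ 2 * U.2 y)]) ->
    [/\ (rot k t X).1 y = a y * r.1 y /\ (rot k t X).2 y = a y * r.2 y &
        (rot k t Y).1 y = a y * (om.1 y + k ^+ 2 * p.1 y) /\
        (rot k t Y).2 y = a y * (om.2 y + k ^+ 2 * p.2 y)] \/
    [/\ (rot k t X).1 y = 0, (rot k t X).2 y = 0, p.1 y = 0 & p.2 y = 0].
  move=> H; have [Dy|nD] := pselect (D° y); [left|right].
    have [h1 h2 h3 h4] := H Dy.
    by split; split; rewrite /p /r /om !(rot1, rot2) ?h1 ?h2 ?h3 ?h4; ring.
  have [x1 x2] := X0 y nD; have [u1 u2] := U0 y nD.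
  by split; rewrite /p !(rot1, rot2) ?x1 ?x2 ?u1 ?u2 !mulr0 ?subr0 ?addr0.
have [||| eta [Leta Feta eta_le]] := @elliptic_smoothing R k k0 c A B a da fb dfb p _ r _ om
  c0 Aa Afb Ap1 Ap2 Ar1 Ar2 Lp Ldp Lom ac aA daA fB dfB.
- apply: ae_mono inside => y /all [[[h1 h2] _]|[h1 h2 h3 h4]].
    by rewrite h1 h2; split; field; exact: a0.
  by rewrite h1 h2 h3 h4 !mul0r !mulr0.
- apply: ae_mono inside => y /all [[[h1 h2] _]|[h1 h2 h3 h4]].
    by rewrite h1 h2; split; field; exact: a0.
  by rewrite h1 h2 !mulr0 expr2 !mul0r.
- apply: ae_mono inside => y /all [[_ [h1 h2]]|[h1 h2 h3 h4]].
    by rewrite h1 h2.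
  by rewrite h3 h4 !mulr0.
have mfb := AC_measurable Afb.
have [U1 U2] := LU.
pose F : cfun := (fun y => - k * (fb y * U.2 y), fun y => k * (fb y * U.1 y)).
exists F; split.
- by split; apply: L2Z; exact: (L2_bounded_mul mfb fB).
- apply: ae_mono3 fbE UE (ae_interior ch) => y fy Uy DD.
  have [Dy|nD] := pselect (D y); last first.
    have [-> ->] := offD y (fun y => 'i%C * (k * f y)%:C%C * Phi y) nD.
    by have [u1 u2] := U0 y (fun q => nD (interior_subD q)); rewrite /F /= u1 u2 !mulr0.
  have Diy := DD Dy; rewrite /F /= fy//; have [-> ->] := Uy Diy.
  rewrite /on_channel /re_on /im_on /= !patchE mem_set//.
  by case: (Phi y) => p1 p2 /=; split; ring.
- exists eta; split=> //; rewrite -Feta.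
  by congr pair; apply/funext => y; rewrite /rot /F /p /rot /=; ring.
Qed.

End ChannelStage.

(** * A mode of the linearized equation *)

Section ChannelMode.
Context {R : realType}.
Notation leb := (@lebesgue_measure R).
Variable ch : channel.
Notation D := (@cross_section R ch).
Notation cfun := ((R -> R^o) * (R -> R^o))%type.
Implicit Types (u v : R -> R[i]) (x y k t : R).

Let mD := @measurable_cross_section R ch.

Lemma on_channelB u v : on_channel ch (fun y => u y - v y) = on_channel ch u - on_channel ch v.
Proof. by rewrite /on_channel re_onB im_onB. Qed.

Lemma sqr_norm_on_channel u : sqr_norm leb D u = ip2 (on_channel ch u) (on_channel ch u).
Proof. by []. Qed.

Lemma eq_ae_ip2 (a b : cfun) : L2c a -> L2c b ->
  {ae leb, forall y, a.1 y = b.1 y /\ a.2 y = b.2 y} -> ip2 a a = ip2 b b.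
Proof.
move=> [a1 a2] [b1 b2] ab.
have ab1 : {ae leb, forall y, a.1 y = b.1 y} by apply: ae_mono ab => y [].
have ab2 : {ae leb, forall y, a.2 y = b.2 y} by apply: ae_mono ab => y [].
rewrite /ip2; congr (_ + _); apply: eq_ae_ip => //;
  try exact: L2_measurable a1; try exact: L2_measurable a2;
  try exact: L2_measurable b1; exact: L2_measurable b2.
Qed.

(** The limit that defines the derivative, squared and cleared of denominators. *)
Lemma L2_derivative_increment (w : R -> R -> R[i]) t (dw : R -> R[i]) (F : cfun) (e : R) :
  (forall s, 0 <= s -> in_L2 leb D (w s)) -> 0 <= t -> complex_measurable D dw -> L2c F ->
  {ae leb, forall y, F.1 y = (on_channel ch dw).1 y /\ F.2 y = (on_channel ch dw).2 y} ->
  L2_derivative ch w t dw -> 0 < e ->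
  exists2 d : R, 0 < d & forall s, 0 <= s -> `|s - t| < d ->
    let r := on_channel ch (w s) - on_channel ch (w t) - (s - t) *: F in
    ip2 r r <= e * (s - t) ^+ 2.
Proof.
move=> Lw t0 mdw LF FE wd e0.
have [F1 F2] := LF.
have Ldw : in_L2 leb D dw.
  apply/(in_L2P leb mD); split=> //; split.
    by apply: (L2_ae (measurable_re_on mD mdw) _ F1); apply: ae_mono FE => y [].
  by apply: (L2_ae (measurable_im_on mD mdw) _ F2); apply: ae_mono FE => y [].
pose q s y := ((s - t)^-1)%:C%C * (w s y - w t y) - dw y.
have Lq s : 0 <= s -> in_L2 leb D (q s).
  move=> s0; apply: in_L2B => //; apply: in_L2_realZ => //.
  by apply: in_L2B => //; exact: Lw.
have se0 : 0 < Num.sqrt e by rewrite sqrtr_gt0.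
have : \forall s \near within [set s | 0 <= s] t^', (L2norm leb D (q s) < (Num.sqrt e)%:E)%E.
  apply: (wd [set x | (x < (Num.sqrt e)%:E)%E]).
  exact: (@nbhs_open_ereal_lt _ _ (fun=> Num.sqrt e)).
rewrite near_withinE /dnbhs near_withinE => /nbhs_ballP[d /= d0 dP].
exists d => // s s0 sd; set r := _ - _ - _ => /=.
have Lr : L2c r.
  rewrite /r; have Ls := L2c_on_channel (Lw s s0); have Lt := L2c_on_channel (Lw t t0).
  by apply: (DB L2c_lin) => //; [exact: (DB L2c_lin)|exact: (DZ L2c_lin)].
have [st|st] := eqVneq s t.
  have -> : r = 0 *: F by rewrite /r st !subrr !scale0r subr0.
  have D0 : L2c (0 *: F) := DZ L2c_lin 0 LF.
  have e00 : 0 <= e * (s - t) ^+ 2 by rewrite mulr_ge0 ?sqr_ge0// ltW.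
  have E := formZl ip2_psd 0 LF D0; rewrite mul0r in E.
  by apply: le_trans e00; rewrite le_eqVlt; apply/orP; left; apply/eqP; exact: E.
have Lqs := L2c_on_channel (Lq s s0).
have : (L2norm leb D (q s) < (Num.sqrt e)%:E)%E.
  by apply: dP => //; rewrite /ball/= distrC.
rewrite (L2normE mD (Lq s s0)) lte_fin ltr_sqrt// sqr_norm_on_channel => qe.
have st0 : s - t != 0 by rewrite subr_eq0.
have rE : {ae leb, forall y, r.1 y = ((s - t) *: on_channel ch (q s)).1 y /\
    r.2 y = ((s - t) *: on_channel ch (q s)).2 y}.
  apply: ae_mono FE => y [f1 f2].
  have -> : r.1 y = re_on D (w s) y - re_on D (w t) y - (s - t) * F.1 y by [].
  have -> : r.2 y = im_on D (w s) y - im_on D (w t) y - (s - t) * F.2 y by [].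
  rewrite f1 f2 /q /on_channel re_onB im_onB re_on_realZ im_on_realZ re_onB im_onB /=.
  have fE x1 x2 x5 : x1 - x2 - (s - t) * x5 = (s - t) * ((s - t)^-1 * (x1 - x2) - x5).
    by field.
  by split; [exact: (fE (re_on D (w s) y))|exact: (fE (im_on D (w s) y))].
rewrite (eq_ae_ip2 Lr _ rE); last exact: (DZ L2c_lin).
have Dq := DZ L2c_lin (s - t) Lqs.
rewrite (formZl ip2_psd _ Lqs Dq) (formC ip2_psd Lqs Dq).
rewrite (formZl ip2_psd _ Lqs Lqs) mulrA -expr2 mulrC.
by rewrite ler_wpM2r ?sqr_ge0// ltW.
Qed.

(** The forcing found by [stage_smoothing] at each time satisfies the hypotheses of [mode_bound]
    and [mode_cauchy]. *)
Lemma channel_mode (g f a da fb dfb : R -> R) (c A B k : R) (w Phi : R -> R -> R[i]) :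
  0 < `|k| -> 0 < c -> AC a da -> AC fb dfb -> (forall y, c <= a y <= c^-1) ->
  (forall y, `|a y| <= A) -> (forall y, `|da y| <= A) ->
  (forall y, `|fb y| <= B) -> (forall y, `|dfb y| <= B) ->
  {ae leb, forall y, D° y -> a y * g y = 1} -> {ae leb, forall y, D° y -> fb y = f y} ->
  measurable_fun (D : set (measurableTypeR R)) f ->
  0 <= 3 * B * A * (1 + `|k| ^- 2) / (`|k| * c) <= coupling ->
  (forall t, 0 <= t -> in_L2 leb D (w t)) ->
  (forall t, 0 <= t -> stream_function ch g k t (w t) (Phi t) /\
    L2_derivative ch w t (fun y => 'i%C * (k * f y)%:C%C * Phi t y)) ->
  (forall t t', 0 <= t -> t <= t' ->
     sqr_norm leb D (fun y => w t' y - w t y) <= sqr_norm leb D (w 0)) /\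
  (forall e : R, 0 < e -> exists2 T : R, 0 <= T & forall t t', T <= t -> T <= t' ->
     sqr_norm leb D (fun y => w t' y - w t y) <= e).
Proof.
move=> k0 c0 Aa Afb ac aA daA fB dfB ag fbE mf /andP[C0 CC] Lw ev.
pose W t := on_channel ch (w t).
pose Q t (Ft : cfun) : Prop := 0 <= t -> [/\ L2c Ft,
    (let dw := on_channel ch (fun y => 'i%C * (k * f y)%:C%C * Phi t y) in
     {ae leb, forall y, Ft.1 y = dw.1 y /\ Ft.2 y = dw.2 y}) &
    exists eta, [/\ L2c eta, rot k t Ft = smear2 (expP k0) (-1) eta &
      ip2 eta eta <= coupling ^+ 2 *
        ip2 (smear2 (expP k0) 1 (rot k t (W t))) (smear2 (expP k0) 1 (rot k t (W t)))]].
have [F FP] : exists F : R -> cfun, forall t, Q t (F t).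
  suff H t : exists Ft, Q t Ft by exists (fun t => sval (cid (H t))) => t; exact: svalP.
  have [t0|nt0] := pselect (0 <= t); last by exists 0.
  have [sf _] := ev t t0.
  have [Ft [LF FE [eta [Le Ee eta_le]]]] :=
    stage_smoothing k0 c0 Aa Afb ac aA daA fB dfB ag fbE (Lw t t0) sf.
  exists Ft => _; split=> //; exists eta; split=> //.
  apply: le_trans eta_le _; apply: ler_wpM2r; last by rewrite ler_pXn2r ?nnegrE// ltW// coupling_gt0.
  by apply: (form_ge0 ip2_psd); apply: L2c_smear; apply: L2c_rot; apply: L2c_on_channel; exact: Lw.
have LW t : 0 <= t -> L2c (W t) by move=> t0; apply: L2c_on_channel; exact: Lw.
have LF t : 0 <= t -> L2c (F t) by move=> /FP[].
have Feta t : 0 <= t -> exists eta, [/\ L2c eta, rot k t (F t) = smear2 (expP k0) (-1) eta &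
      ip2 eta eta <= coupling ^+ 2 *
        ip2 (smear2 (expP k0) 1 (rot k t (W t))) (smear2 (expP k0) 1 (rot k t (W t)))].
  by move=> /FP[].
have Wd t (e : R) : 0 <= t -> 0 < e -> exists2 d : R, 0 < d &
    forall s, 0 <= s -> `|s - t| < d ->
    ip2 (W s - W t - (s - t) *: F t) (W s - W t - (s - t) *: F t) <= e * (s - t) ^+ 2.
  move=> t0 e0; have [LFt FE _] := FP t t0; have [sf wd] := ev t t0.
  apply: (L2_derivative_increment Lw t0 _ LFt FE wd e0).
  have [_ [v [z [[du [[mPhi _] _ _ _ _]] _ _]]]] := sf.
  case: mPhi => mr mi; split.
    rewrite (_ : (fun y => _) = (fun y => - (k * f y * complex.Im (Phi t y)))).
      apply: measurableT_comp => //; apply: measurable_funM => //.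
      exact: measurable_funM.
    by apply/funext => y; case: (Phi t y) => p1 p2 /=; ring.
  rewrite (_ : (fun y => _) = (fun y => k * f y * complex.Re (Phi t y))).
    by apply: measurable_funM => //; exact: measurable_funM.
  by apply/funext => y; case: (Phi t y) => p1 p2 /=; ring.
split=> [t t' t0 tt'|e e0].
  rewrite !sqr_norm_on_channel on_channelB.
  exact: (@mode_bound R k k0 W F LW LF Feta Wd t t' t0 tt').
have [T T0 TP] := @mode_cauchy R k k0 W F LW LF Feta Wd e e0.
exists T => // t t' Tt Tt'; rewrite sqr_norm_on_channel on_channelB.
exact: TP.
Qed.

End ChannelMode.

(** * Coefficients and smallness *)

Section Coefficients.
Context {R : realType}.
Notation leb := (@lebesgue_measure R).

Section Channel.
Variable ch : channel.
Notation D := (@cross_section R ch).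
Implicit Types (u g f : R -> R).

Lemma sobolev_measurable (n : nat) u (s : R) : (sobolev_oo_norm n.+1 D u < s%:E)%E ->
  measurable_fun (D : set (measurableTypeR R)) u.
Proof.
move=> /ereal_inf_lt[_ [h [h0 wd _]] _].
have [lu _ _] := wd 0%N isT; rewrite h0 in lu; case: lu => + _ _.
rewrite cross_section_interior; case: ch => //= mu.
have -> : `[0, 1]%classic = `]0, 1[%classic `|` ([set 0] `|` [set 1]) :> set R.
  apply/seteqP; split=> x /=; rewrite !in_itv /=.
    move=> /andP[]; rewrite !le_eqVlt => /predU1P[->|x0]; first by right; left.
    by move=> /predU1P[->|x1]; [right; right|left; rewrite x0].
  by move=> [/andP[/ltW -> /ltW ->]//|[->|->]]; rewrite lexx ler01.
apply/measurable_funU; [exact: measurable_itv|exact: measurableU|].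
split=> //; apply/measurable_funU; [exact: measurable_set1|exact: measurable_set1|].
by split; exact: measurable_fun_set1.
Qed.

Lemma sobolev_coefficient (n : nat) u (s : R) : (sobolev_oo_norm n.+1 D u < s%:E)%E ->
  exists b v db, [/\ AC b (v \_ D°), AC b db, {ae leb, forall y, D° y -> b y = u y},
    (forall y, `|b y| <= s) & (forall y, `|db y| <= s)].
Proof.
move=> us.
have [b [v [Ab bE bs vs]]] := sobolev_AC us.
have s0 : 0 <= s by exact: le_trans (bs 0).
have [db Adb dbs] := AC_clip s0 Ab vs.
by exists b, v, db; split.
Qed.

End Channel.

Lemma wavenumber_ge (L : R) (n : int) : 0 < L -> n != 0 -> L^-1 <= `|wavenumber L n|.
Proof.
move=> L0 n0; rewrite /wavenumber !normrM (ger0_norm (ler0n _ 2)) (gtr0_norm (pi_gt0 R)).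
rewrite gtr0_norm ?invr_gt0// mulrAC ler_peMl ?invr_ge0 ?(ltW L0)//.
have n1 : 1 <= `|n%:~R : R|.
  by rewrite -intr_norm -[1]/(1%:~R) ler_int; move: n0; rewrite -normr_gt0; case: `|n|.
have p2 := pi_ge2 R.
have p1 : 1 <= 2 * pi :> R by move: p2; clear; lra.
exact: mulr_ege1.
Qed.

Lemma sobolev_scale_lt (N : \bar R) (L e : R) : 0 < L -> (N < +oo)%E -> (L%:E * N < e%:E)%E ->
  exists2 s : R, (N < s%:E)%E & L * s < e.
Proof.
move=> L0; case: N => [r _ /=| //|_ _].
  rewrite -EFinM lte_fin => h; exists ((r + e / L) / 2).
    by rewrite lte_fin ltr_pdivlMr// mulr_natr mulr2n ltrD2l ltr_pdivlMr// mulrC.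
  rewrite mulrA ltr_pdivrMr// mulrDr mulrCA divff ?gt_eqF// mulr1.
  by rewrite mulr_natr mulr2n ltrD2r.
have [e0|e0] := ltP 0 e; first by exists 0; rewrite ?ltNyr ?mulr0.
exists (e / L - 1); first by rewrite ltNyr.
by rewrite mulrBr mulrCA divff ?gt_eqF// !mulr1; lra.
Qed.

(** [K] is at least [1 / L]: one factor [1 / K] is absorbed by the smallness of [L * B], the
    others by [Lmax]. *)
Lemma small_coupling (A B c L Lmax K : R) : 0 < A -> 0 <= B -> 0 < c -> 0 < L -> L <= Lmax ->
  L^-1 <= K -> L * B < coupling * c / (3 * A * (1 + Lmax ^+ 2)) ->
  0 <= 3 * B * A * (1 + K ^- 2) / (K * c) <= coupling.
Proof.
move=> A0 B0 c0 L0 LL LK LB.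
have K0 : 0 < K by apply: lt_le_trans LK; rewrite invr_gt0.
have KL : K^-1 <= L by rewrite -[L]invrK lef_pV2 ?posrE ?invr_gt0.
have Kn : 0 <= K^-1 by rewrite invr_ge0 ltW.
have K2 : K ^- 2 <= Lmax ^+ 2.
  by rewrite -exprVn ler_sqr ?nnegrE// ?(le_trans KL)// ltW// (lt_le_trans L0).
have c30 : 0 < 3 * A * (1 + Lmax ^+ 2).
  by rewrite !mulr_gt0// ltr_wpDr ?sqr_ge0.
apply/andP; split.
  by rewrite mulr_ge0 ?invr_ge0 ?mulr_ge0 ?addr_ge0 ?invr_ge0 ?sqr_ge0// ltW.
rewrite ltr_pdivlMr// in LB.
rewrite (invfM K c) mulrA ler_pdivrMr//; apply: le_trans (ltW LB).
rewrite (_ : 3 * B * A * (1 + K ^- 2) / K = (K^-1 * B) * (3 * A * (1 + K ^- 2))); last by ring.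
apply: ler_pM.
- by rewrite mulr_ge0.
- by rewrite mulr_ge0 ?addr_ge0 ?invr_ge0 ?sqr_ge0 ?mulr_ge0 ?ltW.
- by rewrite ler_wpM2r.
- have A3 : 0 <= 3 * A by rewrite mulr_ge0// ltW.
  by rewrite (ler_wpM2l A3)// lerD2l.
Qed.

(** The threshold is the one of [small_coupling]; it does not depend on the frequency. The
    coefficients enter through their Lipschitz representatives, continued outside the channel. *)
Lemma mode_stability (c M Lmax : R) : 0 < c -> exists2 eps : R, 0 < eps &
  forall (ch : channel) (L : R) (g f : R -> R),
    0 < L -> L <= Lmax ->
    (forall y, (@cross_section R ch)° y -> c < g y < c^-1) ->
    (sobolev_oo_norm 3 (cross_section ch) (fun y => (g y)^-1)%R <= M%:E)%E ->
    (sobolev_oo_norm 3 (cross_section ch) f < +oo)%E ->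
    (L%:E * sobolev_oo_norm 3 (cross_section ch) f < eps%:E)%E ->
  forall (n : int) (w Phi : R -> R -> R[i]), n != 0 ->
    (forall t, 0 <= t -> in_L2 leb (cross_section ch) (w t)) ->
    (forall t, 0 <= t -> stream_function ch g (wavenumber L n) t (w t) (Phi t) /\
      L2_derivative ch w t (fun y => 'i%C * (wavenumber L n * f y)%:C%C * Phi t y)) ->
  (forall t t', 0 <= t -> t <= t' ->
     sqr_norm leb (cross_section ch) (fun y => w t' y - w t y) <=
     sqr_norm leb (cross_section ch) (w 0)) /\
  (forall e : R, 0 < e -> exists2 T : R, 0 <= T & forall t t', T <= t -> T <= t' ->
     sqr_norm leb (cross_section ch) (fun y => w t' y - w t y) <= e).
Proof.
move=> c0; pose A : R := `|M| + 1.
have A0 : 0 < A by rewrite ltr_wpDl.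
exists (coupling * c / (3 * A * (1 + Lmax ^+ 2))).
  rewrite divr_gt0 ?mulr_gt0 ?coupling_gt0//.
  by rewrite ltr_wpDr ?sqr_ge0.
move=> ch L g f L0 LL gc gM fy fe n w Phi n0 Lw ev.
have gA : (sobolev_oo_norm 3 (cross_section ch) (fun y => (g y)^-1)%R < A%:E)%E.
  by apply: le_lt_trans gM _; rewrite lte_fin /A (le_lt_trans (ler_norm M))// ltrDl.
have [B fB LB] := sobolev_scale_lt L0 fy fe.
have [a [va [da [Aa Ada aE aA daA]]]] := sobolev_coefficient gA.
have [b [vb [db [_ Adb bE bB dbB]]]] := sobolev_coefficient fB.
have B0 : 0 <= B := le_trans (normr_ge0 _) (bB 0).
have ca y : c <= a y <= c^-1.
  apply/andP; split.
    apply: (AC_ge Aa); apply: ae_mono aE => z H Dz; rewrite H//.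
    have /andP[g1 g2] := gc z Dz.
    by rewrite -[c]invrK lef_pV2 ?posrE ?invr_gt0 ?(ltW g2)// (lt_trans c0).
  apply: (AC_le Aa); apply: ae_mono aE => z H Dz; rewrite H//.
  have /andP[g1 g2] := gc z Dz.
  by rewrite lef_pV2 ?posrE ?(ltW g1)// (lt_trans c0).
have k0 : 0 < `|wavenumber L n|.
  by apply: lt_le_trans (wavenumber_ge L0 n0); rewrite invr_gt0.
apply: (channel_mode k0 c0 Ada Adb ca aA daA bB dbB _ bE (sobolev_measurable fB) _ Lw ev).
  apply: ae_mono aE => y H Dy; rewrite H// mulVf//.
  by have /andP[g1 _] := gc y Dy; rewrite gt_eqF// (lt_trans c0).
exact: small_coupling A0 B0 c0 L0 LL (wavenumber_ge L0 n0) LB.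
Qed.

End Coefficients.

(** * Convergence of the vorticity *)

Section Assembly.
Context {R : realType}.
Notation leb := (@lebesgue_measure R).
Notation plane := (@plane_measure R).

Section Channel.
Variables (ch : channel) (L : R).
Hypothesis L0 : 0 < L.
Notation D := (@cross_section R ch).
Notation DD := (@channel_domain R ch L).
Implicit Types (w : R * R -> R[i]) (n : int).

Let mD := @measurable_cross_section R ch.
Let mDD := @measurable_channel_domain R ch L.

Lemma fourier_modeB n w w' : in_L2 plane DD w -> in_L2 plane DD w' ->
  sqr_norm leb D (fourier_mode L n (fun z => w z - w' z)) =
  sqr_norm leb D (fun y => fourier_mode L n w y - fourier_mode L n w' y).
Proof.
move=> Lw Lw'; have Ld := in_L2B mDD Lw Lw'.
have Lm := in_L2B mD (fourier_mode_in_L2 L0 Lw n) (fourier_mode_in_L2 L0 Lw' n).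
have [md _] := fourier_mode_in_L2 L0 Ld n; have [mm _] := Lm.
have E : {ae leb, forall y,
    re_on D (fourier_mode L n (fun z => w z - w' z)) y =
      re_on D (fun y => fourier_mode L n w y - fourier_mode L n w' y) y /\
    im_on D (fourier_mode L n (fun z => w z - w' z)) y =
      im_on D (fun y => fourier_mode L n w y - fourier_mode L n w' y) y}.
  apply: ae_mono2 (on_circle_slices Lw) (on_circle_slices Lw') => y.
  move=> [/on_circle_integrable ir /on_circle_integrable ii].
  move=> [/on_circle_integrable ir' /on_circle_integrable ii'].
  rewrite re_onB im_onB !re_fourier_mode !im_fourier_mode -!mulrBr.
  have sB : re_slice ch L (fun z => w z - w' z) y =
      (fun x => re_slice ch L w y x - re_slice ch L w' y x) by rewrite /re_slice re_onB.
  have sB' : im_slice ch L (fun z => w z - w' z) y =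
      (fun x => im_slice ch L w y x - im_slice ch L w' y x) by rewrite /im_slice im_onB.
  split; congr (_ * _).
    rewrite -RintegralB//.
    - by apply: eq_Rintegral => x _; rewrite sB sB'; ring.
    - exact: (integrableD measurableT (cos_mul_integrable _ ir) (sin_mul_integrable _ ii)).
    - exact: (integrableD measurableT (cos_mul_integrable _ ir') (sin_mul_integrable _ ii')).
  rewrite -RintegralB//.
  - by apply: eq_Rintegral => x _; rewrite sB sB'; ring.
  - exact: (integrableB measurableT (cos_mul_integrable _ ii) (sin_mul_integrable _ ir)).
  - exact: (integrableB measurableT (cos_mul_integrable _ ii') (sin_mul_integrable _ ir')).
have [h1 h2] := (measurable_re_on mD md, measurable_im_on mD md).
have [h3 h4] := (measurable_re_on mD mm, measurable_im_on mD mm).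
by rewrite /sqr_norm; congr (_ + _); apply: eq_ae_ip => //; apply: ae_mono E => y [].
Qed.

Lemma sqr_normC d (T : measurableType d) (m : {measure set T -> \bar R}) (A : set T)
    (u v : T -> R[i]) :
  sqr_norm m A (fun x => u x - v x) = sqr_norm m A (fun x => v x - u x).
Proof.
rewrite /sqr_norm !re_onB !im_onB /ip; congr (_ + _); apply: eq_Rintegral => x _; ring.
Qed.

Lemma cauchy_limit (W : R -> R * R -> R[i]) :
  (forall t, 0 <= t -> in_L2 plane DD (W t)) ->
  (forall e : R, 0 < e -> exists2 T : R, 0 <= T & forall t t', T <= t -> T <= t' ->
     sqr_norm plane DD (fun z => W t' z - W t z) <= e) ->
  exists Winf : R * R -> R[i], in_L2 plane DD Winf /\
    L2norm plane DD (fun z => W t z - Winf z) @[t --> +oo%R] --> (0 : \bar R)%E.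
Proof.
move=> LW cW.
have part (p : R -> R * R -> R) : (forall t, 0 <= t -> L2 plane (p t)) ->
    (forall t t', ip plane (fun z => p t' z - p t z) (fun z => p t' z - p t z) <=
       sqr_norm plane DD (fun z => W t' z - W t z)) ->
    exists2 v, L2 plane v & forall e : R, 0 < e -> exists2 T0 : R, 0 <= T0 & forall t, T0 <= t ->
      ip plane (fun x => p t x - v x) (fun x => p t x - v x) <= e.
  move=> Lp pW; apply: L2_complete => // e e0.
  have [T T0 TP] := cW e e0; exists T => // t t' Tt Tt'.
  exact: le_trans (pW t t') (TP t t' Tt Tt').
have [r Lr rP] := part (fun t => re_on DD (W t))
  (fun t t0 => ((in_L2P plane mDD _).1 (LW t t0)).2.1)
  (fun t t' => ltac:(by rewrite /sqr_norm re_onB lerDl ip_ge0)).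
have [q Lq qP] := part (fun t => im_on DD (W t))
  (fun t t0 => ((in_L2P plane mDD _).1 (LW t t0)).2.2)
  (fun t t' => ltac:(by rewrite /sqr_norm im_onB lerDr ip_ge0)).
pose Winf z : R[i] := Complex (r z) (q z).
have [mr _] := Lr; have [mq _] := Lq.
have restr (u : R * R -> R) : L2 plane u -> L2 plane (u \_ DD).
  move=> Lu; have [mu0 _] := Lu; apply: (L2_le _ Lu).
    by apply: (measurable_restrictT u mDD).1; exact: measurable_funTS mu0.
  by move=> z; rewrite patchE; case: ifP => _; rewrite ?lexx// expr0n sqr_ge0.
have Linf : in_L2 plane DD Winf.
  apply/(in_L2P plane mDD); split; first by split; exact: measurable_funTS.
  by split; [exact: (restr _ Lr)|exact: (restr _ Lq)].
exists Winf; split=> //.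
have restr_le (u v : R * R -> R) : L2 plane (u \_ DD) -> L2 plane v ->
    ip plane (fun z => (u \_ DD) z - (v \_ DD) z) (fun z => (u \_ DD) z - (v \_ DD) z) <=
    ip plane (fun z => (u \_ DD) z - v z) (fun z => (u \_ DD) z - v z).
  move=> Lu Lv; have h1 := L2B Lu (restr _ Lv); have h2 := L2B Lu Lv.
  apply: le_Rintegral => //; [exact: L2_ip_integrable|exact: L2_ip_integrable|].
  move=> z _; rewrite -!expr2 !patchE; case: ifP => _; first exact: lexx.
  by rewrite subrr expr0n sqr_ge0.
have sq (e : R) : 0 < e -> exists2 T0 : R, 0 <= T0 & forall t, T0 <= t ->
    sqr_norm plane DD (fun z => W t z - Winf z) <= e.
  move=> e0; have e20 : 0 < e / 2 by rewrite divr_gt0.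
  have [T1 T10 h1] := rP _ e20; have [T2 T20 h2] := qP _ e20.
  exists (Num.max T1 T2); first by rewrite le_max T10.
  move=> t; rewrite ge_max => /andP[t1 t2].
  have [_ [Lre Lim]] := (in_L2P plane mDD _).1 (LW t (le_trans T10 t1)).
  rewrite /sqr_norm re_onB im_onB (splitr e); apply: lerD.
    exact: (le_trans (restr_le _ _ Lre Lr) (h1 t t1)).
  exact: (le_trans (restr_le _ _ Lim Lq) (h2 t t2)).
have norm_fin t : 0 <= t -> L2norm plane DD (fun z => W t z - Winf z) =
    (Num.sqrt (sqr_norm plane DD (fun z => W t z - Winf z)))%:E.
  by move=> t0; apply: (L2normE mDD); apply: in_L2B => //; exact: LW.
apply: cvg_EFin.
  by near=> t; rewrite norm_fin//; near: t; exact: nbhs_pinfty_ge.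
apply/cvgrPdist_le => e e0.
have [T T0 TP] := sq (e ^+ 2) (exprn_gt0 2 e0).
near=> t; have Tt : T <= t by near: t; apply: nbhs_pinfty_ge; exact: num_real.
rewrite /= norm_fin ?(le_trans T0)//= sub0r normrN ger0_norm ?sqrtr_ge0//.
by rewrite -[leRHS](ger0_norm (ltW e0)) -sqrtr_sqr ler_wsqrtr// TP.
Unshelve. all: by end_near. Qed.

End Channel.

Lemma frequency_sum_small (E : int -> R -> R -> R) K (e : R) :
  (forall n (e : R), 0 < e -> exists2 T : R, 0 <= T & forall t t', T <= t -> T <= t' -> E n t t' <= e) ->
  0 < e -> exists2 T : R, 0 <= T & forall t t', T <= t -> T <= t' ->
    frequency_sum K (fun n => E n t t') <= e.
Proof.
move=> cE; elim: K e => [|K IH] e e0.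
  have [T T0 TP] := cE 0 e e0; exists T => // t t' Tt Tt'.
  by rewrite /frequency_sum big_geq// addr0 TP.
have e30 : 0 < e / 3 by rewrite divr_gt0.
have [T1 T10 h1] := IH _ e30; have [T2 _ h2] := cE K.+1%:Z _ e30.
have [T3 _ h3] := cE (- K.+1%:Z) _ e30.
exists (Num.max T1 (Num.max T2 T3)); first by rewrite le_max T10.
move=> t t'; rewrite !ge_max => /and3P[t1 t2 t3] /and3P[t1' t2' t3'].
have := h1 t t' t1 t1'; have := h2 t t' t2 t2'; have := h3 t t' t3 t3'.
rewrite /frequency_sum big_nat_recr//= addrA.
move: (_ + _) (E _ t t') (E _ t t'); clear=> x y z; lra.
Qed.

(** The low frequencies are finitely many, and each of them is Cauchy; the high ones are
    dominated by those of the initial vorticity, uniformly in time. *)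
Lemma cauchy_of_modes (ch : channel) (L : R) (W : R -> R * R -> R[i]) : 0 < L ->
  (forall t, 0 <= t -> in_L2 plane (channel_domain ch L) (W t)) ->
  (forall n t t', 0 <= t -> t <= t' ->
     sqr_norm leb (cross_section ch) (fun y => fourier_mode L n (W t') y - fourier_mode L n (W t) y) <=
     sqr_norm leb (cross_section ch) (fourier_mode L n (W 0))) ->
  (forall n (e : R), 0 < e -> exists2 T : R, 0 <= T & forall t t', T <= t -> T <= t' ->
     sqr_norm leb (cross_section ch) (fun y => fourier_mode L n (W t') y - fourier_mode L n (W t) y) <= e) ->
  forall e : R, 0 < e -> exists2 T : R, 0 <= T & forall t t', T <= t -> T <= t' ->
     sqr_norm plane (channel_domain ch L) (fun z => W t' z - W t z) <= e.
Proof.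
move=> L0 LW bW cW e e0.
have mDD := @measurable_channel_domain R ch L.
have d0 : 0 < e / 2 / L by rewrite !divr_gt0.
have b0 n : 0 <= sqr_norm leb (cross_section ch) (fourier_mode L n (W 0)) by exact: sqr_norm_ge0.
have bB N := plane_bessel L0 (LW 0 (lexx 0)) N.
have [K KP] := frequency_tail b0 bB d0.
have [T T0 TP] := frequency_sum_small K cW d0.
exists T => //.
suff H t t' : T <= t -> T <= t' -> t <= t' ->
    sqr_norm plane (channel_domain ch L) (fun z => W t' z - W t z) <= e.
  move=> t t' Tt Tt'; have [tt'|/ltW t't] := leP t t'; first exact: H.
  by rewrite sqr_normC; exact: H.
move=> Tt Tt' tt'; have t0 := le_trans T0 Tt; have t'0 := le_trans T0 Tt'.
have Ld := in_L2B mDD (LW t' t'0) (LW t t0).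
(* half of the tolerance for the frequencies up to [K], half for the others *)
have -> : e = L * (e / 2 / L + e / 2 / L) by rewrite -mulrDl -splitr mulrC divfK// gt_eqF.
apply: (plane_parseval L0 Ld) => N.
apply: le_trans (_ : _ <= N%:R * (frequency_sum K (fun n => sqr_norm leb (cross_section ch)
   (fun y => fourier_mode L n (W t') y - fourier_mode L n (W t) y)) + e / 2 / L)) _; last first.
  by rewrite ler_wpM2l// lerD2r TP.
rewrite (_ : (fun n => sqr_norm leb _ (fourier_mode L n _)) = fun n => sqr_norm leb (cross_section ch)
   (fun y => fourier_mode L n (W t') y - fourier_mode L n (W t) y)); last first.
  by apply/funext => n; exact: (fourier_modeB L0 n (LW t' t'0) (LW t t0)).
by apply: KP => n; rewrite sqr_norm_ge0 bW.
Qed.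

End Assembly.

Theorem corollary6p1 (R : realType) (c M Lmax : R) (hc : 0 < c) :
  exists2 eps : R, 0 < eps &
  forall (ch : channel) (L : R) (I : set R) (U g f : R -> R),
    0 < L -> L <= Lmax ->
    shear_profile ch I U ->
    profile_coefficients I U g f ->
    (forall y, (@cross_section R ch)° y -> c < g y < c^-1) ->
    (sobolev_oo_norm 3 (cross_section ch) (fun y => (g y)^-1)%R <= M%:E)%E ->
    (sobolev_oo_norm 3 (cross_section ch) f < +oo)%E ->
    (L%:E * sobolev_oo_norm 3 (cross_section ch) f < eps%:E)%E ->
  forall (w0 : R * R -> R[i]) (W : R -> R * R -> R[i]),
    in_L2 (@plane_measure R) (channel_domain ch L) w0 ->
    euler_scattering_solution ch L g f w0 W ->
  exists Winf : R * R -> R[i],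
    in_L2 (@plane_measure R) (channel_domain ch L) Winf /\
    L2norm (@plane_measure R) (channel_domain ch L)
      (fun z => (W t z - Winf z)%R) @[t --> +oo%R] --> (0 : \bar R)%E.
Proof.
have [eps eps0 stable] := mode_stability M Lmax hc.
exists eps => // ch L I U g f L0 LLmax _ _ gc gM fy fe w0 W _ [LW _ W0 Wn].
have mD := @measurable_cross_section R ch.
have mean t t' : 0 <= t -> 0 <= t' -> sqr_norm (@lebesgue_measure R) (cross_section ch)
    (fun y => fourier_mode L 0 (W t') y - fourier_mode L 0 (W t) y) = 0.
  move=> t0 t'0.
  have Ld := in_L2B mD (fourier_mode_in_L2 L0 (LW t' t'0) 0) (fourier_mode_in_L2 L0 (LW t t0) 0).
  have [md _] := Ld.
  have [mr mi] := (measurable_re_on mD md, measurable_im_on mD md).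
  have E : {ae (@lebesgue_measure R), forall y,
      re_on (cross_section ch) (fun y => fourier_mode L 0 (W t') y - fourier_mode L 0 (W t) y) y = 0 /\
      im_on (cross_section ch) (fun y => fourier_mode L 0 (W t') y - fourier_mode L 0 (W t) y) y = 0}.
    apply: ae_mono2 (W0 t' t'0) (W0 t t0) => y h' h.
    rewrite /re_on /im_on !patchE; case: ifPn => [/set_mem Dy|_] //.
    by rewrite (h' Dy) (h Dy) subrr.
  have zero (u : R -> R) : measurable_fun [set: measurableTypeR R] u ->
      {ae (@lebesgue_measure R), forall y, u y = 0} -> ip (@lebesgue_measure R) u u = 0.
    move=> mu0 u0; have -> : ip (@lebesgue_measure R) u u = ip (@lebesgue_measure R) (fun=> 0) (fun=> 0).
      exact: eq_ae_ip.
    by rewrite /ip; under eq_Rintegral => x _ do rewrite mulr0; rewrite Rintegral_cst// mul0r.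
  by rewrite /sqr_norm !zero ?addr0//; apply: ae_mono E => y [].
have mode n : n != 0 -> _ := fun n0 =>
  let: ex_intro Phi P := Wn n n0 in
  stable ch L g f L0 LLmax gc gM fy fe n (fun t => fourier_mode L n (W t)) Phi n0
    (fun t t0 => fourier_mode_in_L2 L0 (LW t t0) n) P.
apply: (cauchy_limit LW); apply: (cauchy_of_modes L0 LW) => n.
  have [->|n0] := eqVneq n 0.
    by move=> t t' t0 tt'; rewrite mean// ?sqr_norm_ge0// (le_trans t0).
  by have [+ _] := mode n n0; exact.
have [->|n0] := eqVneq n 0.
  by move=> e e0; exists 0 => // t t' t0 t'0; rewrite mean// ltW.
by have [_] := mode n n0; exact.
Qed.
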